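(* Let $S$ be a smooth surface and let $\sigma\colon S\to SL(2,\mathbb C)$ be an admissible immersion with pull-back metric $g$ and shape operator $\Psi$. - $\sigma(S)$ is contained in the image of an isometric embedding of $\mathbb H^3$ if and only if $g$ is Riemannian and $\Psi$ is real. - $\sigma(S)$ is contained in the image of an isometric embedding of $AdS^3$ if and only if either $g$ is Riemannian and $i\Psi$ is real, or $g$ has signature $(1,1)$ and $\Psi$ is real. - $\sigma(S)$ is contained in the image of an isometric embedding of $-dS^3$ if and only if either $g$ has signature $(1,1)$ and $i\Psi$ is real, or $g$ is negative definite and $\Psi$ is real. - $\sigma(S)$ is contained in the image of an isometric embedding of $-\mathbb S^3$ if and only if $g$ is negative definite and $i\Psi$ is real.
   Context: $SL(2,\mathbb C)\subset Mat(2,\mathbb C)$ is endowed with the holomorphic Riemannian metric $\langle AV,AW\rangle_A=\frac12\mathrm{tr}(VW)$ for $A\in SL(2,\mathbb C)$, $V,W\in\mathfrak{sl}(2,\mathbb C)$, i.e. the restriction of $\langle M,N\rangle=\frac12(\mathrm{tr}(MN)-\mathrm{tr}(M)\mathrm{tr}(N))$. Manifolds are connected; $\mathbb CTS=TS\otimes_{\mathbb R}\mathbb C$. An immersion $\sigma\colon S\to SL(2,\mathbb C)$ is admissible if the $\mathbb C$-bilinear form $g(X,Y)=\langle d\sigma(X),d\sigma(Y)\rangle$ on $\mathbb CTS$ ($d\sigma$ extended $\mathbb C$-linearly) is non-degenerate at every point. A local normal field is a local section $\nu$ of $\sigma^*TSL(2,\mathbb C)$ with $\langle\nu,\nu\rangle=1$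 and orthogonal to $d\sigma(\mathbb CTS)$, unique up to sign; the shape operator $\Psi$ is the endomorphism of $\mathbb CTS$, defined up to sign, with $d\nu(X)=-d\sigma(\Psi(X))$ (viewing $\nu$ as $Mat(2,\mathbb C)$-valued). ''$g$ is Riemannian / negative definite / has signature $(1,1)$'' means that $g|_{TS}$ is real-valued with that signature. An endomorphism of $\mathbb CTS$ is real if it maps $TS$ to $TS$. $\mathbb R^{p,q}$ is $\mathbb R^{p+q}$ with the standard form of signature $(p,q)$. $\mathbb H^3$ is hyperbolic space; $AdS^3=\{x\in\mathbb R^{2,2}\mid\langle x,x\rangle=-1\}$; $dS^3=\{x\in\mathbb R^{3,1}\mid\langle x,x\rangle=1\}$; $\mathbb S^3$ is the unit sphere; $-dS^3$ and $-\mathbb S^3$ are $dS^3$ and $\mathbb S^3$ with the opposite of their metrics (so all four have constant sectional curvature $-1$). An embedding $\iota$ of a pseudo-Riemannian manifold $(N,h)$ into $SL(2,\mathbb C)$ is isometric if $\langle d\iota(X),d\iota(Y)\rangle=h(X,Y)$ for all $X,Y\in TN$. *)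

(* Defs.v *)
From HB Require Import structures.
From mathcomp Require Import all_boot all_order all_algebra.
From mathcomp Require Import all_classical all_reals all_analysis.
From mathcomp Require Import complex ring.
Set Implicit Arguments.
Unset Strict Implicit.
Unset Printing Implicit Defensive.
Import Order.TTheory GRing.Theory Num.Theory.
Import numFieldNormedType.Exports.
Local Open Scope classical_set_scope.
Local Open Scope ring_scope.
Local Open Scope complex_scope.

Section Smoothness.
Context {R : realType}.

(* For finite-dimensional V, this is C^k on the open set U: at each order all
   the directional derivatives are taken, and they depend on finitely many
   partial derivatives. *)
Fixpoint Ck_on {V W : normedModType R} (k : nat) (U : set V) (f : V -> W)
    : Prop :=
  match k with
  | 0 => forall x, U x -> {for x, continuous f}
  | k'.+1 => (forall x, U x -> differentiable f x) /\
             forall v : V, Ck_on k' U (fun x => 'D_v f x)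
  end.

Definition smooth_on {V W : normedModType R} (U : set V) (f : V -> W) : Prop :=
  forall k, Ck_on k U f.

(* 'M[R[i]]_2 has no topology and is not a normed space over R in the library;
   topology and real calculus on Mat(2, C) go through its identification with
   pairs (real part, imaginary part) of real matrices. *)
Definition mx_reim (M : 'M[R[i]]_2) : 'M[R]_2 * 'M[R]_2 :=
  (map_mx (@complex.Re R) M, map_mx (@complex.Im R) M).

Definition mx_of_reim (P : 'M[R]_2 * 'M[R]_2) : 'M[R[i]]_2 :=
  map_mx (real_complex R) P.1 + 'i *: map_mx (real_complex R) P.2.

Definition smooth_mx_on {V : normedModType R} (U : set V)
    (F : V -> 'M[R[i]]_2) : Prop :=
  smooth_on U (mx_reim \o F).

Definition mx_derive {V : normedModType R} (F : V -> 'M[R[i]]_2) (x v : V)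
    : 'M[R[i]]_2 :=
  mx_of_reim ('D_v (mx_reim \o F) x).

End Smoothness.

Section SL2C.
Context {R : realType}.
Implicit Types A M N : 'M[R[i]]_2.

Definition SL2C : set 'M[R[i]]_2 := [set A | \det A = 1].

Definition sl2C : set 'M[R[i]]_2 := [set V | \tr V = 0].

Definition tangent_SL2C A : set 'M[R[i]]_2 := [set A *m V | V in sl2C].

Definition mform M N : R[i] := (\tr (M *m N) - \tr M * \tr N) / 2%:R.

(* mform restricts to the left-invariant metric of SL(2, C). *)
Lemma mform_left_invariant A V W : SL2C A -> sl2C V -> sl2C W ->
  mform (A *m V) (A *m W) = \tr (V *m W) / 2%:R.
Proof.
rewrite /SL2C /sl2C /mform /= (expand_det_row _ ord0) /cofactor /mxtrace.
rewrite !big_ord_recl !big_ord0 !det_mx11 !mxE /= !big_ord_recl !big_ord0.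
rewrite !mxE !big_ord_recl !big_ord0.
set f := lift _ _; have -> : lift f ord0 = ord0 :> 'I_2 by apply: val_inj.
rewrite -/f.
rewrite !addr0 /bump /= expr0 expr1 !mul1r => dA trV trW; congr (_ / _).
have -> : V f f = - V ord0 ord0 by apply/eqP; rewrite -addr_eq0 addrC trV.
have -> : W f f = - W ord0 ord0 by apply/eqP; rewrite -addr_eq0 addrC trW.
rewrite -[RHS]mul1r -dA; ring.
Qed.

End SL2C.

Section Surfaces.
Variable R : realType.

(* Only the values of chart_map on chart_dom, and of chart_inv on the image of
   chart_dom, are meaningful. *)
Record chart (T : topologicalType) := Chart {
  chart_dom : set T;
  chart_map : T -> 'rV[R]_2;
  chart_inv : 'rV[R]_2 -> T;
  chart_dom_open : open chart_dom;
  chart_img_open : open (chart_map @` chart_dom);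
  chart_mapK : forall p, chart_dom p -> chart_inv (chart_map p) = p;
  chart_map_continuous : forall p, chart_dom p -> {for p, continuous chart_map};
  chart_inv_continuous : forall x, (chart_map @` chart_dom) x ->
    {for x, continuous chart_inv}
}.

(* chart_at selects a chart around each point; it serves only to coordinatize
   the tangent spaces, see tangent below. *)
Record surface := Surface {
  surface_space :> topologicalType;
  atlas : set (chart surface_space);
  chart_at : surface_space -> chart surface_space;
  chart_at_atlas : forall p, atlas (chart_at p);
  chart_at_dom : forall p, chart_dom (chart_at p) p;
  transition_smooth : forall c d, atlas c -> atlas d ->
    smooth_on (chart_map c @` (chart_dom c `&` chart_dom d))
              (chart_map d \o chart_inv c);
  surface_hausdorff : hausdorff_space surface_space;
  surface_second_countable : @second_countable surface_space;
  surface_connected : connected [set: surface_space]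
}.

End Surfaces.

Section SurfacesInSL2C.
Context {R : realType} {S : surface R}.
Implicit Types (sigma nu : S -> 'M[R[i]]_2) (Psi : S -> 'M[R[i]]_2) (p : S).

Definition smooth_map_on (U : set S) (f : S -> 'M[R[i]]_2) : Prop :=
  forall c, atlas c ->
    smooth_mx_on (chart_map c @` (chart_dom c `&` U)) (f \o chart_inv c).

(* T_p S and its complexification, in the coordinates of chart_at p; T_p S sits
   in the latter as the set of real vectors, via cvec. *)
Definition tangent p := 'rV[R]_2.
Definition ctangent p := 'rV[R[i]]_2.

Definition cvec {p} (v : tangent p) : ctangent p := map_mx (real_complex R) v.

Definition diff_at (f : S -> 'M[R[i]]_2) p (v : tangent p) : 'M[R[i]]_2 :=
  mx_derive (f \o chart_inv (chart_at p)) (chart_map (chart_at p) p) v.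

Definition cdiff_at (f : S -> 'M[R[i]]_2) p (X : ctangent p) : 'M[R[i]]_2 :=
  diff_at f (map_mx (@complex.Re R) X : tangent p)
  + 'i *: diff_at f (map_mx (@complex.Im R) X : tangent p).

Definition immersion_SL2C sigma : Prop :=
  [/\ forall p, SL2C (sigma p),
      smooth_map_on [set: S] sigma &
      forall p (v : tangent p), diff_at sigma v = 0 -> v = 0].

Definition pullback sigma p (X Y : ctangent p) : R[i] :=
  mform (cdiff_at sigma X) (cdiff_at sigma Y).

Definition admissible sigma : Prop :=
  immersion_SL2C sigma /\
  forall p (X : ctangent p),
    (forall Y : ctangent p, pullback sigma X Y = 0) -> X = 0.

Definition normal_field_on sigma (U : set S) nu : Prop :=
  smooth_map_on U nu /\
  forall q, U q ->
    [/\ tangent_SL2C (sigma q) (nu q),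
        mform (nu q) (nu q) = 1 &
        forall X : ctangent q, mform (nu q) (cdiff_at sigma X) = 0].

(* The matrix Psi p acts on row vectors, X |-> X *m Psi p.  The normal field may
   change with p, so Psi is constrained up to an arbitrary sign at each point. *)
Definition shape_operator sigma Psi : Prop :=
  forall p, exists (U : set S) nu,
    [/\ open U, U p, normal_field_on sigma U nu &
        forall X : ctangent p,
          cdiff_at nu X = - cdiff_at sigma (X *m Psi p : ctangent p)].

Definition real_endo Psi : Prop :=
  forall p (v : tangent p), exists w : tangent p, cvec v *m Psi p = cvec w.

Definition real_metric sigma : Prop :=
  forall p (v w : tangent p), pullback sigma (cvec v) (cvec w) \is Num.real.

Definition riemannian sigma : Prop :=
  real_metric sigma /\
  forall p (v : tangent p), v != 0 -> 0 < pullback sigma (cvec v) (cvec v).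

Definition negative_definite sigma : Prop :=
  real_metric sigma /\
  forall p (v : tangent p), v != 0 -> pullback sigma (cvec v) (cvec v) < 0.

(* T_p S has dimension 2, so v, w below form an orthogonal basis of it. *)
Definition signature11 sigma : Prop :=
  real_metric sigma /\
  forall p, exists v w : tangent p,
    [/\ 0 < pullback sigma (cvec v) (cvec v),
        pullback sigma (cvec w) (cvec w) < 0 &
        pullback sigma (cvec v) (cvec w) = 0].

End SurfacesInSL2C.

Section ModelSpaces.
Context {R : realType}.

(* the standard form of R^{p,q} *)
Definition pqform (p q : nat) (x y : 'rV[R]_(p + q)) : R :=
  \sum_(i < p) x 0 (lshift q i) * y 0 (lshift q i)
  - \sum_(j < q) x 0 (rshift p j) * y 0 (rshift p j).

(* hyperboloid model: upper sheet of <x, x> = -1 in R^{3,1} *)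
Definition H3 : set 'rV[R]_(3 + 1) :=
  [set x | pqform x x = -1 /\ 0 < x 0 (rshift 3 ord0)].

Definition AdS3 : set 'rV[R]_(2 + 2) := [set x | pqform x x = -1].

Definition dS3 : set 'rV[R]_(3 + 1) := [set x | pqform x x = 1].

Definition S3 : set 'rV[R]_(4 + 0) := [set x | pqform x x = 1].

(* F is a smooth extension of iota|_N to a neighbourhood of x in R^n. *)
Definition local_extension n (N : set 'rV[R]_n) (iota F : 'rV[R]_n -> 'M[R[i]]_2)
    (x : 'rV[R]_n) : Prop :=
  exists U : set 'rV[R]_n,
    [/\ open U, U x, smooth_mx_on U F &
        forall y, U y -> N y -> F y = iota y].

(* N is to be an open subset of a level set {h(x, x) = c}, c <> 0, of a
   non-degenerate symmetric bilinear form h (or of its opposite), so that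
   T_x N = {v | h(x, v) = 0}; N carries the metric induced by h.  For v in
   T_x N, the value of mx_derive F x v does not depend on the choice of F. *)
Definition isometric_embedding n (N : set 'rV[R]_n)
    (h : 'rV[R]_n -> 'rV[R]_n -> R) (iota : 'rV[R]_n -> 'M[R[i]]_2) : Prop :=
  [/\ forall x, N x -> SL2C (iota x),
      forall x, N x -> exists F, local_extension N iota F x,
      forall x F, N x -> local_extension N iota F x ->
        forall v, h x v = 0 -> mx_derive F x v = 0 -> v = 0,
      {within N, continuous (mx_reim \o iota)} /\
        (exists j : 'M[R]_2 * 'M[R]_2 -> 'rV[R]_n,
          (forall x, N x -> j (mx_reim (iota x)) = x) /\
          {within (mx_reim \o iota) @` N, continuous j}) &
      forall x F, N x -> local_extension N iota F x ->
        forall v w, h x v = 0 -> h x w = 0 ->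
          mform (mx_derive F x v) (mx_derive F x w) = (h v w)%:C].

Definition in_isometric_image (S : Type) (sigma : S -> 'M[R[i]]_2)
    n (N : set 'rV[R]_n) (h : 'rV[R]_n -> 'rV[R]_n -> R) : Prop :=
  exists iota, isometric_embedding N h iota /\ range sigma `<=` iota @` N.

End ModelSpaces.

(* Main.v *)
Require Import Defs.
From HB Require Import structures.
From mathcomp Require Import all_boot all_order all_algebra.
From mathcomp Require Import all_classical all_reals all_analysis.
From mathcomp Require Import complex ring lra.
Set Implicit Arguments.
Unset Strict Implicit.
Unset Printing Implicit Defensive.
Import Order.TTheory GRing.Theory Num.Theory.
Import numFieldNormedType.Exports.
Local Open Scope classical_set_scope.
Local Open Scope ring_scope.
Local Open Scope complex_scope.

(** The quadratic form of [mform] is [- det], so [SL(2, C)] is the quadric of vectors of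
    square [-1] in [Mat(2, C) = C^4], and every quadric [h(x, x) = -1] of a real form of [C^4]
    is contained in it. The four models are such quadrics, for the signatures [(3,1)], [(2,2)],
    [(1,3)] and [(0,4)]. The theorem says that a surface lies in a model exactly when it lies
    in a real form of [C^4] of the right signature, and that the latter can be read off from
    [g] and [Psi].

    First, every isometric embedding of a model is the restriction of a linear map from [R^4]
    ([isometric_embedding_linear]). Its extension to the cone over the model, homogeneous of
    degree one, is an isometric map from an open set of flat [R^4]; the expression
    [<D_z D_v G, D_w G>] is symmetric in [(z, v)] and antisymmetric in [(v, w)], so the second
    derivative vanishes. The linear map found near a point is unique, so connectedness
    of [S] makes it the same for the whole surface ([in_linear_image]). Conversely,
    a linear isometry restricts to an isometric embedding ([span_map_isometric_embedding]).

    Suppose that [sigma] takes values in a real form [W], the fixed points of a conjugation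
    [C]. Then [d sigma] maps real vectors into [W], and [C] maps a unit normal to a unit normal,
    that is, to itself or to its opposite, with the same sign everywhere by connectedness
    ([conj_normal_sign]). So [kappa nu] lies in [W] for [kappa = 1] or [kappa = 'i], and
    differentiating it shows that [kappa Psi] is real ([real_shape]). An orthogonal basis of the
    tangent plane, together with [sigma] and [kappa nu], is an orthogonal basis of [W];
    the signature of [W] then determines that of [g] and [kappa] ([hyperbolic_signs],
    [antidesitter_signs], [desitter_signs], [spherical_signs]).

    Conversely, suppose that [g] and [kappa Psi] are real. The frame [(sigma, d sigma (e_1),
    d sigma (e_2), kappa nu)] of [C^4] has real Gram matrix, and the products of its derivatives
    with its members are real, by the Koszul formula and the definition of [Psi]. Hence
    it moves with real coefficients, and the conjugation that fixes it is locally constant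
    ([frame_conj_cst]); it depends neither on the chart nor on the sign of [nu], so it is
    constant on [S] ([adapted_conj_global]). The surface lies in the real span of the frame at
    one point, whose signature is [-1], the signature of [g], and [kappa^2]; for the
    hyperbolic space, connectedness selects one sheet of the hyperboloid ([one_sheet]). *)

(** * Calculus of C^k maps *)

Lemma open_near (T : topologicalType) (U : set T) x : open U -> U x ->
  \forall y \near x, U y.
Proof. by move=> oU Ux; apply: open_nbhs_nbhs. Qed.

Section RealSmooth.
Context {R : realType} {V : normedModType R}.
Implicit Types (U : set V) (f g : V -> R) (x y v w : V).

(** The difference of the two functions vanishes near [x], so it is differentiable. *)
Lemma near_eq_differentiable {W : normedModType R} (f g : V -> W) x :
  (\near x, f x = g x) -> differentiable f x -> differentiable g x.
Proof.
move=> fg df.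
have fgx : f x = g x := nbhs_singleton fg.
have key : (g \- f) \o shift x = cst ((g \- f) x) + (\0 : {linear V -> W}) +o_ 0 id.
  apply/eqaddoP => e e0; near=> y.
  have -> : ((g \- f) \o shift x - (cst ((g \- f) x) + (\0 : {linear V -> W}))) y = 0.
    rewrite !fctE /= /GRing.null_fun fgx subrr addr0 subr0.
    apply/eqP; rewrite subr_eq0; apply/eqP/esym.
    near: y; rewrite -[X in \forall y \near X, _]/(nbhs 0).
    have := fg; rewrite (near_shift 0 x) /=; apply: filterS => y /=.
    by rewrite subr0.
  by rewrite normr0 mulr_ge0// ltW.
have dgf : differentiable (g \- f) x.
  apply/diff_locallyP; split.
    rewrite (diff_unique _ key); exact: cst_continuous.
  rewrite [X in _ = _ + X +o_ _ _](diff_unique _ key) //; exact: cst_continuous.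
have -> : g = (g \- f) + f by apply/funext => y; rewrite !fctE subrK.
exact: differentiableD.
Unshelve. all: by end_near. Qed.

Lemma Ck_on_eq {W : normedModType R} k U (f g : V -> W) : open U ->
  (forall x, U x -> f x = g x) -> Ck_on k U f -> Ck_on k U g.
Proof.
move=> oU; elim: k f g => [|k IH] f g fg /=.
  move=> cf x Ux; rewrite /prop_for /continuous_at -(fg _ Ux).
  apply: cvg_trans (cf x Ux); apply: near_eq_cvg.
  by apply: filterS (open_near oU Ux) => y /fg.
move=> [df cf]; split=> [x Ux|v].
  apply: near_eq_differentiable (df x Ux).
  by apply: filterS (open_near oU Ux) => y /fg.
apply: IH (cf v) => x Ux; apply: near_eq_derive.
by apply: filterS (open_near oU Ux) => y /fg.
Qed.

Lemma Ck_onW {W : normedModType R} k U (f : V -> W) : Ck_on k.+1 U f -> Ck_on k U f.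
Proof.
elim: k f => [|k IH] f /= [df cf].
  by move=> x Ux; apply: differentiable_continuous; exact: df.
by split => // v; apply: IH; exact: cf.
Qed.

Lemma Ck_onS {W : normedModType R} k U U' (f : V -> W) :
  U' `<=` U -> Ck_on k U f -> Ck_on k U' f.
Proof.
move=> UU'; elim: k f => [|k IH] f /=; first by move=> cf x /UU'; exact: cf.
by move=> [df cf]; split => [x /UU'|v]; [exact: df | exact/IH/cf].
Qed.

Lemma Ck_on_cst {W : normedModType R} k U (c : W) : open U -> Ck_on k U (fun=> c).
Proof.
move=> oU; elim: k c => [|k IH] c /=; first by move=> x _; exact: cst_continuous.
split=> [x _|v]; first exact: differentiable_cst.
by apply: Ck_on_eq (IH 0) => // x _; rewrite derive_cst.
Qed.

Lemma Ck_onD {W : normedModType R} k U (f g : V -> W) : open U ->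
  Ck_on k U f -> Ck_on k U g -> Ck_on k U (fun x => f x + g x).
Proof.
move=> oU; elim: k f g => [|k IH] f g /=.
  by move=> cf cg x Ux; apply: continuousD; [exact: cf|exact: cg].
move=> [df cf] [dg cg]; split=> [x Ux|v].
  by apply: differentiableD; [exact: df|exact: dg].
apply: Ck_on_eq (IH _ _ (cf v) (cg v)) => // x Ux.
by rewrite -deriveD //; apply: diff_derivable; [exact: df|exact: dg].
Qed.

Lemma Ck_onM k U f g : open U ->
  Ck_on k U f -> Ck_on k U g -> Ck_on k U (fun x => f x * g x).
Proof.
move=> oU; elim: k f g => [|k IH] f g.
  by move=> /= cf cg x Ux; apply: continuousM; [exact: cf|exact: cg].
move=> Cf Cg; have [df cf] := Cf; have [dg cg] := Cg.
split=> [x Ux|v].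
  by apply: (@differentiableM _ _ f g); [exact: df|exact: dg].
apply: (@Ck_on_eq _ k U (fun x => f x * 'D_v g x + g x * 'D_v f x)) => //.
  move=> x Ux; rewrite -[fun y => f y * g y]/(f * g) deriveM //.
    by apply: diff_derivable; exact: df.
  by apply: diff_derivable; exact: dg.
by apply: Ck_onD => //; apply: IH; [exact: Ck_onW|exact: cg|exact: Ck_onW|exact: cf].
Qed.

(* postcomposition with a continuous linear map *)
Lemma derive_linear {W W' : normedModType R} (l : {linear W -> W'}) (f : V -> W) x v :
  continuous l -> differentiable f x -> 'D_v (l \o f) x = l ('D_v f x).
Proof.
move=> cl df; have dl : differentiable l (f x) by exact: linear_differentiable.
rewrite deriveE; last exact: differentiable_comp.
by rewrite diff_comp //= [in RHS]deriveE // diff_lin.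
Qed.

Lemma Ck_on_linear {W W' : normedModType R} (l : {linear W -> W'}) k U (f : V -> W) :
  open U -> continuous l -> Ck_on k U f -> Ck_on k U (l \o f).
Proof.
move=> oU cl; elim: k f => [|k IH] f /=.
  by move=> cf x Ux; apply: continuous_comp; [exact: cf|exact: cl].
move=> [df cf]; split=> [x Ux|v].
  apply: differentiable_comp; first exact: df.
  exact: linear_differentiable.
apply: Ck_on_eq (IH _ (cf v)) => // x Ux.
by rewrite derive_linear //; exact: df.
Qed.

End RealSmooth.

(** * Mean values and mixed derivatives *)

Section Lines.
Context {R : realType} {V W : normedModType R}.

Lemma is_derive_line (f : V -> W) p v (a : R) : derivable f (p + a *: v) v ->
  is_derive a 1 (fun t : R => f (p + t *: v)) ('D_v f (p + a *: v)).
Proof.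
have key : (fun h : R => h^-1 *: (f (p + (h *: (1 : R^o) + a) *: v) - f (p + a *: v)))
         = (fun h : R => h^-1 *: (f (h *: v + (p + a *: v)) - f (p + a *: v))).
  apply/funext => h; congr (_ *: (f _ - _)).
  by rewrite [h *: _]mulr1 scalerDl addrCA.
move=> df; split; rewrite /derivable /derive /= ?key //.
Qed.

End Lines.

Section MeanValue.
Context {R : realType} {V : normedModType R}.
Implicit Types (U : set V) (f g : V -> R) (x y v w : V).

Lemma line_MVT f p v (t : R) : 0 < t ->
  (forall a, 0 <= a <= t -> differentiable f (p + a *: v)) ->
  exists2 a, 0 <= a <= t & f (p + t *: v) - f p = t * 'D_v f (p + a *: v).
Proof.
move=> t0 df.
have dl (a : R) : 0 <= a <= t ->
    is_derive a 1 (fun t : R => f (p + t *: v)) ('D_v f (p + a *: v)).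
  by move=> /df dfa; apply: is_derive_line; exact: diff_derivable.
have [||a] := @MVT R (fun t : R => f (p + t *: v))
    (fun a => 'D_v f (p + a *: v)) 0 t t0.
- by move=> a /andP[/= a0 a1]; apply: dl; rewrite !ltW.
- apply: derivable_within_continuous => a; rewrite in_itv /= => /dl.
  by case.
rewrite in_itv /= => /andP[a0 a1] H.
exists a; first by rewrite !ltW.
by move: H; rewrite /= scale0r addr0 subr0 mulrC.
Qed.

Lemma ball_line (x y : V) (e a : R) : 0 < e -> ball x e y -> 0 <= a <= 1 ->
  ball x e (x + a *: (y - x)).
Proof.
move=> e0; rewrite -!ball_normE /= => xy /andP[a0 a1].
rewrite opprD addrA subrr sub0r normrN normrZ ger0_norm // distrC.
by rewrite (le_lt_trans _ xy) // ler_piMl.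
Qed.

Lemma derive0_ball_cst f (x : V) (e : R) :
  (forall y, ball x e y -> differentiable f y /\ forall v, 'D_v f y = 0) ->
  forall y, ball x e y -> f y = f x.
Proof.
move=> df y xy.
have e0 : 0 < e by move: xy; rewrite -ball_normE /=; apply: le_lt_trans.
have [|a a01] := @line_MVT f x (y - x) 1 ltr01.
  by move=> a a01; apply: (df _ _).1; exact: ball_line.
rewrite (df _ _).2; last exact: ball_line.
by rewrite scale1r [x + (y - x)]addrC subrK mulr0 => /subr0_eq.
Qed.

Lemma second_difference f U x v w (t : R) : Ck_on 2 U f -> 0 < t ->
  (forall a b, 0 <= a <= t -> 0 <= b <= t -> U (x + a *: v + b *: w)) ->
  exists a b, [/\ 0 <= a <= t, 0 <= b <= t &
    f (x + t *: v + t *: w) - f (x + t *: v) - (f (x + t *: w) - f x)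
      = t * (t * 'D_w ('D_v f) (x + a *: v + b *: w))].
Proof.
move=> [df ddf] t0 inU.
have t00 : 0 <= (0 : R) <= t by rewrite lexx ltW.
have tt : 0 <= t <= t by rewrite lexx ltW.
have dshift (y z : V) : differentiable f (z + y) -> differentiable (f \o shift y) z.
  by move=> dfy; apply: differentiable_comp.
have Dshift (y z : V) : 'D_v (f \o shift y) z = 'D_v f (z + y).
  rewrite /derive.
  have -> // : (fun h : R => h^-1 *: ((f \o shift y \o shift z) (h *: v) - (f \o shift y) z))
    = (fun h => h^-1 *: ((f \o shift (z + y)) (h *: v) - f (z + y))).
  by apply/funext => h /=; rewrite addrA.
have [|a at_ H] := @line_MVT (f \o shift (t *: w) \- f) x v t t0.
  move=> a at_; apply: differentiableB; last first.
    by apply: df; rewrite -[_ + _]addr0 -(scale0r w); exact: inU.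
  by apply: dshift; apply: df; exact: inU.
have [|b bt H'] := @line_MVT ('D_v f) (x + a *: v) w t t0.
  move=> b bt; apply: ((ddf v).1 _ _); exact: inU.
exists a, b; split=> //.
rewrite -H'; move: H; rewrite /= => ->; congr (_ * _).
rewrite deriveB; first by rewrite Dshift.
  by apply/diff_derivable/dshift/df/inU.
by apply/diff_derivable/df; rewrite -[_ + _]addr0 -(scale0r w); exact: inU.
Qed.

Lemma near_dist_lt2 (f g : V -> R) x (e : R) : {for x, continuous f} ->
  {for x, continuous g} -> 0 < e ->
  \forall y \near x, `|f x - f y| < e /\ `|g x - g y| < e.
Proof.
move=> /cvgrPdist_lt cf /cvgrPdist_lt cg e0.
by apply: filterS (filterI (cf e e0) (cg e e0)).
Qed.

Lemma dist_lt_halves (a b c d e : R) : c = d -> `|a - c| < e / 2 -> `|b - d| < e / 2 ->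
  `|a - b| < e.
Proof.
move=> -> ac bd; rewrite (splitr e) -(subrKA d) (le_lt_trans (ler_normD _ _)) // ltrD //.
by rewrite distrC.
Qed.

(** Both mixed derivatives are limits of the same second difference of [f]
    over a small parallelogram. *)
Lemma derive_derive_sym f U x v w : open U -> U x -> Ck_on 2 U f ->
  'D_w ('D_v f) x = 'D_v ('D_w f) x.
Proof.
move=> oU Ux Cf.
have cvw : {for x, continuous ('D_w ('D_v f))} by apply: ((Cf.2 v).2 w x Ux).
have cwv : {for x, continuous ('D_v ('D_w f))} by apply: ((Cf.2 w).2 v x Ux).
apply/eqP; rewrite -subr_eq0 -normr_le0; apply/ler_addgt0Pl => e e0; rewrite addr0.
have e2 : 0 < e / 2 by rewrite divr_gt0.
have near_U : \forall y \near x, U y /\ (`|'D_w ('D_v f) x - 'D_w ('D_v f) y| < e / 2 /\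
    `|'D_v ('D_w f) x - 'D_v ('D_w f) y| < e / 2).
  exact: (filterI (open_near oU Ux) (near_dist_lt2 cvw cwv e2)).
have /nbhs_ballP[r /= r0 near_x] := near_U.
(* Small enough for the parallelogram with sides [t *: v] and [t *: w] to lie in the ball. *)
pose t := r / 2 / (`|v| + `|w| + 1).
have vw0 : 0 < `|v| + `|w| + 1 by rewrite ltr_wpDl // addr_ge0.
have t0 : 0 < t by rewrite !divr_gt0.
have inB a b : 0 <= a <= t -> 0 <= b <= t -> ball x r (x + a *: v + b *: w).
  move=> /andP[a0 at_] /andP[b0 bt]; rewrite -ball_normE /=.
  rewrite -addrA opprD addrA subrr sub0r normrN.
  rewrite (le_lt_trans (ler_normD _ _)) // !normrZ !ger0_norm //.
  apply: (@le_lt_trans _ _ (t * (`|v| + `|w| + 1))).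
    by rewrite mulrDr mulrDr ler_wpDr ?mulr1 ?(ltW t0) // lerD // ler_wpM2r.
  by rewrite /t divfK ?gt_eqF // ltr_pdivrMr // ltr_pMr // ltr1n.
have [a [b [aP bP E1]]] := second_difference Cf t0
  (fun a b aP bP => let: conj h _ := near_x _ (inB a b aP bP) in h).
have inB' (b1 a1 : R) : 0 <= b1 <= t -> 0 <= a1 <= t -> ball x r (x + b1 *: w + a1 *: v).
  by move=> *; rewrite addrAC; exact: inB.
have [b' [a' [bP' aP' E2]]] := @second_difference f U x w v t Cf t0
  (fun b a bP aP => let: conj h _ := near_x _ (inB' b a bP aP) in h).
have [_ [H1 _]] := near_x _ (inB a b aP bP).
have [_ [_ H2]] := near_x _ (inB' b' a' bP' aP').
have E : 'D_w ('D_v f) (x + a *: v + b *: w) = 'D_v ('D_w f) (x + b' *: w + a' *: v).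
  apply: (mulfI (lt0r_neq0 t0)); apply: (mulfI (lt0r_neq0 t0)).
  apply: etrans (esym E1) _; apply: etrans E2.
  by rewrite [x + t *: w + t *: v]addrAC; ring.
exact/ltW/(dist_lt_halves E H1 H2).
Qed.

End MeanValue.

(** * Composition of smooth functions *)

Section SmoothFunctions.
Context {R : realType} {V : normedModType R}.
Implicit Types (U : set V) (f g : V -> R) (x y v w : V).

Lemma smooth_derive {W : normedModType R} U (f : V -> W) v :
  smooth_on U f -> smooth_on U ('D_v f).
Proof. by move=> sf k; exact: (sf k.+1).2. Qed.

Lemma smooth_differentiable {W : normedModType R} U (f : V -> W) x :
  smooth_on U f -> U x -> differentiable f x.
Proof. by move=> sf; exact: (sf 1).1. Qed.

Lemma differentiable_coords n (phi : V -> 'rV[R]_n) x :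
  (forall i, differentiable (fun y => phi y 0 i) x) -> differentiable phi x.
Proof.
move=> dphi.
have -> : phi = \sum_(i < n) (fun y => phi y 0 i *: delta_mx 0 i).
  by apply/funext => y; rewrite fct_sumE [LHS]row_sum_delta.
apply: differentiable_sum => i.
exact: (@differentiableZl _ _ _ (fun y => phi y 0 i) (delta_mx 0 i)).
Qed.

Lemma coord_linear n (i : 'I_n) : exists2 l : {linear 'rV[R]_n -> R^o},
  continuous l & forall u, l u = u 0 i.
Proof.
have @l : {linear 'rV[R]_n -> R^o}.
  by exists (fun N : 'rV[R]_n => N 0 i); do 2![eexists]; do ?[constructor];
     rewrite ?mxE// => ? *; rewrite ?mxE//; move=> ?; rewrite !mxE.
by exists l => //; exact: coord_continuous.
Qed.

Lemma derive_dir_linear f x (a : R) v w : differentiable f x ->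
  'D_(a *: v + w) f x = a * 'D_v f x + 'D_w f x.
Proof.
move=> df; rewrite (deriveE (a *: v + w) df) (deriveE v df) (deriveE w df).
exact: linearP.
Qed.

Lemma derive_coord n (phi : V -> 'rV[R]_n) x v i : differentiable phi x ->
  'D_v (fun y => phi y 0 i) x = 'D_v phi x 0 i.
Proof.
move=> dphi; have [l cl lE] := coord_linear i.
have -> : (fun y => phi y 0 i) = l \o phi by apply/funext => y /=; rewrite lE.
by rewrite derive_linear // lE.
Qed.

(** The chain rule in terms of partial derivatives: the regularity of a composite
    then reduces to that of sums and products. *)
Lemma derive_comp n (f : 'rV[R]_n -> R) (phi : V -> 'rV[R]_n) x v :
  differentiable phi x -> differentiable f (phi x) ->
  'D_v (f \o phi) x = \sum_(i < n) 'D_v phi x 0 i * 'D_(delta_mx 0 i) f (phi x).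
Proof.
move=> dphi df; rewrite deriveE; last exact: differentiable_comp.
rewrite diff_comp //= -[in LHS](deriveE v dphi) [in LHS](row_sum_delta ('D_v phi x)).
rewrite linear_sum; apply: eq_bigr => i _.
by rewrite [LHS]linearZ (deriveE (delta_mx 0 i) df).
Qed.

Lemma Ck_on_sum {W : normedModType R} (I : finType) k U (F : I -> V -> W) : open U ->
  (forall i, Ck_on k U (F i)) -> Ck_on k U (fun x => \sum_i F i x).
Proof.
move=> oU CF.
suff H (s : seq I) : Ck_on k U (fun x => \sum_(i <- s) F i x).
  by apply: Ck_on_eq (H (index_enum _)).
elim: s => [|i s IH].
  apply: Ck_on_eq (Ck_on_cst k 0 oU) => // x _; by rewrite big_nil.
apply: Ck_on_eq (Ck_onD oU (CF i) IH) => // x _; by rewrite big_cons.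
Qed.

Lemma Ck_on_comp n k U (U' : set 'rV[R]_n) (f : 'rV[R]_n -> R) (phi : V -> 'rV[R]_n) : open U ->
  (forall x, U x -> U' (phi x)) -> Ck_on k U' f ->
  (forall i, Ck_on k U (fun x => phi x 0 i)) -> Ck_on k U (f \o phi).
Proof.
move=> oU UU'; elim: k f => [|k IH] f.
  move=> /= cf cphi x Ux; apply: continuous_comp; last by apply: cf; exact: UU'.
  have -> : phi = \sum_(i < n) (fun y => phi y 0 i *: delta_mx 0 i).
    by apply/funext => y; rewrite fct_sumE [LHS]row_sum_delta.
  apply: (big_ind (fun g : V -> 'rV[R]_n => {for x, continuous g})) => [|g h|i _].
  - exact: cst_continuous.
  - exact: continuousD.
  - by apply: cvgZr_tmp; exact: cphi.
move=> Cf Cphi.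
have dphi x : U x -> differentiable phi x.
  by move=> Ux; apply: differentiable_coords => i; exact: (Cphi i).1.
split=> [x Ux|v].
  apply: differentiable_comp; first exact: dphi.
  by apply: Cf.1; exact: UU'.
apply: (@Ck_on_eq _ _ _ k U (fun x => \sum_(i < n)
   'D_v (fun y => phi y 0 i) x * ('D_(delta_mx 0 i) f \o phi) x)) => //.
  move=> x Ux; rewrite derive_comp; [|exact: dphi|by apply: Cf.1; exact: UU'].
  by apply: eq_bigr => i _; rewrite derive_coord //; exact: dphi.
apply: Ck_on_sum => // i; apply: Ck_onM => //; first exact: (Cphi i).2.
by apply: IH; [exact: Cf.2 | move=> j; exact: Ck_onW].
Qed.

End SmoothFunctions.

Section SmoothClosure.
Context {R : realType} {V : normedModType R}.
Implicit Types (U : set V) (x y v w : V).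

Lemma rsqrt_derive (y : R) : 0 < y ->
  is_derive y 1 (fun t : R => (Num.sqrt t)^-1) (- (2^-1) * (Num.sqrt y)^-1 ^+ 3).
Proof.
move=> y0; have sy0 : Num.sqrt y != 0 by rewrite gt_eqF // sqrtr_gt0.
have [d1 d2] := is_derive1_sqrt y0.
split; first exact: (@derivableV _ _ Num.sqrt).
rewrite (@deriveV _ _ Num.sqrt) // d2 /=.
rewrite -[_ *: _]/(_ * _); field.
by rewrite sy0.
Qed.

(** The function [r = 1 / sqrt u] solves [D_v r = - r^3 D_v u / 2], so the regularity of [r]
    up to some order gives its regularity up to the next one. *)
Lemma smooth_rsqrt U (u : V -> R) : open U -> (forall x, U x -> 0 < u x) ->
  smooth_on U u -> smooth_on U (fun x => (Num.sqrt (u x))^-1).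
Proof.
move=> oU u0 su; pose r x := (Num.sqrt (u x))^-1.
have dr x : U x -> differentiable r x /\
    forall v, 'D_v r x = - (2^-1) * r x ^+ 3 * 'D_v u x.
  move=> Ux; have [df Df] := rsqrt_derive (u0 x Ux).
  have du := smooth_differentiable su Ux.
  have dc : differentiable (fun t : R => (Num.sqrt t)^-1) (u x).
    exact/derivable1_diffP.
  have drx : differentiable r x by exact: (differentiable_comp du dc).
  split=> // v; rewrite deriveE // (diff_comp du dc) /= -(deriveE v du).
  by rewrite deriv1E // derive1E Df /=; exact: mulrC.
elim=> [|k IH]; first by move=> x /dr[drx _]; exact: differentiable_continuous.
split=> [x /dr[]//|v].
apply: (@Ck_on_eq _ _ _ k U (fun x => - (2^-1) * (r x * (r x * r x)) * 'D_v u x)) => //.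
  move=> x /dr[_ ->]; by rewrite !exprS expr0 mulr1.
apply: Ck_onM => //; last exact: (su k.+1).2.
apply: Ck_onM => //; first exact: Ck_on_cst.
by do 2?apply: Ck_onM.
Qed.

Lemma smoothD {W : normedModType R} U (f g : V -> W) : open U ->
  smooth_on U f -> smooth_on U g -> smooth_on U (fun x => f x + g x).
Proof. by move=> oU sf sg k; exact: Ck_onD. Qed.

Lemma smoothM U (f g : V -> R) : open U ->
  smooth_on U f -> smooth_on U g -> smooth_on U (fun x => f x * g x).
Proof. by move=> oU sf sg k; exact: Ck_onM. Qed.

Lemma smooth_cst {W : normedModType R} U (c : W) : open U -> smooth_on U (fun=> c).
Proof. by move=> oU k; exact: Ck_on_cst. Qed.

Lemma smoothN U (f : V -> R) : open U -> smooth_on U f -> smooth_on U (fun x => - f x).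
Proof.
move=> oU sf k; have H : Ck_on k U (fun=> - 1 : R) by exact: Ck_on_cst.
by apply: Ck_on_eq (Ck_onM oU H (sf k)) => // x _; rewrite mulN1r.
Qed.

Lemma smooth_eq {W : normedModType R} U (f g : V -> W) : open U ->
  (forall x, U x -> f x = g x) -> smooth_on U f -> smooth_on U g.
Proof. by move=> oU fg sf k; exact: Ck_on_eq (sf k). Qed.

Lemma smooth_sum {W : normedModType R} (I : finType) U (F : I -> V -> W) : open U ->
  (forall i, smooth_on U (F i)) -> smooth_on U (fun x => \sum_i F i x).
Proof. by move=> oU sF k; apply: Ck_on_sum => // i; exact: sF. Qed.

Lemma smooth_linear {W W' : normedModType R} (l : {linear W -> W'}) U (f : V -> W) :
  open U -> continuous l -> smooth_on U f -> smooth_on U (l \o f).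
Proof. by move=> oU cl sf k; exact: Ck_on_linear. Qed.

Lemma smooth_scale {W : normedModType R} U (f : V -> R) (c : W) : open U ->
  smooth_on U f -> smooth_on U (fun x => f x *: c).
Proof.
move=> oU sf.
have sc_lin : linear ( *:%R ^~ c : R -> W) by move=> u y z; rewrite scalerDl scalerA.
pose sclM := GRing.isLinear.Build _ _ _ _ _ sc_lin.
pose sc : {linear _ -> _} := HB.pack ( *:%R ^~ c) sclM.
by apply: (smooth_linear (l := sc)) => //; exact: scalel_continuous.
Qed.

Lemma smooth_coord n U (phi : V -> 'rV[R]_n) i : open U ->
  smooth_on U phi -> smooth_on U (fun x => phi x 0 i).
Proof.
move=> oU sphi; have [l cl lE] := coord_linear (R := R) i.
by apply: smooth_eq (smooth_linear oU cl sphi) => // x _ /=; rewrite lE.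
Qed.

Lemma smooth_id U : open U -> smooth_on U (@id V).
Proof.
move=> oU [|k] /=; first by move=> x _; exact: cvg_id.
split=> // v; apply: Ck_on_eq (Ck_on_cst k v oU) => // x _.
by rewrite derive_id.
Qed.

Lemma smoothS {W : normedModType R} U U' (f : V -> W) : U' `<=` U ->
  smooth_on U f -> smooth_on U' f.
Proof. by move=> UU' sf k; exact: Ck_onS UU' (sf k). Qed.

Lemma smooth_continuous {W : normedModType R} U (f : V -> W) x : smooth_on U f ->
  U x -> {for x, continuous f}.
Proof. by move=> sf; exact: (sf 0%N). Qed.

End SmoothClosure.

(** * Complex-valued smooth functions *)

(** Locked, so that two derivatives are compared through their arguments and never by
    unfolding the limits that define them. *)
HB.lock Definition cderive (R : realType) (V : normedModType R) (f : V -> R[i])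
    (x v : V) : R[i] :=
  'D_v (@complex.Re R \o f) x +i* 'D_v (@complex.Im R \o f) x.

Section ComplexSmooth.
Context {R : realType} {V : normedModType R}.
Implicit Types (U : set V) (f g : V -> R[i]) (x y v w : V).

Notation Re := (@complex.Re R).
Notation Im := (@complex.Im R).

Definition csmooth_on U f := smooth_on U (Re \o f) /\ smooth_on U (Im \o f).

Lemma cderiveE f x v : cderive f x v = 'D_v (Re \o f) x +i* 'D_v (Im \o f) x.
Proof. by rewrite cderive.unlock. Qed.

Lemma csmooth_eq U f g : open U -> (forall x, U x -> f x = g x) ->
  csmooth_on U f -> csmooth_on U g.
Proof.
by move=> oU fg [sr si]; split; [move: sr|move: si]; apply: smooth_eq => // x /fg /= ->.
Qed.

Lemma csmoothS U U' f : U' `<=` U -> csmooth_on U f -> csmooth_on U' f.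
Proof. by move=> UU' [sr si]; split; apply: smoothS UU' _. Qed.

Lemma csmooth_cst U c : open U -> csmooth_on U (fun=> c).
Proof. by move=> oU; split; exact: smooth_cst. Qed.

Lemma csmoothD U f g : open U -> csmooth_on U f -> csmooth_on U g ->
  csmooth_on U (fun x => f x + g x).
Proof.
move=> oU [fr fi] [gr gi]; split.
  by apply: smooth_eq (smoothD oU fr gr) => // x _ /=; rewrite raddfD.
by apply: smooth_eq (smoothD oU fi gi) => // x _ /=; rewrite raddfD.
Qed.

Lemma ReM (a b : R[i]) : Re (a * b) = Re a * Re b - Im a * Im b.
Proof. by case: a => ? ?; case: b. Qed.

Lemma ImM (a b : R[i]) : Im (a * b) = Re a * Im b + Im a * Re b.
Proof. by case: a => ? ?; case: b. Qed.

Lemma csmoothM U f g : open U -> csmooth_on U f -> csmooth_on U g ->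
  csmooth_on U (fun x => f x * g x).
Proof.
move=> oU [fr fi] [gr gi]; split.
  apply: smooth_eq (smoothD oU (smoothM oU fr gr)
    (smoothN oU (smoothM oU fi gi))) => // x _ /=.
  by rewrite ReM.
apply: smooth_eq (smoothD oU (smoothM oU fr gi) (smoothM oU fi gr)) => // x _ /=.
by rewrite ImM.
Qed.

Lemma csmooth_conj U f : open U -> csmooth_on U f -> csmooth_on U (fun x => conjc (f x)).
Proof.
move=> oU [fr fi]; split.
  by apply: smooth_eq fr => // x _ /=; case: (f x).
apply: smooth_eq (smoothN oU fi) => // x _ /=.
by case: (f x).
Qed.

Lemma csmooth_real U (u : V -> R) : open U -> smooth_on U u ->
  csmooth_on U (fun x => (u x)%:C).
Proof. by move=> oU su; split => //; exact: smooth_cst. Qed.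

Lemma csmooth_cderive U f v : csmooth_on U f -> csmooth_on U (fun x => cderive f x v).
Proof.
rewrite cderive.unlock => -[fr fi].
by split; [exact: (smooth_derive v fr) | exact: (smooth_derive v fi)].
Qed.

Lemma near_eq_cderive f g x v : (\near x, f x = g x) -> cderive f x v = cderive g x v.
Proof.
move=> fg; rewrite !cderiveE; congr (_ +i* _); apply: near_eq_derive.
  by apply: filterS fg => y /= ->.
by apply: filterS fg => y /= ->.
Qed.

Lemma eq_cderive U f g x v : open U -> U x -> (forall y, U y -> f y = g y) ->
  cderive f x v = cderive g x v.
Proof.
by move=> oU Ux fg; apply: near_eq_cderive; apply: filterS (open_near oU Ux) => y /fg.
Qed.

Lemma cderive_cst c x v : cderive (fun=> c) x v = 0.
Proof. by rewrite cderiveE !derive_cst. Qed.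

Section AtPoint.
Variables (U : set V) (x : V).
Hypothesis Ux : U x.

Lemma cderiveD f g v : csmooth_on U f -> csmooth_on U g ->
  cderive (fun y => f y + g y) x v = cderive f x v + cderive g x v.
Proof.
move=> [fr fi] [gr gi]; rewrite !cderiveE.
have -> : Re \o (fun y => f y + g y) = (Re \o f) + (Re \o g).
  by apply/funext => y /=; rewrite raddfD.
have -> : Im \o (fun y => f y + g y) = (Im \o f) + (Im \o g).
  by apply/funext => y /=; rewrite raddfD.
have dr := diff_derivable (v := v) (smooth_differentiable fr Ux).
have di := diff_derivable (v := v) (smooth_differentiable fi Ux).
have er := diff_derivable (v := v) (smooth_differentiable gr Ux).
have ei := diff_derivable (v := v) (smooth_differentiable gi Ux).
by rewrite (deriveD dr er) (deriveD di ei).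
Qed.

Lemma cderiveM f g v : csmooth_on U f -> csmooth_on U g ->
  cderive (fun y => f y * g y) x v = cderive f x v * g x + f x * cderive g x v.
Proof.
move=> [fr fi] [gr gi].
have dr := diff_derivable (v := v) (smooth_differentiable fr Ux).
have di := diff_derivable (v := v) (smooth_differentiable fi Ux).
have er := diff_derivable (v := v) (smooth_differentiable gr Ux).
have ei := diff_derivable (v := v) (smooth_differentiable gi Ux).
rewrite !cderiveE.
have -> : Re \o (fun y => f y * g y) = (Re \o f) * (Re \o g) - (Im \o f) * (Im \o g).
  by apply/funext => y /=; rewrite ReM.
have -> : Im \o (fun y => f y * g y) = (Re \o f) * (Im \o g) + (Im \o f) * (Re \o g).
  by apply/funext => y /=; rewrite ImM.
rewrite (deriveB (derivableM dr er) (derivableM di ei)).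
rewrite (deriveD (derivableM dr ei) (derivableM di er)).
rewrite (deriveM dr er) (deriveM di ei) (deriveM dr ei) (deriveM di er).
move: ('D_v (Re \o f) x) ('D_v (Im \o f) x) ('D_v (Re \o g) x) ('D_v (Im \o g) x) => a b c d.
rewrite /=; case: (f x) => f1 f2; case: (g x) => g1 g2 /=.
rewrite -![_ *: _]/(_ * _); simpc; apply/eqP.
by rewrite eq_complex /=; apply/andP; split; apply/eqP; ring.
Qed.

Lemma cderive_conj f v : csmooth_on U f ->
  cderive (fun y => conjc (f y)) x v = conjc (cderive f x v).
Proof.
move=> [fr fi]; rewrite !cderiveE /=; congr (_ +i* _).
  by congr ('D_v _ x); apply/funext => y /=; case: (f y).
have -> : Im \o (fun y => conjc (f y)) = - (Im \o f).
  by apply/funext => y; rewrite -[RHS]/(- Im (f y)) /=; case: (f y).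
by rewrite (deriveN (diff_derivable (v := v) (smooth_differentiable fi Ux))).
Qed.

Lemma cderive_linear f (a : R) v w : csmooth_on U f ->
  cderive f x (a *: v + w) = a%:C * cderive f x v + cderive f x w.
Proof.
move=> [fr fi]; rewrite !cderiveE.
rewrite (derive_dir_linear a v w (smooth_differentiable fr Ux)).
rewrite (derive_dir_linear a v w (smooth_differentiable fi Ux)).
move: ('D_v _ x) ('D_w _ x) ('D_v _ x) ('D_w _ x) => p q r t.
by apply/eqP; rewrite eq_complex /= !mul0r subr0 addr0 !eqxx.
Qed.

End AtPoint.

Lemma cderive_sym U f x v w : open U -> U x -> csmooth_on U f ->
  cderive (fun y => cderive f y v) x w = cderive (fun y => cderive f y w) x v.
Proof.
rewrite cderive.unlock => oU Ux [fr fi].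
have Er := derive_derive_sym v w oU Ux (fr 2%N).
have Ei := derive_derive_sym v w oU Ux (fi 2%N).
exact: (f_equal2 (@Complex R) Er Ei).
Qed.

Lemma cderive0_cst f (x : V) (e : R) : csmooth_on (ball x e) f ->
  (forall y v, ball x e y -> cderive f y v = 0) ->
  forall y, ball x e y -> f y = f x.
Proof.
move=> [fr fi] df y xy.
have Hr : Re (f y) = Re (f x).
  apply: (@derive0_ball_cst _ _ (Re \o f) x e) => // z xz.
  split=> [|v]; first exact: smooth_differentiable fr xz.
  by have := df z v xz; rewrite cderiveE => -[].
have Hi : Im (f y) = Im (f x).
  apply: (@derive0_ball_cst _ _ (Im \o f) x e) => // z xz.
  split=> [|v]; first exact: smooth_differentiable fi xz.
  by have := df z v xz; rewrite cderiveE => -[].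
by apply/eqP; rewrite eq_complex Hr Hi !eqxx.
Qed.

Lemma csmooth_sum (I : finType) U (F : I -> V -> R[i]) : open U ->
  (forall i, csmooth_on U (F i)) -> csmooth_on U (fun x => \sum_i F i x).
Proof.
move=> oU sF; split.
  apply: smooth_eq (smooth_sum oU (fun i => (sF i).1)) => // x _ /=.
  by rewrite raddf_sum.
apply: smooth_eq (smooth_sum oU (fun i => (sF i).2)) => // x _ /=.
by rewrite raddf_sum.
Qed.

Lemma cderive_sum (I : finType) U (F : I -> V -> R[i]) x v : open U -> U x ->
  (forall i, csmooth_on U (F i)) ->
  cderive (fun y => \sum_i F i y) x v = \sum_i cderive (F i) x v.
Proof.
move=> oU Ux sF.
have H (s : seq I) : csmooth_on U (fun y => \sum_(i <- s) F i y) /\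
    cderive (fun y => \sum_(i <- s) F i y) x v = \sum_(i <- s) cderive (F i) x v.
  elim: s => [|i s [IH1 IH2]].
    have -> : (fun y => \sum_(i <- [::]) F i y) = (fun=> 0).
      by apply/funext => y; rewrite big_nil.
    by rewrite cderive_cst big_nil; split => //; exact: csmooth_cst.
  have -> : (fun y => \sum_(i <- i :: s) F i y) = (fun y => F i y + \sum_(i <- s) F i y).
    by apply/funext => y; rewrite big_cons.
  split; first exact: csmoothD.
  by rewrite (cderiveD Ux) // IH2 big_cons.
exact: (H _).2.
Qed.

End ComplexSmooth.

Section ComplexComp.
Context {R : realType} {V : normedModType R}.
Implicit Types (U : set V) (x y v w : V).

Lemma cderive_comp n (U' : set 'rV[R]_n) (f : 'rV[R]_n -> R[i]) (phi : V -> 'rV[R]_n) x v :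
  csmooth_on U' f -> U' (phi x) -> differentiable phi x ->
  cderive (f \o phi) x v = cderive f (phi x) ('D_v phi x).
Proof.
move=> [fr fi] Ux dphi.
have dr := smooth_differentiable fr Ux; have di := smooth_differentiable fi Ux.
rewrite !cderiveE; congr (_ +i* _).
  rewrite deriveE; last exact: (differentiable_comp dphi dr).
  by rewrite (diff_comp dphi dr) /= -(deriveE v dphi) (deriveE ('D_v phi x) dr).
rewrite deriveE; last exact: (differentiable_comp dphi di).
by rewrite (diff_comp dphi di) /= -(deriveE v dphi) (deriveE ('D_v phi x) di).
Qed.


End ComplexComp.

(** * The bilinear form of Mat(2, C) *)

Section Mform.
Context {R : realType}.
Implicit Types (M N P : 'M[R[i]]_2).

Lemma sum2E (T : nmodType) (F : 'I_2 -> T) : \sum_i F i = F 0 + F 1.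
Proof. by rewrite !big_ord_recl big_ord0 addr0; congr (_ + F _); apply: val_inj. Qed.

Lemma mformE M N :
  mform M N = (M 0 1 * N 1 0 + M 1 0 * N 0 1 - M 0 0 * N 1 1 - M 1 1 * N 0 0) / 2%:R.
Proof. by rewrite /mform /mxtrace !sum2E !mxE !sum2E; congr (_ / _); ring. Qed.

Lemma det2E M : \det M = M 0 0 * M 1 1 - M 0 1 * M 1 0.
Proof.
rewrite (expand_det_row _ ord0) sum2E /cofactor !det_mx11 !mxE /=.
rewrite expr0 expr1 mul1r mulN1r mulrN.
by congr (_ * M _ _ - _ * M _ _); apply: val_inj.
Qed.

(** The quadratic form of [mform] is [- det]: thus [SL2C] is the quadric of vectors of
    square [-1]. *)
Lemma mform_diag M : mform M M = - \det M.
Proof.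
rewrite mformE det2E.
have -> : M 0 1 * M 1 0 + M 1 0 * M 0 1 - M 0 0 * M 1 1 - M 1 1 * M 0 0 =
  - (M 0 0 * M 1 1 - M 0 1 * M 1 0) * 2%:R by ring.
by rewrite mulfK // pnatr_eq0.
Qed.

Lemma mformC M N : mform M N = mform N M.
Proof. by rewrite !mformE; congr (_ / _); ring. Qed.

Lemma mformDl M N P : mform (M + N) P = mform M P + mform N P.
Proof. by rewrite !mformE !mxE -mulrDl; congr (_ / _); ring. Qed.

Lemma mformZl a M P : mform (a *: M) P = a * mform M P.
Proof. by rewrite !mformE !mxE mulrA; congr (_ / _); ring. Qed.

Lemma mformDr M N P : mform P (M + N) = mform P M + mform P N.
Proof. by rewrite mformC mformDl !(mformC P). Qed.

Lemma mformZr a M P : mform P (a *: M) = a * mform P M.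
Proof. by rewrite mformC mformZl !(mformC P). Qed.

Lemma mform0l P : mform 0 P = 0.
Proof. by rewrite -(scale0r 0) mformZl mul0r. Qed.

Lemma mform0r P : mform P 0 = 0.
Proof. by rewrite mformC mform0l. Qed.

Lemma mformNl M P : mform (- M) P = - mform M P.
Proof. by rewrite -scaleN1r mformZl mulN1r. Qed.

Lemma mform_suml I (r : seq I) (F : I -> 'M[R[i]]_2) P :
  mform (\sum_(i <- r) F i) P = \sum_(i <- r) mform (F i) P.
Proof. by elim: r => [|i r IH]; rewrite ?big_nil ?mform0l // !big_cons mformDl IH. Qed.

Lemma mform_sumr I (r : seq I) (F : I -> 'M[R[i]]_2) P :
  mform P (\sum_(i <- r) F i) = \sum_(i <- r) mform P (F i).
Proof. by rewrite mformC mform_suml; apply: eq_bigr => i _; rewrite mformC. Qed.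

Lemma SL2C_mform M : SL2C M <-> mform M M = -1.
Proof.
rewrite mform_diag /SL2C /=; split => [->//|/eqP].
by rewrite eqr_opp => /eqP.
Qed.

(** [mform M (M *m W) = - \det M * \tr W / 2]; this is the description of the tangent space
    of a quadric as the orthogonal of the point of tangency. *)
Lemma tangent_mform M N : SL2C M -> tangent_SL2C M N <-> mform M N = 0.
Proof.
rewrite /SL2C /= => detM.
have uM : M \in unitmx by rewrite unitmxE detM unitr1.
split=> [[W trW <-]|mMN].
  rewrite mformE !mxE !sum2E.
  have tr0 : W 0 0 + W 1 1 = 0 by move: trW; rewrite /sl2C /= /mxtrace sum2E.
  have -> : W 1 1 = - W 0 0 by apply/eqP; rewrite -addr_eq0 addrC tr0.
  apply/eqP; rewrite mulf_eq0; apply/orP; left; apply/eqP; ring.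
exists (invmx M *m N); last by rewrite mulmxA mulmxV // mul1mx.
rewrite /sl2C /=; have NE : N = M *m (invmx M *m N) by rewrite mulmxA mulmxV // mul1mx.
move: mMN; rewrite {1}NE; move: (invmx M *m N) => W.
rewrite mformE /mxtrace !mxE !sum2E => /eqP.
rewrite mulf_eq0 invr_eq0 pnatr_eq0 orbF => /eqP E.
have : (M 0 0 * M 1 1 - M 0 1 * M 1 0) * (W 0 0 + W 1 1) = 0.
  apply/eqP; rewrite -oppr_eq0; apply/eqP; rewrite -E; ring.
by rewrite -det2E detM mul1r.
Qed.

End Mform.

(** * Matrix-valued smooth functions *)

(** [mx_derive], locked for the same reason as [cderive]. *)
HB.lock Definition mxD (R : realType) (V : normedModType R) (F : V -> 'M[R[i]]_2)
    (x v : V) : 'M[R[i]]_2 := mx_derive F x v.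

Section MatrixSmooth.
Context {R : realType} {V : normedModType R}.
Implicit Types (U : set V) (F G : V -> 'M[R[i]]_2) (x y v w : V).
Notation Re := (@complex.Re R).
Notation Im := (@complex.Im R).

Lemma mx_reimK : cancel (@mx_reim R) mx_of_reim.
Proof.
move=> M; apply/matrixP => i j; rewrite !mxE /=.
by case: (M i j) => a b; simpc.
Qed.

Lemma mx_of_reimK : cancel (@mx_of_reim R) mx_reim.
Proof.
move=> [A B]; rewrite /mx_reim /mx_of_reim /=; congr (_, _); apply/matrixP => i j;
  by rewrite !mxE /=; simpc.
Qed.

Lemma entry_linear (i j : 'I_2) :
  exists lr li : {linear ('M[R]_2 * 'M[R]_2)%type -> R^o},
    [/\ continuous lr, continuous li & forall P, lr P = P.1 i j /\ li P = P.2 i j].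
Proof.
have @c : {linear 'M[R]_2 -> R^o}.
  by exists (fun N : 'M[R]_2 => N i j); do 2![eexists]; do ?[constructor];
     rewrite ?mxE// => ? *; rewrite ?mxE//; move=> ?; rewrite !mxE.
have cc : continuous c by exact: coord_continuous.
exists (c \o fst), (c \o snd); split=> //= P.
  by apply: continuous_comp; [exact: cvg_fst | exact: cc].
by apply: continuous_comp; [exact: cvg_snd | exact: cc].
Qed.

Lemma mxDE F x v i j : differentiable (@mx_reim R \o F) x ->
  mxD F x v i j = cderive (fun y => F y i j) x v.
Proof.
move=> dF; have [lr [li [cr ci l]]] := entry_linear i j.
rewrite mxD.unlock /mx_derive /mx_of_reim !mxE cderiveE.
have Er := derive_linear v cr dF; have Ei := derive_linear v ci dF.
rewrite (l _).1 in Er; rewrite (l _).2 in Ei; rewrite -Er -Ei.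
have -> : lr \o (@mx_reim R \o F) = Re \o (fun y => F y i j).
  by apply/funext => y; rewrite /= (l _).1 /= mxE.
have -> : li \o (@mx_reim R \o F) = Im \o (fun y => F y i j).
  by apply/funext => y; rewrite /= (l _).2 /= mxE.
by simpc.
Qed.

Lemma smooth_mx_csmooth U F i j : open U -> smooth_mx_on U F ->
  csmooth_on U (fun x => F x i j).
Proof.
move=> oU sF; have [lr [li [cr ci l]]] := entry_linear i j; split.
  apply: smooth_eq (smooth_linear oU cr sF) => // y _.
  by rewrite /= (l _).1 /= mxE.
apply: smooth_eq (smooth_linear oU ci sF) => // y _.
by rewrite /= (l _).2 /= mxE.
Qed.

Lemma csmooth_smooth_mx U F : open U -> (forall i j, csmooth_on U (fun x => F x i j)) ->
  smooth_mx_on U F.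
Proof.
move=> oU sF.
pose e1 i j : 'M[R]_2 * 'M[R]_2 := (delta_mx i j, 0).
pose e2 i j : 'M[R]_2 * 'M[R]_2 := (0, delta_mx i j).
have s1 i j : smooth_on U (fun x => Re (F x i j) *: e1 i j).
  by apply: smooth_scale => //; exact: (sF _ _).1.
have s2 i j : smooth_on U (fun x => Im (F x i j) *: e2 i j).
  by apply: smooth_scale => //; exact: (sF _ _).2.
apply: smooth_eq (smoothD oU (smooth_sum oU (fun i => smooth_sum oU (s1 i)))
  (smooth_sum oU (fun i => smooth_sum oU (s2 i)))) => // x _.
have sum1 (f : 'I_2 -> 'I_2 -> R) : \sum_i \sum_j f i j *: e1 i j = (\matrix_(i, j) f i j, 0).
  rewrite [X in (X, _)]matrix_sum_delta !sum2E !mxE.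
  by apply: injective_projections; rewrite /= ?scaler0 ?addr0.
have sum2 (f : 'I_2 -> 'I_2 -> R) : \sum_i \sum_j f i j *: e2 i j = (0, \matrix_(i, j) f i j).
  rewrite [X in (_, X)]matrix_sum_delta !sum2E !mxE.
  by apply: injective_projections; rewrite /= ?scaler0 ?addr0.
rewrite (sum1 (fun i j => Re (F x i j))) (sum2 (fun i j => Im (F x i j))).
rewrite -[_ + _]/(_, _) /mx_reim /= addr0 add0r.
by congr (_, _); apply/matrixP => i j; rewrite !mxE.
Qed.

Lemma smooth_mxS U U' F : U' `<=` U -> smooth_mx_on U F -> smooth_mx_on U' F.
Proof. by move=> UU'; exact: smoothS. Qed.

Lemma near_eq_mxD F G x v : (\near x, F x = G x) -> mxD F x v = mxD G x v.
Proof.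
move=> FG; have FG' : \forall y \near x, (@mx_reim R \o F) y = (@mx_reim R \o G) y.
  by apply: filterS FG => y /= ->.
by rewrite mxD.unlock /mx_derive (near_eq_derive v FG').
Qed.

Lemma eq_mxD U F G x v : open U -> U x -> (forall y, U y -> F y = G y) ->
  mxD F x v = mxD G x v.
Proof.
by move=> oU Ux FG; apply: near_eq_mxD; apply: filterS (open_near oU Ux) => y /FG.
Qed.

Section On.
Variable (U : set V).
Hypothesis oU : open U.

Lemma mxDE_on F x v i j : smooth_mx_on U F -> U x ->
  mxD F x v i j = cderive (fun y => F y i j) x v.
Proof. by move=> sF Ux; rewrite mxDE //; exact: smooth_differentiable sF Ux. Qed.

Lemma smooth_mxD F v : smooth_mx_on U F -> smooth_mx_on U (fun x => mxD F x v).
Proof.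
move=> sF; apply: csmooth_smooth_mx => // i j.
apply: csmooth_eq (csmooth_cderive v (smooth_mx_csmooth i j oU sF)) => // x Ux.
by rewrite mxDE_on.
Qed.

Lemma mxD_linear F x (a : R) v w : smooth_mx_on U F -> U x ->
  mxD F x (a *: v + w) = a%:C *: mxD F x v + mxD F x w.
Proof.
move=> sF Ux; apply/matrixP => i j.
have linE c (A B : 'M[R[i]]_2) : (c *: A + B) i j = c * A i j + B i j by rewrite !mxE.
rewrite linE (mxDE_on (a *: v + w) i j sF Ux) (mxDE_on v i j sF Ux) (mxDE_on w i j sF Ux).
exact: (cderive_linear Ux a v w (smooth_mx_csmooth i j oU sF)).
Qed.

Lemma mxD_sym F x v w : smooth_mx_on U F -> U x ->
  mxD (fun y => mxD F y v) x w = mxD (fun y => mxD F y w) x v.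
Proof.
move=> sF Ux; apply/matrixP => i j.
have sv := smooth_mxD v sF; have sw := smooth_mxD w sF.
rewrite (mxDE_on w i j sv Ux) (mxDE_on v i j sw Ux).
have sFij := smooth_mx_csmooth i j oU sF.
rewrite (eq_cderive w oU Ux (fun y Uy => mxDE_on v i j sF Uy)).
rewrite (eq_cderive v oU Ux (fun y Uy => mxDE_on w i j sF Uy)).
exact: (cderive_sym v w oU Ux sFij).
Qed.

Lemma csmooth_mform F G : smooth_mx_on U F -> smooth_mx_on U G ->
  csmooth_on U (fun x => mform (F x) (G x)).
Proof.
move=> sF sG.
have f i j := smooth_mx_csmooth i j oU sF; have g i j := smooth_mx_csmooth i j oU sG.
have N1 : csmooth_on U (fun=> -1) by exact: csmooth_cst.
apply: csmooth_eq (csmoothM oU (csmoothD oU (csmoothD oU (csmoothD oU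
  (csmoothM oU (f 0 1) (g 1 0)) (csmoothM oU (f 1 0) (g 0 1)))
  (csmoothM oU N1 (csmoothM oU (f 0 0) (g 1 1))))
  (csmoothM oU N1 (csmoothM oU (f 1 1) (g 0 0)))) (csmooth_cst (2%:R)^-1 oU)) => // x _.
by rewrite mformE !mulN1r.
Qed.

Lemma cderive_mform F G x v : smooth_mx_on U F -> smooth_mx_on U G -> U x ->
  cderive (fun y => mform (F y) (G y)) x v =
    mform (mxD F x v) (G x) + mform (F x) (mxD G x v).
Proof.
move=> sF sG Ux.
have f i j := smooth_mx_csmooth i j oU sF; have g i j := smooth_mx_csmooth i j oU sG.
have N1 : csmooth_on U (fun=> -1) by exact: csmooth_cst.
have h2 : csmooth_on U (fun=> (2%:R)^-1) by exact: csmooth_cst.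
have fg i j k l := csmoothM oU (f i j) (g k l).
have nfg i j k l := csmoothM oU N1 (fg i j k l).
pose H y := (F y 0 1 * G y 1 0 + F y 1 0 * G y 0 1 + (-1) * (F y 0 0 * G y 1 1)
   + (-1) * (F y 1 1 * G y 0 0)) * (2%:R)^-1.
have -> : (fun y => mform (F y) (G y)) = H.
  by apply/funext => y; rewrite /H mformE !mulN1r.
have s1 := csmoothD oU (fg 0 1 1 0) (fg 1 0 0 1).
have s2 := csmoothD oU s1 (nfg 0 0 1 1).
have s3 := csmoothD oU s2 (nfg 1 1 0 0).
rewrite /H (cderiveM Ux v s3 h2) cderive_cst mulr0 addr0.
rewrite (cderiveD Ux v s2 (nfg _ _ _ _)) (cderiveD Ux v s1 (nfg _ _ _ _)).
rewrite (cderiveD Ux v (fg 0 1 1 0) (fg 1 0 0 1)).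
rewrite !(cderiveM Ux v N1 (fg _ _ _ _)) !(cderiveM Ux v (f _ _) (g _ _)) !cderive_cst.
rewrite !mformE !(mxDE_on _ _ _ sF Ux) !(mxDE_on _ _ _ sG Ux) -mulrDl.
by congr (_ * _); ring.
Qed.

End On.

Lemma mxD0_cst F x (e : R) : smooth_mx_on (ball x e) F ->
  (forall y v, ball x e y -> mxD F y v = 0) -> forall y, ball x e y -> F y = F x.
Proof.
move=> sF dF y xy; apply/matrixP => i j.
have oB : open (ball x e) by exact: ball_open.
apply: (cderive0_cst (smooth_mx_csmooth i j oB sF)) xy => z v xz.
by rewrite -(mxDE_on v i j sF xz) dF // mxE.
Qed.

End MatrixSmooth.

(** * Frames of Mat(2, C) and the conjugations that fix them *)

Section Frames.
Context {R : realType}.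
Implicit Types (b : 'I_4 -> 'M[R[i]]_2) (M N : 'M[R[i]]_2).

Definition gram b : 'M[R[i]]_4 := \matrix_(i, j) mform (b i) (b j).

Lemma ord4_ind (P : 'I_4 -> Prop) : P 0 -> P 1 -> P 2%:R -> P 3%:R -> forall i, P i.
Proof.
move=> P0 P1 P2 P3; case=> -[|[|[|[|//]]]] h.
- by rewrite (_ : Ordinal h = 0) //; apply: val_inj.
- by rewrite (_ : Ordinal h = 1) //; apply: val_inj.
- by rewrite (_ : Ordinal h = 2%:R) //; apply: val_inj.
- by rewrite (_ : Ordinal h = 3%:R) //; apply: val_inj.
Qed.

Lemma sum4E (T : nmodType) (F : 'I_4 -> T) : \sum_i F i = F 0 + F 1 + F 2%:R + F 3%:R.
Proof.
rewrite !big_ord_recl big_ord0 addr0 !addrA.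
by congr (F _ + F _ + F _ + F _); apply: val_inj.
Qed.

(** [mvec] lists the coordinates of a matrix and [mcovec] the dual ones, so that their
    product is [mform], see [mvecE]. *)
Definition mvec M : 'rV[R[i]]_4 :=
  \row_k nth 0 [:: M 0 0; M 0 1; M 1 0; M 1 1] k.

Definition mcovec M : 'cV[R[i]]_4 :=
  \col_k (nth 0 [:: - M 1 1; M 1 0; M 0 1; - M 0 0] k / 2%:R).

Lemma mvecE M N : (mvec M *m mcovec N) 0 0 = mform M N.
Proof.
rewrite mxE sum4E !mxE /= mformE !mulrA -!mulrDl; congr (_ / _); ring.
Qed.

Lemma mvec_eq0 M : mvec M = 0 -> M = 0.
Proof.
move=> /rowP H; apply/matrixP => i j; rewrite mxE.
have := (H 0, H 1, H 2%:R, H 3%:R); rewrite !mxE /= => -[[[h0 h1] h2] h3].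
case: i => -[|[|//]] hi; case: j => -[|[|//]] hj.
- by rewrite -[RHS]h0; congr (M _ _); apply: val_inj.
- by rewrite -[RHS]h1; congr (M _ _); apply: val_inj.
- by rewrite -[RHS]h2; congr (M _ _); apply: val_inj.
- by rewrite -[RHS]h3; congr (M _ _); apply: val_inj.
Qed.

(** The Gram matrix is the product of the matrices of coordinates [mvec] and [mcovec] of the
    frame, so these are invertible when it is. *)
Lemma frame_nondegenerate b M : gram b \in unitmx ->
  (forall j, mform M (b j) = 0) -> M = 0.
Proof.
pose A := \matrix_(i < 4) mvec (b i); pose B := \matrix_(i, j < 4) mcovec (b j) i 0.
have AB : A *m B = gram b.
  apply/matrixP => i j; rewrite [RHS]mxE -mvecE !mxE; apply: eq_bigr => k _.
  by rewrite !mxE.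
rewrite -AB unitmx_mul => /andP[_ uB] Mb.
apply: mvec_eq0; apply: (can_inj (mulmxK uB)); rewrite mul0mx.
apply/rowP => j; rewrite [RHS]mxE -(Mb j) -mvecE !mxE; apply: eq_bigr => k _.
by rewrite !mxE.
Qed.

Lemma mform_nondegenerate M : (forall N, mform M N = 0) -> M = 0.
Proof.
move=> H.
have e i j := H (delta_mx i j).
have two : (2%:R : R[i]) != 0 by rewrite pnatr_eq0.
have z (a : R[i]) : a / 2%:R = 0 -> a = 0.
  by move=> /eqP; rewrite mulf_eq0 invr_eq0 (negPf two) orbF => /eqP.
have := (z _ (etrans (esym (mformE _ _)) (e 0 0)), z _ (etrans (esym (mformE _ _)) (e 0 1)),
  z _ (etrans (esym (mformE _ _)) (e 1 0)), z _ (etrans (esym (mformE _ _)) (e 1 1))).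
rewrite !mxE /= !(mulr0, mulr1, addr0, add0r, oppr0) => -[[[h11 h10] h01] h00].
apply: mvec_eq0; apply/rowP; apply: ord4_ind; rewrite !mxE //=.
  by apply/eqP; rewrite -oppr_eq0 h00.
by apply/eqP; rewrite -oppr_eq0 h11.
Qed.

Definition frame_coord b M : 'rV[R[i]]_4 := (\row_j mform M (b j)) *m invmx (gram b).

Lemma frame_expand b M : gram b \in unitmx -> M = \sum_i frame_coord b M 0 i *: b i.
Proof.
move=> ub; apply/subr0_eq/(frame_nondegenerate ub) => j.
rewrite mformDl mformNl mform_suml.
have -> : \sum_i mform (frame_coord b M 0 i *: b i) (b j) = (frame_coord b M *m gram b) 0 j.
  by rewrite [RHS]mxE; apply: eq_bigr => i _; rewrite mformZl [gram b i j]mxE.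
by rewrite mulmxKV // [X in _ - X]mxE subrr.
Qed.

Lemma gramC b i j : gram b i j = gram b j i.
Proof. by rewrite !mxE mformC. Qed.

Lemma gram_tr b : (gram b)^T = gram b.
Proof. by apply/matrixP => i j; rewrite mxE gramC. Qed.

Definition antilinear (f : 'M[R[i]]_2 -> 'M[R[i]]_2) :=
  forall a M N, f (a *: M + N) = conjc a *: f M + f N.

Lemma antilinear0 f : antilinear f -> f 0 = 0.
Proof.
move=> fl; have := fl 1 0 0; rewrite rmorph1 !scale1r addr0 => /eqP.
by rewrite -{1}(addr0 (f 0)) (inj_eq (addrI _)) eq_sym => /eqP.
Qed.

Lemma antilinearZ f a M : antilinear f -> f (a *: M) = conjc a *: f M.
Proof. by move=> fl; rewrite -[a *: M]addr0 fl (antilinear0 fl) addr0. Qed.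

Lemma antilinear_sum f (c : 'I_4 -> R[i]) b : antilinear f ->
  f (\sum_i c i *: b i) = \sum_i conjc (c i) *: f (b i).
Proof.
move=> fl; elim: (index_enum _) => [|i s IH]; first by rewrite !big_nil antilinear0.
by rewrite !big_cons fl IH.
Qed.

Lemma antilinear_eq f f' b : gram b \in unitmx -> antilinear f -> antilinear f' ->
  (forall i, f (b i) = f' (b i)) -> f = f'.
Proof.
move=> ub fl fl' ff'; apply/funext => M; rewrite (frame_expand M ub).
by rewrite !antilinear_sum //; apply: eq_bigr => i _; rewrite ff'.
Qed.

(** The antilinear map [M |-> sum_ij G^ij (<b_i, M>)^* b_j], where [G^ij] is the inverse Gram
    matrix. When the Gram matrix is real, it is the complex conjugation whose fixed points
    form the real span of the frame. *)
Definition frame_conj b M : 'M[R[i]]_2 :=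
  \sum_i \sum_j (invmx (gram b) i j * conjc (mform (b i) M)) *: b j.

Lemma frame_conj_antilinear b : antilinear (frame_conj b).
Proof.
move=> a M N; rewrite /frame_conj scaler_sumr -big_split; apply: eq_bigr => i _ /=.
rewrite scaler_sumr -big_split; apply: eq_bigr => j _ /=.
rewrite scalerA -scalerDl mformDr mformZr rmorphD rmorphM mulrDr.
by congr ((_ + _) *: _); rewrite mulrCA.
Qed.

Definition real_gram b := forall i j, conjc (gram b i j) = gram b i j.

Lemma frame_conj_fix b k : gram b \in unitmx -> real_gram b -> frame_conj b (b k) = b k.
Proof.
move=> ub rb; rewrite /frame_conj exchange_big /=.
rewrite (eq_bigr (fun j => (1%:M : matrix R[i] 4 4) k j *: b j)); last first.
  move=> j _; rewrite -scaler_suml; congr (_ *: _).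
  rewrite -(mulmxV ub) [RHS]mxE; apply: eq_bigr => i _.
  by rewrite mulrC (gramC b k) -(rb i k) [gram b i k]mxE.
rewrite (bigD1 k) //= mxE eqxx scale1r big1 ?addr0 // => j jk.
by rewrite mxE eq_sym (negPf jk) scale0r.
Qed.

End Frames.

(** * Moving frames *)

Section SmoothInverse.
Context {R : realType} {V : normedModType R}.
Implicit Types (U : set V) (f g : V -> R[i]) (x y v w : V).

(** [1 / f = f^* / |f|^2], and the reciprocal of [|f|^2] is the square of the reciprocal
    square root treated above. *)
Lemma csmooth_inv U f : open U -> csmooth_on U f -> (forall x, U x -> f x != 0) ->
  csmooth_on U (fun x => (f x)^-1).
Proof.
move=> oU [fr fi] f0.
pose q x := complex.Re (f x) * complex.Re (f x) + complex.Im (f x) * complex.Im (f x).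
have q0 x : U x -> 0 < q x.
  move=> /f0; rewrite /q eq_complex /= -!expr2 negb_and lt0r => /orP H.
  rewrite addr_ge0 ?sqr_ge0 // andbT paddr_eq0 ?sqr_ge0 // !sqrf_eq0 negb_and.
  by apply/orP.
have sq : smooth_on U q by exact: smoothD (smoothM oU fr fr) (smoothM oU fi fi).
have sr := smooth_rsqrt oU q0 sq.
have sr2 := smoothM oU sr sr.
have sC := csmoothM oU (csmooth_conj oU (conj fr fi)) (csmooth_real oU sr2).
apply: csmooth_eq sC => // x Ux.
rewrite -invfM -expr2 sqr_sqrtr ?(ltW (q0 x Ux)) //.
rewrite /q; case: (f x) => a c /=; simpc.
by rewrite -!expr2.
Qed.

Lemma csmooth_near_neq0 U f x : csmooth_on U f -> U x -> f x != 0 ->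
  \forall y \near x, f y != 0.
Proof.
move=> [fr fi] Ux; rewrite eq_complex negb_and => /orP[nz|nz].
  have H : \forall y \near x, complex.Re (f y) != 0.
    exact: cvgr_neq0 (smooth_continuous fr Ux) nz.
  by apply: filterS H => y; apply: contraNneq => ->.
have H : \forall y \near x, complex.Im (f y) != 0.
  exact: cvgr_neq0 (smooth_continuous fi Ux) nz.
by apply: filterS H => y; apply: contraNneq => ->.
Qed.

Lemma csmooth_prod (I : finType) U (F : I -> V -> R[i]) : open U ->
  (forall i, csmooth_on U (F i)) -> csmooth_on U (fun x => \prod_i F i x).
Proof.
move=> oU sF.
suff H (s : seq I) : csmooth_on U (fun x => \prod_(i <- s) F i x).
  by apply: csmooth_eq (H (index_enum _)).
elim: s => [|i s IH].
  by apply: csmooth_eq (csmooth_cst 1 oU) => // x _; rewrite big_nil.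
by apply: csmooth_eq (csmoothM oU (sF i) IH) => // x _; rewrite big_cons.
Qed.

Lemma csmooth_det n U (A : V -> 'M[R[i]]_n) : open U ->
  (forall i j, csmooth_on U (fun x => A x i j)) -> csmooth_on U (fun x => \det (A x)).
Proof.
move=> oU sA; apply: csmooth_sum => // s.
by apply: csmoothM => //; [exact: csmooth_cst | exact: csmooth_prod].
Qed.

(** Cramer's rule. *)
Lemma csmooth_invmx n U (A : V -> 'M[R[i]]_n) : open U ->
  (forall i j, csmooth_on U (fun x => A x i j)) ->
  (forall x, U x -> A x \in unitmx) ->
  forall i j, csmooth_on U (fun x => invmx (A x) i j).
Proof.
move=> oU sA uA i j.
have sdet := csmooth_inv oU (csmooth_det oU sA)
  (fun x Ux => etrans (esym (unitfE _)) (uA x Ux)).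
apply: (@csmooth_eq _ _ U (fun x => (\det (A x))^-1 * cofactor (A x) j i)) => //.
  by move=> x Ux; rewrite /invmx (uA x Ux) !mxE.
apply: csmoothM => //; apply: csmoothM => //; first exact: csmooth_cst.
apply: csmooth_det => // k l.
by apply: csmooth_eq (sA (lift j k) (lift i l)) => // x _; rewrite !mxE.
Qed.

End SmoothInverse.

Section MovingFrame.
Context {R : realType} {V : normedModType R}.
Variables (U : set V) (b : 'I_4 -> V -> 'M[R[i]]_2).
Implicit Types (x y v w : V).
Hypotheses (oU : open U) (sb : forall i, smooth_mx_on U (b i)).
Local Notation gm := (fun x => gram (b^~ x)).
Hypotheses (ub : forall x, U x -> gram (b^~ x) \in unitmx)
  (rb : forall x, U x -> real_gram (b^~ x))
  (rdb : forall x v i j, U x ->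
    conjc (mform (mxD (b i) x v) (b j x)) = mform (mxD (b i) x v) (b j x)).

Let sgram i j : csmooth_on U (fun x => gram (b^~ x) i j).
Proof.
by apply: csmooth_eq (csmooth_mform oU (sb i) (sb j)) => // x _; rewrite mxE.
Qed.

Let sinv := csmooth_invmx oU sgram ub.

(** The coefficients of the derivative solve a linear system with real data: its matrix is
    the Gram matrix and its right-hand sides are the pairings assumed to be real. *)
Lemma frame_structure x v : U x -> exists Om : 'M[R[i]]_4,
  [/\ forall i, mxD (b i) x v = \sum_j Om i j *: b j x,
      forall i j, conjc (Om i j) = Om i j &
      forall i j, cderive (fun y => gram (b^~ y) i j) x v =
        (Om *m gram (b^~ x) + gram (b^~ x) *m Om^T) i j].
Proof.
move=> Ux.
pose Th : 'M[R[i]]_4 := \matrix_(i, j) mform (mxD (b i) x v) (b j x).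
pose Om := Th *m invmx (gram (b^~ x)).
have ThE : Om *m gram (b^~ x) = Th by rewrite mulmxKV // ub.
exists Om; split=> [i|i j|i j].
- rewrite [LHS](frame_expand _ (ub Ux)); apply: eq_bigr => j _; congr (_ *: _).
  by rewrite /frame_coord !mxE; apply: eq_bigr => k _; rewrite !mxE.
- have rTh : map_mx (@conjc R) Th = Th by apply/matrixP => k l; rewrite !mxE rdb.
  have rG : map_mx (@conjc R) (gram (b^~ x)) = gram (b^~ x).
    by apply/matrixP => k l; rewrite mxE rb.
  have : map_mx (@conjc R) Om = Om by rewrite map_mxM map_invmx rTh rG.
  by move=> /matrixP /(_ i j); rewrite mxE.
- have -> : cderive (fun y => gram (b^~ y) i j) x v
      = cderive (fun y => mform (b i y) (b j y)) x v.
    by congr (cderive _ x v); apply/funext => y; rewrite mxE.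
  rewrite (cderive_mform oU v (sb i) (sb j) Ux) [RHS]mxE; congr (_ + _).
    by rewrite ThE mxE.
  by rewrite -[gram _]gram_tr -trmx_mul ThE !mxE mformC.
Qed.

(** [d(G^-1) = - G^-1 (dG) G^-1], with [dG] given by the structure equation. *)
Lemma cderive_invgram x v (Om : 'M[R[i]]_4) : U x ->
  (forall i j, cderive (fun y => gram (b^~ y) i j) x v =
        (Om *m gram (b^~ x) + gram (b^~ x) *m Om^T) i j) ->
  forall i j, cderive (fun y => invmx (gram (b^~ y)) i j) x v =
    - (Om^T *m invmx (gram (b^~ x)) + invmx (gram (b^~ x)) *m Om) i j.
Proof.
move=> Ux dG.
set G := gram (b^~ x) in dG *.
pose DI : 'M[R[i]]_4 := \matrix_(i, j) cderive (fun y => invmx (gram (b^~ y)) i j) x v.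
have H : DI *m G + invmx G *m (Om *m G + G *m Om^T) = 0.
  apply/matrixP => i j; rewrite [RHS]mxE.
  have c1 : cderive (fun y => \sum_k invmx (gram (b^~ y)) i k * gram (b^~ y) k j) x v = 0.
    rewrite -[RHS](cderive_cst ((1%:M : 'M[R[i]]_4) i j) x v); apply: (eq_cderive v oU Ux) => y Uy.
    by rewrite -(mulVmx (ub Uy)) [RHS]mxE.
  rewrite -c1 (cderive_sum v oU Ux (fun k => csmoothM oU (sinv i k) (sgram k j))).
  rewrite [LHS]mxE [X in X + _]mxE [X in _ + X]mxE -big_split; apply: eq_bigr => k _ /=.
  by rewrite (cderiveM Ux v (sinv i k) (sgram k j)) dG [DI i k]mxE.
move=> i j; have -> : cderive (fun y => invmx (gram (b^~ y)) i j) x v = DI i j by rewrite mxE.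
have uG : G \in unitmx by exact: ub.
have -> : DI = - (Om^T *m invmx G + invmx G *m Om).
  move: H => /(congr1 (mulmx^~ (invmx G))).
  rewrite mul0mx mulmxDl mulmxK // mulmxDr mulmxDl !mulmxA mulVmx // mul1mx mulmxK //.
  by move=> /eqP; rewrite addr_eq0 addrC => /eqP.
by rewrite mxE.
Qed.

(** Write the value as [u G^-1 w] with [u] the conjugates of the pairings with [M] and [w]
    the pairings with [N]. Both are transformed by the same [Om], because [Om] is real, and the
    two contributions cancel the derivative of [G^-1]. *)
Lemma cderive_frame_conj M N x v : U x ->
  cderive (fun y => mform (frame_conj (b^~ y) M) N) x v = 0.
Proof.
move=> Ux; have [Om [db rOm dG]] := frame_structure v Ux.
have dI := cderive_invgram Ux dG.
set G := gram (b^~ x) in dG dI.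
have sM P : smooth_mx_on U (fun=> P) by apply: csmooth_smooth_mx => // i j; exact: csmooth_cst.
have sp i P : csmooth_on U (fun y => mform (b i y) P) := csmooth_mform oU (sb i) (sM P).
have dp i P : cderive (fun y => mform (b i y) P) x v = \sum_j Om i j * mform (b j x) P.
  rewrite (cderive_mform oU v (sb i) (sM P) Ux).
  rewrite db mform_suml [X in _ + X](_ : _ = 0).
    by rewrite addr0; apply: eq_bigr => j _; rewrite mformZl.
  have -> : mxD (fun=> P) x v = 0; last exact: mform0r.
  by apply/matrixP => k l; rewrite (mxDE_on v k l (sM P) Ux) cderive_cst mxE.
pose u : 'rV[R[i]]_4 := \row_i conjc (mform (b i x) M).
pose w : 'cV[R[i]]_4 := \col_i mform (b i x) N.
have sc i := csmooth_conj oU (sp i M).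
have st i j := csmoothM oU (csmoothM oU (sinv i j) (sc i)) (sp j N).
have -> : (fun y => mform (frame_conj (b^~ y) M) N) = (fun y =>
    \sum_i \sum_j invmx (gram (b^~ y)) i j * conjc (mform (b i y) M) * mform (b j y) N).
  apply/funext => y; rewrite /frame_conj mform_suml; apply: eq_bigr => i _.
  by rewrite mform_suml; apply: eq_bigr => j _; rewrite mformZl.
rewrite (cderive_sum v oU Ux (fun i => csmooth_sum oU (st i))).
transitivity ((u *m (Om^T *m invmx G) *m w + u *m (invmx G *m Om) *m w
  - u *m (Om^T *m invmx G + invmx G *m Om) *m w) 0 0); last first.
  by rewrite mulmxDr mulmxDl subrr mxE.
have dc i : cderive (fun y => conjc (mform (b i y) M)) x v = (u *m Om^T) 0 i.
  rewrite (cderive_conj Ux v (sp i M)) dp rmorph_sum mxE; apply: eq_bigr => j _ /=.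
  by rewrite rmorphM [Om^T _ _]mxE [u _ _]mxE mulrC; congr (_ * _); exact: rOm.
have dn j : cderive (fun y => mform (b j y) N) x v = (Om *m w) j 0.
  by rewrite dp mxE; apply: eq_bigr => l _; rewrite [w _ _]mxE.
have bil (a : 'rV[R[i]]_4) (B : 'M[R[i]]_4) (c : 'cV[R[i]]_4) :
    (a *m B *m c) 0 0 = \sum_i \sum_j B i j * a 0 i * c j 0.
  rewrite mxE exchange_big; apply: eq_bigr => j _ /=.
  by rewrite mxE mulr_suml; apply: eq_bigr => i _; rewrite [B _ _ * _]mulrC.
rewrite mulmxA -[u *m (invmx G *m Om) *m w]mulmxA -[invmx G *m Om *m w]mulmxA.
rewrite (mulmxA u (invmx G)) [RHS]mxE [X in X + _]mxE [X in _ + X]mxE !bil.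
rewrite -big_split -sumrB /=; apply: eq_bigr => i _.
rewrite (cderive_sum v oU Ux (st i)) -big_split -sumrB /=; apply: eq_bigr => j _.
rewrite (cderiveM Ux v (csmoothM oU (sinv i j) (sc i)) (sp j N)).
rewrite (cderiveM Ux v (sinv i j) (sc i)) dc dn dI.
rewrite [u 0 i]mxE [w j 0]mxE; ring.
Qed.

(** The derivative of the form [(M, N) |-> mform (frame_conj b M) N] is zero, so the
    frame keeps its real span. *)
Lemma frame_conj_cst x (e : R) : ball x e `<=` U ->
  forall y, ball x e y -> frame_conj (b^~ y) = frame_conj (b^~ x).
Proof.
move=> BU y xy; apply/funext => M; apply/subr0_eq/mform_nondegenerate => N.
have sM P : smooth_mx_on U (fun=> P) by apply: csmooth_smooth_mx => // i j; exact: csmooth_cst.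
rewrite mformDl mformNl; apply/eqP; rewrite subr_eq0; apply/eqP.
apply: (@cderive0_cst _ _ (fun y => mform (frame_conj (b^~ y) M) N) x e) => //; last first.
  by move=> z v /BU Uz; exact: cderive_frame_conj.
apply: csmoothS BU _.
apply: (@csmooth_eq _ _ U (fun y =>
    \sum_i \sum_j invmx (gram (b^~ y)) i j * conjc (mform (b i y) M) * mform (b j y) N)) => //.
  move=> z _; rewrite /frame_conj mform_suml; apply: eq_bigr => i _.
  by rewrite mform_suml; apply: eq_bigr => j _; rewrite mformZl.
apply: csmooth_sum => // i; apply: csmooth_sum => // j.
apply: csmoothM => //; last exact: csmooth_mform.
by apply: csmoothM => //; apply: csmooth_conj => //; exact: csmooth_mform.
Qed.

End MovingFrame.

(** * Radial projection onto a hyperquadric *)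

Section Hyperquadric.
Context {R : realType}.
Variable eta : 'I_4 -> R.
Hypothesis eta2 : forall i, eta i * eta i = 1.
Local Notation V := 'rV[R]_4.
Implicit Types (x y v w z : V).

Definition eform x y : R := \sum_i eta i * (x 0 i * y 0 i).
Local Notation h := eform.

Lemma eformC x y : h x y = h y x.
Proof. by apply: eq_bigr => i _; rewrite [x 0 i * _]mulrC. Qed.

Lemma eformDl x y z : h (x + y) z = h x z + h y z.
Proof. by rewrite -big_split; apply: eq_bigr => i _; rewrite mxE mulrDl mulrDr. Qed.

Lemma eformZl (a : R) x z : h (a *: x) z = a * h x z.
Proof. by rewrite mulr_sumr; apply: eq_bigr => i _; rewrite mxE -mulrA [LHS]mulrCA. Qed.

Lemma eformDr x y z : h z (x + y) = h z x + h z y.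
Proof. by rewrite eformC eformDl !(eformC z). Qed.

Lemma eformZr (a : R) x z : h z (a *: x) = a * h z x.
Proof. by rewrite eformC eformZl (eformC z). Qed.

Lemma eform_nondegenerate x : (forall y, h x y = 0) -> x = 0.
Proof.
move=> H; apply/rowP => i; have := H (delta_mx 0 i); rewrite /eform (bigD1 i) //=.
rewrite big1 => [|j ji]; last by rewrite mxE (negPf ji) andbF !mulr0.
rewrite mxE !eqxx mulr1 addr0 => /(congr1 ( *%R (eta i))).
by rewrite mulrA eta2 mul1r mulr0 mxE.
Qed.

Lemma smooth_coordinate (U : set V) i : open U -> smooth_on U (fun x => x 0 i).
Proof. by move=> oU; exact: smooth_coord (smooth_id oU). Qed.

Lemma derive_coordinate x v i : 'D_v (fun y : V => y 0 i) x = v 0 i.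
Proof. by rewrite (derive_coord (phi := id)) // derive_id. Qed.

Lemma smooth_eform_diag (U : set V) : open U -> smooth_on U (fun x => - h x x).
Proof.
move=> oU; apply: smoothN => //; apply: smooth_sum => // i.
apply: smoothM => //; first exact: smooth_cst.
by apply: smoothM => //; exact: smooth_coordinate.
Qed.

Lemma derive_eform_diag x v : 'D_v (fun y => - h y y) x = - (2 * h x v).
Proof.
have dc (y : V) i : differentiable (fun y : V => y 0 i) y by exact: differentiable_coord.
have -> : (fun y => - h y y) = - (\sum_i (eta i \*: ((fun y : V => y 0 i) * (fun y : V => y 0 i)))).
  by apply/funext => y; rewrite !fctE /eform fct_sumE.
have dm i : derivable ((fun y : V => y 0 i) * (fun y : V => y 0 i)) x v.
  by apply: derivableM; exact: diff_derivable.
rewrite deriveN; last by apply: derivable_sum => i; exact: derivableZ.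
rewrite derive_sum; last by move=> i; exact: derivableZ.
congr (- _); rewrite mulr_sumr; apply: eq_bigr => i _.
rewrite deriveZ // deriveM; [|exact: diff_derivable|exact: diff_derivable].
rewrite derive_coordinate -[_ *: _]/(_ * _) -![x 0 i *: _]/(_ * _); ring.
Qed.

Definition timecone : set V := [set x | 0 < - h x x].

Lemma open_timecone : open timecone.
Proof.
have cq : continuous (fun x => - h x x).
  by move=> x; apply: (smooth_continuous (smooth_eform_diag openT)).
exact: (open_comp (fun x _ => cq x) (@open_gt R 0)).
Qed.

(** The reciprocal of the norm of a timelike vector. *)
Definition rnorm x : R := (Num.sqrt (- h x x))^-1.

(** The radial projection onto the quadric [h x x = -1]. *)
Definition normalize x : V := rnorm x *: x.
Local Notation phi := normalize.

Lemma rnorm_gt0 x : timecone x -> 0 < rnorm x.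
Proof. by move=> tx; rewrite invr_gt0 sqrtr_gt0. Qed.

Lemma rnorm_sqr x : timecone x -> rnorm x * rnorm x * h x x = -1.
Proof.
move=> tx; rewrite -invfM -expr2 sqr_sqrtr ?ltW // invrN mulNr mulVf //.
by rewrite -oppr_eq0 gt_eqF.
Qed.

Lemma smooth_rnorm : smooth_on timecone rnorm.
Proof.
apply: smooth_rsqrt => //; first exact: open_timecone.
exact/smooth_eform_diag/open_timecone.
Qed.

Lemma derive_rnorm x v : timecone x -> 'D_v rnorm x = rnorm x ^+ 3 * h x v.
Proof.
move=> tx.
have dq := smooth_differentiable (smooth_eform_diag openT) (x := x) I.
have [df Df] := rsqrt_derive tx.
have dc : differentiable (fun t : R => (Num.sqrt t)^-1) (- h x x) by exact/derivable1_diffP.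
rewrite deriveE; last exact: (differentiable_comp dq dc).
rewrite (diff_comp dq dc) /= -(deriveE v dq) derive_eform_diag deriv1E // derive1E Df.
rewrite /rnorm -[_ *: _]/(_ * _); field.
by rewrite sqrtr_eq0 -ltNge.
Qed.

Lemma smooth_normalize_coord i : smooth_on timecone (fun x => phi x 0 i).
Proof.
apply: (@smooth_eq _ _ _ _ (fun x => rnorm x * x 0 i)); first exact: open_timecone.
  by move=> x _; rewrite mxE.
apply: smoothM; [exact: open_timecone|exact: smooth_rnorm|exact/smooth_coordinate/open_timecone].
Qed.

Lemma differentiable_normalize x : timecone x -> differentiable phi x.
Proof.
move=> tx; apply: differentiable_coords => i.
exact: smooth_differentiable (smooth_normalize_coord i) tx.
Qed.

(** Up to scale this is the projection to the hyperplane tangent to the quadric; at a point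
    of the quadric it fixes the tangent vectors. *)
Lemma derive_normalize x v : timecone x ->
  'D_v phi x = rnorm x *: (v + h (phi x) v *: phi x).
Proof.
move=> tx; apply/rowP => i; rewrite -derive_coord; last exact: differentiable_normalize.
have -> : (fun y => phi y 0 i) = rnorm * (fun y : V => y 0 i).
  by apply/funext => y; rewrite mxE.
rewrite deriveM; first last.
- exact/diff_derivable/differentiable_coord.
- exact/diff_derivable/(smooth_differentiable smooth_rnorm).
rewrite derive_rnorm // derive_coordinate /normalize eformZl !mxE.
rewrite -![_ *: _]/(_ * _); ring.
Qed.

Lemma continuous_normalize x : timecone x -> {for x, continuous phi}.
Proof. by move=> tx; apply: differentiable_continuous; exact: differentiable_normalize. Qed.

Lemma eform_normalize x : timecone x -> h (phi x) (phi x) = -1.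
Proof. by move=> tx; rewrite eformZl eformZr mulrA rnorm_sqr. Qed.

Lemma timecone_unit x : h x x = -1 -> timecone x.
Proof. by move=> hx; rewrite /timecone /= hx opprK ltr01. Qed.

Lemma rnorm_unit x : h x x = -1 -> rnorm x = 1.
Proof. by move=> hx; rewrite /rnorm hx opprK sqrtr1 invr1. Qed.

Lemma normalize_unit x : h x x = -1 -> phi x = x.
Proof. by move=> hx; rewrite /phi rnorm_unit // scale1r. Qed.

Lemma normalizeK x : timecone x -> (rnorm x)^-1 *: phi x = x.
Proof. by move=> tx; rewrite scalerA mulVf ?scale1r // gt_eqF // rnorm_gt0. Qed.

Lemma open_normalize (W : set V) : open W -> open (timecone `&` phi @^-1` W).
Proof.
move=> oW; rewrite openE => x [tx Wx]; apply: filterI.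
  exact: open_near open_timecone tx.
exact: (continuous_normalize tx) (open_near oW Wx).
Qed.

End Hyperquadric.

(** * Linear isometric embeddings *)

Section LinearModel.
Context {R : realType}.
Variable eta : 'I_4 -> R.
Hypothesis eta2 : forall i, eta i * eta i = 1.
Local Notation V := 'rV[R]_4.
Local Notation h := (eform eta).
Implicit Types (x y v w z : V) (b : 'I_4 -> 'M[R[i]]_2).

Definition span_map b x : 'M[R[i]]_2 := \sum_i (x 0 i)%:C *: b i.

Definition orthonormal b := forall i j, mform (b i) (b j) = (eta i *+ (i == j))%:C.

Lemma orthonormal_gram b : orthonormal b -> gram b \in unitmx.
Proof.
move=> ob; have [M HM] : exists M : 'M[R[i]]_4, M *m gram b = 1%:M.
  exists (gram b); apply/matrixP => i j; rewrite [LHS]mxE (bigD1 i) //= big1.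
    rewrite addr0 [gram b i i]mxE [gram b i j]mxE [RHS]mxE !ob eqxx -rmorphM /=.
    by case: eqP => _; rewrite ?mulr0n ?mulr0 ?mulr1n ?eta2.
  by move=> k ki; rewrite [gram b i k]mxE ob eq_sym (negPf ki) mulr0n rmorph0 mul0r.
by have [] := mulmx1_unit HM.
Qed.

Lemma orthonormal_real_gram b : orthonormal b -> real_gram b.
Proof. by move=> ob i j; rewrite mxE ob conjc_real. Qed.

Lemma span_map_linear b (a : R) x y :
  span_map b (a *: x + y) = a%:C *: span_map b x + span_map b y.
Proof.
rewrite scaler_sumr -big_split; apply: eq_bigr => i _ /=.
by rewrite !mxE rmorphD rmorphM scalerDl scalerA.
Qed.

Lemma span_map_delta b i : span_map b (delta_mx 0 i) = b i.
Proof.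
rewrite /span_map (bigD1 i) //= big1 => [|j ji]; last first.
  by rewrite mxE (negPf ji) andbF rmorph0 scale0r.
by rewrite mxE !eqxx rmorph1 scale1r addr0.
Qed.

Lemma mform_span_map b x y : orthonormal b ->
  mform (span_map b x) (span_map b y) = (h x y)%:C.
Proof.
move=> ob; rewrite mform_suml rmorph_sum; apply: eq_bigr => i _.
rewrite mform_sumr (bigD1 i) //= big1 => [|j ji].
  rewrite addr0 mformZl mformZr ob eqxx mulr1n !rmorphM /=; ring.
by rewrite mformZl mformZr ob eq_sym (negPf ji) mulr0n rmorph0 !mulr0.
Qed.

Lemma span_map_inj b x : orthonormal b -> span_map b x = 0 -> x = 0.
Proof.
move=> ob Lx; apply: (eform_nondegenerate eta2) => y.
have := mform_span_map x y ob; rewrite Lx mform0l => /esym/eqP.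
by rewrite -[0]/(0%:C) (inj_eq (@complexI _)) => /eqP.
Qed.

Lemma smooth_span_map b (U : set V) : open U -> smooth_mx_on U (span_map b).
Proof.
move=> oU; apply: csmooth_smooth_mx => // i j.
apply: (@csmooth_eq _ _ U (fun x => \sum_k (x 0 k)%:C * b k i j)) => //.
  by move=> x _; rewrite summxE; apply: eq_bigr => k _; rewrite mxE.
apply: csmooth_sum => // k; apply: csmoothM => //; last exact: csmooth_cst.
by apply: csmooth_real => //; exact: smooth_coordinate.
Qed.

Lemma mxD_span_map b x v : mxD (span_map b) x v = span_map b v.
Proof.
apply/matrixP => i j; rewrite (mxDE_on v i j (smooth_span_map b openT) (I : setT x)).
have -> : (fun y => span_map b y i j) = (fun y => \sum_k (y 0 k)%:C * b k i j).
  by apply/funext => y; rewrite summxE; apply: eq_bigr => k _; rewrite mxE.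
have sk k : csmooth_on setT (fun y : V => (y 0 k)%:C).
  by apply: csmooth_real; [exact: openT|exact/smooth_coordinate/openT].
have sb k : csmooth_on setT (fun y : V => b k i j) by exact/csmooth_cst/openT.
rewrite (cderive_sum v openT (I : setT x) (fun k => csmoothM openT (sk k) (sb k))).
rewrite summxE; apply: eq_bigr => k _.
rewrite (cderiveM (I : setT x) v (sk k) (sb k)) cderive_cst mulr0 addr0 mxE; congr (_ * _).
rewrite cderiveE; congr (_ +i* _); first exact: derive_coordinate.
by rewrite (_ : _ \o _ = cst 0) ?derive_cst.
Qed.

Lemma mxD_sum (U : set V) (F : V -> 'M[R[i]]_2) x v : open U -> smooth_mx_on U F -> U x ->
  mxD F x v = span_map (fun i => mxD F x (delta_mx 0 i)) v.
Proof.
move=> oU sF Ux.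
have l0 : mxD F x 0 = 0.
  have := mxD_linear oU (-1) 0 0 sF Ux.
  by rewrite scaler0 addr0 rmorphN1 scaleN1r addNr.
rewrite {1}(row_sum_delta v) /span_map.
elim: (index_enum _) => [|i s IH]; first by rewrite !big_nil.
by rewrite !big_cons (mxD_linear oU _ _ _ sF Ux) IH.
Qed.

Lemma orthonormal_real_coord b i M x : orthonormal b -> M = span_map b x ->
  x 0 i = eta i * complex.Re (mform M (b i)).
Proof.
move=> ob ->; rewrite -[b i]span_map_delta mform_span_map //=.
rewrite /eform (bigD1 i) //= big1 => [|j ji]; last by rewrite mxE (negPf ji) andbF !mulr0.
by rewrite mxE !eqxx mulr1 addr0 mulrA eta2 mul1r.
Qed.

Lemma smooth_mx_of_reim : smooth_mx_on setT (@mx_of_reim R).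
Proof.
rewrite /smooth_mx_on (_ : _ \o _ = id); first exact/smooth_id/openT.
by apply/funext => P /=; rewrite mx_of_reimK.
Qed.

(** Composed with the radial projection, the two maps agree in a neighbourhood of [x], and
    the derivative of the projection fixes the tangent vectors. *)
Lemma extension_derive (W U : set V) (F G : V -> 'M[R[i]]_2) x v : open W -> open U ->
  W x -> U x -> h x x = -1 -> h x v = 0 ->
  smooth_mx_on U F -> smooth_mx_on U G ->
  (forall y, U y -> W y -> h y y = -1 -> F y = G y) -> mxD F x v = mxD G x v.
Proof.
move=> oW oU Wx Ux hx hv sF sG FG.
have tx := timecone_unit hx.
pose phi := normalize eta.
have phix : phi x = x by exact: normalize_unit.
have Dphi : 'D_v phi x = v.
  by rewrite derive_normalize // rnorm_unit // normalize_unit // scale1r hv scale0r addr0.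
have near_eq : \near x, F (phi x) = G (phi x).
  have oUW : open (timecone eta `&` phi @^-1` (U `&` W)).
    by apply: open_normalize; exact: openI.
  have Ox : (timecone eta `&` phi @^-1` (U `&` W)) x by split => //=; rewrite phix.
  apply: filterS (open_near oUW Ox) => y [ty [Uy Wy]].
  by apply: FG => //; exact: eform_normalize.
have dphi : differentiable phi x by exact: differentiable_normalize.
have Uphi : U (phi x) by rewrite phix.
apply/matrixP => i j; rewrite (mxDE_on v i j sF Ux) (mxDE_on v i j sG Ux).
have := cderive_comp v (smooth_mx_csmooth i j oU sF) Uphi dphi.
have := cderive_comp v (smooth_mx_csmooth i j oU sG) Uphi dphi.
rewrite Dphi phix => <- <-; apply: near_eq_cderive.
by apply: filterS near_eq => y /= ->.
Qed.

Variable W : set V.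
Hypothesis oW : open W.
Local Notation N := [set x | h x x = -1 /\ W x].

(** The linear map [span_map b] is its own smooth extension, and [extension_derive] transfers
    its derivative to every other extension. A continuous inverse is given by the real parts of
    the products with the frame. *)
Lemma span_map_isometric_embedding b : orthonormal b ->
  isometric_embedding N h (span_map b).
Proof.
move=> ob.
have ext x F : N x -> local_extension N (span_map b) F x -> forall v, h x v = 0 ->
    mx_derive F x v = span_map b v.
  move=> [hx Wx] [U [oU Ux sF FL]] v hv; rewrite -(mxD_span_map b x v).
  have -> : mx_derive F x v = mxD F x v by rewrite mxD.unlock.
  apply: (extension_derive oW oU) => //; first exact: smooth_span_map.
  by move=> y Uy Wy hy; exact: FL.
split.
- by move=> x [hx _]; apply/SL2C_mform; rewrite mform_span_map // hx rmorphN1.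
- move=> x _; exists (span_map b), setT; split=> //; first exact: openT.
  exact/smooth_span_map/openT.
- by move=> x F Nx FL v hv; rewrite (ext x F Nx FL v hv); exact: span_map_inj.
- split.
    apply: continuous_subspaceT => x.
    exact: (smooth_continuous (smooth_span_map b openT) (I : setT x)).
  pose j P : V := \row_i (eta i * complex.Re (mform (mx_of_reim P) (b i))).
  exists j; split=> [x _|].
    apply/rowP => i; rewrite mxE mx_reimK.
    by rewrite -(orthonormal_real_coord i ob (erefl (span_map b x))).
  apply: continuous_subspaceT => P; apply: differentiable_continuous.
  apply: differentiable_coords => i.
  have sC : smooth_mx_on setT (fun _ : 'M[R]_2 * 'M[R]_2 => b i).
    by apply: csmooth_smooth_mx => [|k l]; [exact: openT|exact/csmooth_cst/openT].
  have [sr _] := csmooth_mform openT smooth_mx_of_reim sC.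
  have -> : (fun P => j P 0 i) =
      (fun P => eta i * (complex.Re (mform (mx_of_reim P) (b i)))).
    by apply/funext => Q; rewrite mxE.
  apply: (@smooth_differentiable _ _ _ setT) => //.
  by apply: smoothM => //; [exact: openT|exact/smooth_cst/openT].
- move=> x F Nx FL v w hv hw.
  by rewrite (ext x F Nx FL v hv) (ext x F Nx FL w hw) mform_span_map.
Qed.

End LinearModel.

(** * Isometric embeddings of hyperquadrics are linear *)

Section FlatIsometry.
Context {R : realType}.
Variable eta : 'I_4 -> R.
Hypothesis eta2 : forall i, eta i * eta i = 1.
Local Notation V := 'rV[R]_4.
Local Notation h := (eform eta).
Implicit Types (x y v w z : V).

Section Flat.
Variables (U : set V) (G : V -> 'M[R[i]]_2).
Hypotheses (oU : open U) (sG : smooth_mx_on U G)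
  (iG : forall x v w, U x -> mform (mxD G x v) (mxD G x w) = (h v w)%:C).

Lemma isometry_frame x : U x -> orthonormal eta (fun i => mxD G x (delta_mx 0 i)).
Proof.
move=> Ux i j; rewrite iG // /eform (bigD1 i) //= big1 => [|k ki].
  by rewrite !mxE !eqxx mul1r addr0 /=; case: eqP; rewrite ?mulr1n ?mulr0n ?mulr1 ?mulr0.
by rewrite mxE (negPf ki) andbF mul0r mulr0.
Qed.

(** The trilinear form [(z, v, w) |-> mform (D_z D_v G) (D_w G)] is symmetric in its
    first two arguments and antisymmetric in the last two, hence zero. *)
Lemma isometry_second_derivative x v z : U x -> mxD (fun y => mxD G y v) x z = 0.
Proof.
move=> Ux.
pose T z v w := mform (mxD (fun y => mxD G y v) x z) (mxD G x w).
have Tsym z1 v1 w1 : T z1 v1 w1 = T v1 z1 w1.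
  by rewrite /T (mxD_sym oU v1 z1 sG Ux).
have Tanti z1 v1 w1 : T z1 v1 w1 = - T z1 w1 v1.
  apply/eqP; rewrite -addr_eq0; apply/eqP.
  have := cderive_mform oU z1 (smooth_mxD oU v1 sG) (smooth_mxD oU w1 sG) Ux.
  rewrite [X in _ + X]mformC => <-.
  rewrite -[RHS](cderive_cst ((h v1 w1)%:C) x z1).
  by apply: (eq_cderive z1 oU Ux) => y Uy; rewrite iG.
have T0 w : T z v w = 0.
  have E : T z v w = - T z v w.
    by rewrite {1}Tanti Tsym Tanti opprK Tsym Tanti Tsym.
  have two : (2%:R : R[i]) != 0 by rewrite pnatr_eq0.
  apply: (mulIf two); rewrite mul0r mulr_natr mulr2n {2}E subrr //.
apply: (frame_nondegenerate (orthonormal_gram eta2 (isometry_frame Ux))) => j.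
exact: T0.
Qed.

Lemma isometry_derive_cst x (e : R) y v : ball x e `<=` U -> ball x e y ->
  mxD G y v = mxD G x v.
Proof.
move=> BU xy; apply: (@mxD0_cst _ _ (fun z => mxD G z v) x e) => //.
  by apply: smooth_mxS BU _; exact: smooth_mxD.
by move=> z w /BU Uz; exact: isometry_second_derivative.
Qed.

End Flat.

Section LocalLinearity.
Variables (W : set V) (iota : V -> 'M[R[i]]_2).
Hypothesis oW : open W.
Local Notation N := [set x | h x x = -1 /\ W x].
Hypothesis iota_iso : isometric_embedding N h iota.

(** The cone over the quadric is open in flat [R^4], and the extension of [iota] to it that
    is homogeneous of degree one is again isometric, hence has constant derivative; by
    Euler's identity it is linear. *)
Lemma isometric_embedding_linear x0 : N x0 -> exists b, orthonormal eta b /\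
  exists2 e : R, 0 < e & forall x, ball x0 e x -> N x -> iota x = span_map b x.
Proof.
move=> Nx0; have [iSL /(_ _ Nx0) [F [U [oU Ux0 sF FE]]] _ _ iI] := iota_iso.
have [hx0 Wx0] := Nx0.
pose phi := normalize eta.
pose U1 : set V := timecone eta `&` phi @^-1` (U `&` W).
have oU1 : open U1 by apply: open_normalize; exact: openI.
have tU x : U1 x -> timecone eta x by case.
have NU x : U1 x -> N (phi x) by move=> [tx [_ Wx]]; split => //; exact: eform_normalize.
have Uphi x : U1 x -> U (phi x) by move=> [_ []].
pose s x : R := (rnorm eta x)^-1.
have sE x : U1 x -> s x = - h x x * rnorm eta x.
  move=> /tU tx; rewrite /s; have r0 := rnorm_gt0 tx.
  apply: (mulfI (lt0r_neq0 r0)); rewrite mulfV ?lt0r_neq0 //.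
  have := rnorm_sqr tx; rewrite mulrCA mulNr => /(congr1 -%R); rewrite opprK => <-.
  by rewrite mulrC.
have ss : smooth_on U1 s.
  apply: (@smooth_eq _ _ _ U1 (fun x => - h x x * rnorm eta x)) => //.
    by move=> x Ux; rewrite sE.
  apply: smoothM => //; first exact: smooth_eform_diag.
  by apply: smoothS (smooth_rnorm eta) => x /tU.
(* The extension of [iota] that is homogeneous of degree one. *)
pose G x := (s x)%:C *: F (phi x).
have csF i j : csmooth_on U1 (fun x => F (phi x) i j).
  have [fr fi] := smooth_mx_csmooth i j oU sF.
  have sphi k : smooth_on U1 (fun x => phi x 0 k).
    by apply: smoothS (smooth_normalize_coord eta k) => x /tU.
  by split=> k; [apply: (Ck_on_comp oU1 Uphi (fr k)) => l|
    apply: (Ck_on_comp oU1 Uphi (fi k)) => l]; exact: sphi.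
have csG i j : csmooth_on U1 (fun x => (s x)%:C * F (phi x) i j).
  by apply: csmoothM => //; exact: csmooth_real.
have sG : smooth_mx_on U1 G.
  apply: csmooth_smooth_mx => // i j; apply: csmooth_eq (csG i j) => // x _.
  by rewrite mxE.
have Fiota x : U1 x -> F (phi x) = iota (phi x) by move=> Ux; apply: FE; [exact: Uphi|exact: NU].
have isoF x v w : U1 x -> h (phi x) v = 0 -> h (phi x) w = 0 ->
    mform (mxD F (phi x) v) (mxD F (phi x) w) = (h v w)%:C.
  move=> Ux hv hw; have := iI (phi x) F (NU x Ux).
  rewrite mxD.unlock; apply => //; exists U; split=> //; exact: Uphi.
have mii x : U1 x -> mform (F (phi x)) (F (phi x)) = -1.
  by move=> Ux; rewrite Fiota //; apply/SL2C_mform/iSL/NU.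
have ds x v : U1 x -> 'D_v s x = - h (phi x) v.
  move=> Ux; have tx := tU x Ux; have r0 := lt0r_neq0 (rnorm_gt0 tx).
  rewrite [LHS](@deriveV _ _ (rnorm eta)) //; last first.
    by apply/diff_derivable/(smooth_differentiable (smooth_rnorm eta)).
  rewrite derive_rnorm // /phi /normalize eformZl -[_ *: _]/(_ * _); field.
  by rewrite r0.
(* Chain rule; the argument of [mxD F] is the component of [v] tangent at [phi x]. *)
have dG x v : U1 x ->
    mxD G x v = (- h (phi x) v)%:C *: F (phi x) + mxD F (phi x) (v + h (phi x) v *: phi x).
  move=> Ux; have tx := tU x Ux; have r0 := lt0r_neq0 (rnorm_gt0 tx).
  apply/matrixP => i j; rewrite (mxDE_on v i j sG Ux).
  have -> : cderive (fun y => G y i j) x v = cderive (fun y => (s y)%:C * F (phi y) i j) x v.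
    by apply: (eq_cderive v oU1 Ux) => y _; rewrite mxE.
  rewrite (cderiveM Ux v (csmooth_real oU1 ss) (csF i j)).
  have -> : cderive (fun y => (s y)%:C) x v = (- h (phi x) v)%:C.
    rewrite cderiveE -(ds x v Ux); congr (_ +i* _).
    by rewrite (_ : _ \o _ = cst 0) ?derive_cst.
  have linE c (A B : 'M[R[i]]_2) : (c *: A + B) i j = c * A i j + B i j by rewrite !mxE.
  rewrite linE; congr (_ + _).
  have dphi : differentiable phi x by exact: differentiable_normalize.
  rewrite (cderive_comp v (smooth_mx_csmooth i j oU sF) (Uphi x Ux) dphi).
  rewrite derive_normalize // -(mxDE_on _ i j sF (Uphi x Ux)) -/phi.
  set u := v + _.
  have := mxD_linear oU (rnorm eta x) u 0 sF (Uphi x Ux); rewrite !addr0 => ->.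
  have -> : mxD F (phi x) 0 = 0.
    have := mxD_linear oU (-1) 0 0 sF (Uphi x Ux).
    by rewrite scaler0 addr0 rmorphN1 scaleN1r addNr.
  rewrite addr0 [in LHS]mxE mulrA -rmorphM /s mulVf //.
  by rewrite rmorph1 mul1r.
have hphi x : U1 x -> h (phi x) (phi x) = -1 by move=> /NU[].
have tang x v : U1 x -> h (phi x) (v + h (phi x) v *: phi x) = 0.
  by move=> Ux; rewrite eformDr eformZr hphi // mulrN1 subrr.
have mGG x : U1 x -> mform (G x) (G x) = (h x x)%:C.
  move=> Ux; rewrite mformZl mformZr mii // mulrA -rmorphM mulrN1 -rmorphN /=; congr (_%:C).
  have := rnorm_sqr (tU x Ux); have r0 := lt0r_neq0 (rnorm_gt0 (tU x Ux)).
  rewrite /s => E; apply: (mulfI (mulf_neq0 r0 r0)); rewrite E; field.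
  by rewrite r0.
(* Differentiate [mform G G = h] at [phi x]. *)
have mFd x v : U1 x -> h (phi x) v = 0 -> mform (F (phi x)) (mxD F (phi x) v) = 0.
  move=> Ux hv; pose y := phi x; have hy : h y y = -1 by exact: hphi.
  have phiy : phi y = y by exact: normalize_unit.
  have Uy : U1 y.
    split; first exact: timecone_unit.
    by rewrite /= phiy; case: (Ux) => _.
  have := cderive_mform oU1 v sG sG Uy.
  have -> : cderive (fun z => mform (G z) (G z)) y v = 0.
    rewrite (eq_cderive v oU1 Uy mGG) cderiveE.
    apply/eqP; rewrite eq_complex /=; apply/andP; split; last first.
      by rewrite (_ : _ \o _ = cst 0) ?derive_cst.
    have -> : @complex.Re R \o (fun z : V => (h z z)%:C) = - (fun z : V => - h z z).
      by apply/funext => z; rewrite !fctE opprK.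
    rewrite deriveN; last first.
      exact: diff_derivable (smooth_differentiable (smooth_eform_diag eta openT) (I : setT y)).
    by rewrite derive_eform_diag hv mulr0 !oppr0.
  rewrite dG // phiy hv oppr0 rmorph0 scale0r add0r scale0r addr0.
  rewrite {1 2}/G phiy /s rnorm_unit // invr1 rmorph1 scale1r [mform (mxD _ _ _) _]mformC.
  rewrite -mulr2n -mulr_natr => /esym/eqP; rewrite mulf_eq0 pnatr_eq0 orbF => /eqP.
  by [].
have iG x v w : U1 x -> mform (mxD G x v) (mxD G x w) = (h v w)%:C.
  move=> Ux; rewrite !dG // !(mformDl, mformDr, mformZl, mformZr) mii //.
  rewrite isoF ?tang // mFd ?tang // [mform (mxD _ _ _) (F _)]mformC mFd ?tang //.
  rewrite !mulr0 addr0 add0r.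
  rewrite mulrN1 -rmorphN -!rmorphM -rmorphD /=; congr (_%:C).
  have := hphi x Ux; move: (phi x) => y hy.
  by rewrite !(eformDl, eformDr, eformZl, eformZr) hy [h v y]eformC; ring.
have Ux01 : U1 x0.
  split; first exact: timecone_unit.
  by rewrite /= /phi normalize_unit.
have /nbhs_ballP [e /= e0 BU] := open_near oU1 Ux01.
exists (fun i => mxD G x0 (delta_mx 0 i)); split; first exact: isometry_frame Ux01.
exists e => // x xB Nx; have Ux := BU _ xB; have [hx _] := Nx.
have phix : phi x = x by exact: normalize_unit.
(* Euler's identity: [mxD G x x = G x]. *)
have <- : G x = iota x by rewrite /G Fiota // phix /s rnorm_unit // invr1 rmorph1 scale1r.
rewrite -(mxD_sum x oU1 sG Ux01) -(isometry_derive_cst oU1 sG iG x BU xB) dG // phix hx.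
rewrite opprK rmorph1 scale1r scaleN1r subrr /G phix /s rnorm_unit // invr1 rmorph1 scale1r.
have -> : mxD F x 0 = 0; last by rewrite addr0.
have Uphix := Uphi x Ux; rewrite phix in Uphix.
have := mxD_linear oU (-1) 0 0 sF Uphix.
by rewrite scaler0 addr0 rmorphN1 scaleN1r addNr.
Qed.

(** The radial projection maps a neighbourhood of [x0] in [R^4] to points of the quadric near
    [x0]; so two linear maps that agree on the latter agree on an open set. *)
Lemma span_map_unique b b' x0 (e : R) : N x0 -> 0 < e ->
  (forall x, ball x0 e x -> N x -> span_map b x = span_map b' x) -> b = b'.
Proof.
move=> [hx0 Wx0] e0 bb'; pose phi := normalize eta.
have phix : phi x0 = x0 by exact: normalize_unit.
pose U := timecone eta `&` phi @^-1` (W `&` ball x0 e).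
have oU : open U by apply: open_normalize; apply: openI => //; exact: ball_open.
have Ux0 : U x0.
  by split; [exact: timecone_unit | rewrite /= phix; split => //; exact: ballxx].
apply/funext => i; rewrite -!span_map_delta -!(mxD_span_map _ x0).
apply: (eq_mxD _ oU Ux0) => y [ty [Wy By]].
rewrite -(normalizeK ty) -[_ *: _]addr0 !span_map_linear bb' //; last first.
  by split => //; exact: eform_normalize.
congr (_ + _); rewrite /span_map !big1 // => j _; by rewrite mxE rmorph0 scale0r.
Qed.

End LocalLinearity.
End FlatIsometry.

(** * Surfaces and charts *)

Section SurfaceBasics.
Context {R : realType} {S : surface R}.
Implicit Types (p q : S) (U : set S) (f : S -> 'M[R[i]]_2) (c d : chart R S).

(** Connectedness: the points where a given value is a witness form an open set, and so do
    the points that have another witness. *)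
Lemma surface_uniform (T : Type) (D : S -> T -> Prop) p0 :
  (forall p, exists a, \forall q \near p, D q a) ->
  (forall p a a', D p a -> D p a' -> a = a') ->
  exists a, forall p, D p a.
Proof.
move=> locD uD; have [a Da] := locD p0; exists a.
have Da0 := nbhs_singleton Da.
pose P : set S := [set p | D p a].
suff PT : P = setT by move=> p; rewrite -[D p a]/(P p) PT.
have oP : open P.
  rewrite openE => p Dp; have [a' Da'] := locD p.
  by have E : a' = a := uD _ _ _ (nbhs_singleton Da') Dp; rewrite E in Da'.
have oPC : open (~` P).
  rewrite openE => p Dp; have [a' Da'] := locD p.
  have Dap := nbhs_singleton Da'.
  apply: filterS Da' => q Dq Dqa; apply: Dp.
  have E : a' = a := uD _ _ _ Dq Dqa.
  by rewrite E in Dap.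
apply: (surface_connected (s := S)); first by exists p0.
  by exists P => //; rewrite setTI.
by exists P; rewrite ?setTI // -[P]setCK; exact: open_closedC.
Qed.

Lemma chart_image_open c U : open U -> open (chart_map c @` (chart_dom c `&` U)).
Proof.
move=> oU.
have -> : chart_map c @` (chart_dom c `&` U) =
    (chart_map c @` chart_dom c) `&` chart_inv c @^-1` U.
  rewrite eqEsubset; split=> x.
    by move=> [p [cp Up] <-]; split; [exists p | rewrite /= chart_mapK].
  move=> [[p cp <-]]; rewrite /= chart_mapK // => Up.
  by exists p.
rewrite openE => x [cx Ux]; apply: filterI.
  exact: open_near (@chart_img_open _ _ c) cx.
exact: (chart_inv_continuous cx) (open_near oU Ux).
Qed.

Lemma smooth_map_continuous U f p : open U -> smooth_map_on U f -> U p ->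
  {for p, continuous (@mx_reim R \o f)}.
Proof.
move=> oU sf Up; pose c := chart_at p.
have cp : chart_dom c p by exact: chart_at_dom.
have imp : (chart_map c @` (chart_dom c `&` U)) (chart_map c p) by exists p.
have cf := smooth_continuous (sf c (chart_at_atlas p)) imp.
have cm := chart_map_continuous cp.
have H : {for p, continuous ((@mx_reim R \o (f \o chart_inv c)) \o chart_map c)}.
  exact: continuous_comp cm cf.
rewrite /prop_for /continuous_at in H *.
have E : ((@mx_reim R \o (f \o chart_inv c)) \o chart_map c) p = (@mx_reim R \o f) p.
  by rewrite /= chart_mapK.
rewrite E in H; apply: cvg_trans H; apply: near_eq_cvg.
by apply: filterS (open_near (chart_dom_open c) cp) => q cq /=; rewrite chart_mapK.
Qed.

(** The differential at [p] of the change of coordinates from [c] to [d]: it converts the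
    [c]-coordinates of a tangent vector into its [d]-coordinates. *)
Definition transition c d p (v : 'rV[R]_2) : 'rV[R]_2 :=
  'D_v (chart_map d \o chart_inv c) (chart_map c p).

Lemma chart_change U f c d p v : open U -> U p -> smooth_map_on U f ->
  atlas c -> atlas d -> chart_dom c p -> chart_dom d p ->
  mxD (f \o chart_inv c) (chart_map c p) v =
  mxD (f \o chart_inv d) (chart_map d p) (transition c d p v).
Proof.
move=> oU Up sf ac ad cp dp.
pose X := chart_map c @` (chart_dom c `&` (chart_dom d `&` U)).
have oX : open X.
  by apply: chart_image_open; apply: openI => //; exact: chart_dom_open.
have Xp : X (chart_map c p) by exists p.
pose tau := chart_map d \o chart_inv c.
have dtau : differentiable tau (chart_map c p).
  by apply: smooth_differentiable (transition_smooth ac ad) _; exists p.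
have oc : open (chart_map c @` (chart_dom c `&` U)) by exact: chart_image_open.
have od : open (chart_map d @` (chart_dom d `&` U)) by exact: chart_image_open.
have taup : tau (chart_map c p) = chart_map d p by rewrite /tau /= chart_mapK.
have Ud : (chart_map d @` (chart_dom d `&` U)) (chart_map d p) by exists p.
have Uc : (chart_map c @` (chart_dom c `&` U)) (chart_map c p) by exists p.
have Ut : (chart_map d @` (chart_dom d `&` U)) (tau (chart_map c p)) by rewrite taup.
apply/matrixP => i j; rewrite (mxDE_on v i j (sf c ac) Uc).
rewrite (mxDE_on (transition c d p v) i j (sf d ad) Ud) /transition -taup.
rewrite -(cderive_comp v (smooth_mx_csmooth i j od (sf d ad)) Ut dtau).
apply: (eq_cderive v oX Xp) => y [q [cq [dq Uq]] <-].
by rewrite /tau /= chart_mapK // chart_mapK.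
Qed.

Lemma diff_atE f p v :
  diff_at f (v : tangent p) = mxD (f \o chart_inv (chart_at p)) (chart_map (chart_at p) p) v.
Proof. by rewrite mxD.unlock. Qed.

Lemma diff_at_chart U f c p v : open U -> U p -> smooth_map_on U f ->
  atlas c -> chart_dom c p ->
  diff_at f (transition c (chart_at p) p v : tangent p)
    = mxD (f \o chart_inv c) (chart_map c p) v.
Proof.
move=> oU Up sf ac cp; rewrite diff_atE -(chart_change v oU Up sf ac) //.
  exact: chart_at_atlas.
exact: chart_at_dom.
Qed.

Lemma chart_diff_at U f c p v : open U -> U p -> smooth_map_on U f ->
  atlas c -> chart_dom c p ->
  diff_at f (v : tangent p)
    = mxD (f \o chart_inv c) (chart_map c p) (transition (chart_at p) c p v).
Proof.
move=> oU Up sf ac cp; rewrite diff_atE (chart_change v oU Up sf (chart_at_atlas p) ac) //.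
exact: chart_at_dom.
Qed.

Lemma diff_at_linear U f p (a : R) (v w : 'rV[R]_2) : open U -> U p -> smooth_map_on U f ->
  diff_at f (a *: v + w : tangent p) =
  a%:C *: diff_at f (v : tangent p) + diff_at f (w : tangent p).
Proof.
move=> oU Up sf; rewrite !diff_atE.
apply: (mxD_linear _ a v w (sf _ (chart_at_atlas p))); first exact: chart_image_open.
by exists p => //; split => //; exact: chart_at_dom.
Qed.

Section LinearImage.
Variables (eta : 'I_4 -> R) (W : set 'rV[R]_4) (sigma : S -> 'M[R[i]]_2).
Hypotheses (eta2 : forall i, eta i * eta i = 1) (oW : open W)
  (ssigma : smooth_map_on setT sigma).
Local Notation N := [set x | eform eta x x = -1 /\ W x].

(** The linear map that coincides with [iota] near a point of the image is unique, hence
    locally constant along the surface, hence constant. *)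
Lemma in_linear_image p0 : in_isometric_image sigma N (eform eta) ->
  exists b, orthonormal eta b /\ forall p, exists2 x, N x & sigma p = span_map b x.
Proof.
move=> [iota [iso sub]].
have [_ _ _ [ci [j [jK cj]]] _] := iso.
pose X p := j (mx_reim (sigma p)).
have XE p : N (X p) /\ iota (X p) = sigma p.
  by have [x Nx xE] := sub (sigma p) (ex_intro2 _ _ p I erefl); rewrite /X -xE jK.
have cX p : {for p, continuous X}.
  have csig := smooth_map_continuous openT ssigma (I : setT p).
  have [NX XpE] := XE p.
  have Ap : ((@mx_reim R \o iota) @` N) (mx_reim (sigma p)).
    by exists (X p) => //=; rewrite XpE.
  move/subspace_continuousP : cj => /(_ _ Ap) cjp B nB.
  have H : \forall q \near p, ((@mx_reim R \o iota) @` N) (mx_reim (sigma q)) -> B (X q).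
    exact: csig _ (cjp B nB).
  apply: filterS H => q; apply; exists (X q); first by have [] := XE q.
  by rewrite /= (XE q).2.
pose D p b := orthonormal eta b /\ exists2 e : R, 0 < e &
  forall x, ball (X p) e x -> N x -> iota x = span_map b x.
have [b Db] : exists b, forall p, D p b.
  apply: (@surface_uniform _ D p0) => [p|p b b' [ob [e e0 He]] [ob' [e' e0' He']]].
    have [b [ob [e e0 He]]] := isometric_embedding_linear eta2 oW iso (XE p).1.
    exists b; have e2 : 0 < e / 2 by rewrite divr_gt0.
    have nB : nbhs (X p) (ball (X p) (e / 2)) by apply: nbhsx_ballx.
    have H : \forall q \near p, ball (X p) (e / 2) (X q) by exact: cX p _ nB.
    apply: filterS H => q Bq; split => //.
    exists (e / 2) => // x Bx; apply: He.
    by rewrite [e]splitr; exact: ball_triangle Bq Bx.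
  have em : 0 < Num.min e e' by rewrite lt_min e0.
  apply: (span_map_unique oW (XE p).1 em) => x Bx Nx.
  rewrite -He // -?He' //; apply: le_ball Bx; first by rewrite ge_min lexx orbT.
  by rewrite ge_min lexx.
exists b; split=> [|p]; first by have [] := Db p0.
exists (X p); first exact: (XE p).1.
have [_ [e e0 He]] := Db p; rewrite -He //; [by rewrite (XE p).2 | exact: ballxx | exact: (XE p).1].
Qed.

End LinearImage.
End SurfaceBasics.

(** * Unit normals *)

(** The differentials of maps on the surface, locked for the same reason as [cderive]. *)
HB.lock Definition tdiff (R : realType) (S : surface R) (f : S -> 'M[R[i]]_2) (p : S)
  (v : 'rV[R]_2) : 'M[R[i]]_2 := diff_at f (v : tangent p).
HB.lock Definition ctdiff (R : realType) (S : surface R) (f : S -> 'M[R[i]]_2) (p : S)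
  (X : 'rV[R[i]]_2) : 'M[R[i]]_2 := cdiff_at f (X : ctangent p).

Section Hypersurface.
Context {R : realType} {S : surface R}.
Variable sigma : S -> 'M[R[i]]_2.
Hypothesis sigma_adm : admissible sigma.
Implicit Types (p q : S) (U : set S) (nu : S -> 'M[R[i]]_2) (c : chart R S) (n : 'M[R[i]]_2).
Local Notation T := 'rV[R]_2.

Lemma sigma_smooth : smooth_map_on setT sigma.
Proof. by case: sigma_adm => -[]. Qed.

Lemma mform_sigma p : mform (sigma p) (sigma p) = -1.
Proof. by case: sigma_adm => -[/(_ p)/SL2C_mform]. Qed.

Lemma tdiffE f p v :
  tdiff f p v = mxD (f \o chart_inv (chart_at p)) (chart_map (chart_at p) p) v.
Proof. by rewrite tdiff.unlock diff_atE. Qed.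

Lemma tdiff_chart U f c p v : open U -> U p -> smooth_map_on U f ->
  atlas c -> chart_dom c p ->
  tdiff f p (transition c (chart_at p) p v) = mxD (f \o chart_inv c) (chart_map c p) v.
Proof. by move=> oU Up sf ac cp; rewrite tdiff.unlock; exact: diff_at_chart sf ac cp. Qed.

Lemma chart_tdiff U f c p v : open U -> U p -> smooth_map_on U f ->
  atlas c -> chart_dom c p ->
  tdiff f p v = mxD (f \o chart_inv c) (chart_map c p) (transition (chart_at p) c p v).
Proof. by move=> oU Up sf ac cp; rewrite tdiff.unlock; exact: chart_diff_at sf ac cp. Qed.

Lemma tdiff_linear U f p (a : R) (v w : T) : open U -> U p -> smooth_map_on U f ->
  tdiff f p (a *: v + w) = a%:C *: tdiff f p v + tdiff f p w.
Proof. by move=> oU Up sf; rewrite tdiff.unlock; exact: diff_at_linear sf. Qed.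

Lemma tdiff0 U f p : open U -> U p -> smooth_map_on U f -> tdiff f p 0 = 0.
Proof.
move=> oU Up sf; have := tdiff_linear (-1) 0 0 oU Up sf.
by rewrite scaler0 addr0 rmorphN1 scaleN1r addNr.
Qed.

Lemma tdiff_sum U f p (v : T) : open U -> U p -> smooth_map_on U f ->
  tdiff f p v = \sum_a (v 0 a)%:C *: tdiff f p (delta_mx 0 a).
Proof.
move=> oU Up sf; rewrite {1}(row_sum_delta v).
elim: (index_enum _) => [|i s IH]; first by rewrite !big_nil (tdiff0 oU Up sf).
by rewrite !big_cons (tdiff_linear _ _ _ oU Up sf) IH.
Qed.

Lemma ctdiffE U f p (X : 'rV[R[i]]_2) : open U -> U p -> smooth_map_on U f ->
  ctdiff f p X = \sum_a X 0 a *: tdiff f p (delta_mx 0 a).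
Proof.
move=> oU Up sf; transitivity (tdiff f p (map_mx (@complex.Re R) X)
    + 'i *: tdiff f p (map_mx (@complex.Im R) X)).
  by rewrite tdiff.unlock ctdiff.unlock.
rewrite !(tdiff_sum _ oU Up sf) scaler_sumr -big_split; apply: eq_bigr => a _ /=.
rewrite scalerA -scalerDl !mxE; congr (_ *: _).
by case: (X 0 a) => x y /=; simpc.
Qed.

Lemma ctdiff_cvec U f p (v : T) : open U -> U p -> smooth_map_on U f ->
  ctdiff f p (map_mx (real_complex R) v) = tdiff f p v.
Proof.
move=> oU Up sf; rewrite (ctdiffE _ oU Up sf) [RHS](tdiff_sum _ oU Up sf).
by apply: eq_bigr => a _; rewrite mxE.
Qed.

Lemma pullbackE p (X Y : 'rV[R[i]]_2) :
  pullback sigma (X : ctangent p) (Y : ctangent p) = mform (ctdiff sigma p X) (ctdiff sigma p Y).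
Proof. by rewrite ctdiff.unlock. Qed.

Lemma pullback_cvec p (v w : T) : pullback sigma (cvec (v : tangent p)) (cvec (w : tangent p))
  = mform (tdiff sigma p v) (tdiff sigma p w).
Proof. by rewrite pullbackE /cvec !(ctdiff_cvec _ openT (I : setT p) sigma_smooth). Qed.

Lemma mform_sigma_chart c p v : atlas c -> chart_dom c p ->
  mform (sigma p) (mxD (sigma \o chart_inv c) (chart_map c p) v) = 0.
Proof.
move=> ac cp; pose X := chart_map c @` (chart_dom c `&` setT).
have oX : open X by apply: chart_image_open; exact: openT.
have Xp : X (chart_map c p) by exists p.
have sX : smooth_mx_on X (sigma \o chart_inv c) := sigma_smooth ac.
have := cderive_mform oX v sX sX Xp.
have -> : cderive (fun y => mform ((sigma \o chart_inv c) y) ((sigma \o chart_inv c) y))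
    (chart_map c p) v = 0.
  rewrite (eq_cderive (g := fun=> -1) v oX Xp) ?cderive_cst // => y _.
  exact: mform_sigma.
rewrite [X in X + _]mformC /= chart_mapK // -mulr2n -mulr_natr => /esym/eqP.
by rewrite mulf_eq0 pnatr_eq0 orbF => /eqP.
Qed.

Lemma mform_sigma_diff p (v : T) : mform (sigma p) (tdiff sigma p v) = 0.
Proof.
rewrite tdiffE; apply: mform_sigma_chart; first exact: chart_at_atlas.
exact: chart_at_dom.
Qed.

Definition unit_normal p n := [/\ mform n (sigma p) = 0, mform n n = 1 &
  forall v : T, mform n (tdiff sigma p v) = 0].

Lemma normal_field_unit U nu q : open U -> normal_field_on sigma U nu -> U q ->
  unit_normal q (nu q).
Proof.
move=> oU [_ H] Uq; have [tn nn no] := H q Uq.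
split=> // [|v]; last by rewrite -(ctdiff_cvec v openT (I : setT q) sigma_smooth) ctdiff.unlock.
rewrite mformC; apply/tangent_mform => //.
by apply/SL2C_mform; exact: mform_sigma.
Qed.

Definition adapted_frame p n : 'I_4 -> 'M[R[i]]_2 := fun i =>
  nth 0 [:: sigma p; tdiff sigma p (delta_mx 0 0);
            tdiff sigma p (delta_mx 0 1); n] i.

(** A vector in the kernel of the Gram matrix is a combination of [sigma p], of [d sigma (X)]
    with [X] complex, and of [n], orthogonal to all of them; the first and last
    coefficients vanish at once, and [X] vanishes by admissibility. *)
Lemma adapted_frame_unit p n (k : R[i]) : k != 0 -> unit_normal p n ->
  gram (adapted_frame p (k *: n)) \in unitmx.
Proof.
move=> k0 [ns nn nd].
suff H (u : 'rV[R[i]]_4) : u *m gram (adapted_frame p (k *: n)) = 0 -> u = 0.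
  rewrite -row_free_unit -kermx_eq0; apply/eqP/row_matrixP => i.
  by rewrite row0; apply: H; rewrite -row_mul mulmx_ker row0.
move=> u0.
pose M := \sum_i u 0 i *: adapted_frame p (k *: n) i.
have M0 j : mform M (adapted_frame p (k *: n) j) = 0.
  have := congr1 (fun A : 'rV_4 => A 0 j) u0; rewrite [LHS]mxE [RHS]mxE => <-.
  by rewrite mform_suml; apply: eq_bigr => i _; rewrite mformZl mxE.
pose X : 'rV[R[i]]_2 := \row_a (if a == 0 then u 0 1 else u 0 2%:R).
have ME : M = u 0 0 *: sigma p + ctdiff sigma p X + u 0 3%:R *: (k *: n).
  by rewrite /M sum4E (ctdiffE _ openT (I : setT p) sigma_smooth) sum2E !mxE /= !addrA.
have Xs (N : 'M[R[i]]_2) : (forall v : T, mform N (tdiff sigma p v) = 0) ->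
    mform N (ctdiff sigma p X) = 0.
  move=> HN; rewrite (ctdiffE _ openT (I : setT p) sigma_smooth) mform_sumr big1 // => a _.
  by rewrite mformZr HN mulr0.
have Xsig := Xs _ (mform_sigma_diff p); have Xn := Xs _ nd.
have [D DE] : exists D, D = ctdiff sigma p X by eexists.
rewrite -DE in ME Xsig Xn.
have z0 : u 0 0 = 0.
  have := M0 0; rewrite ME /adapted_frame /= !mformDl !mformZl mform_sigma ns.
  by rewrite (mformC D) Xsig !mulr0 !addr0 mulrN1 => /eqP; rewrite oppr_eq0 => /eqP.
have z3 : u 0 3%:R = 0.
  have := M0 3%:R; rewrite ME /adapted_frame /= !mformZr => /eqP.
  rewrite mulf_eq0 (negPf k0) /= !mformDl !mformZl nn mulr1 (mformC (sigma p)) ns.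
  rewrite mulr0 (mformC D) Xn !add0r mulf_eq0 (negPf k0) orbF => /eqP //.
have X0 : X = 0.
  apply: (sigma_adm.2 p) => Y; rewrite pullbackE -DE mformC.
  rewrite (ctdiffE Y openT (I : setT p) sigma_smooth) mform_suml sum2E !mformZl.
  have MX : M = D by rewrite ME z0 z3 !scale0r add0r addr0.
  have := M0 1; have := M0 2%:R; rewrite MX /adapted_frame /= mformC => -> ; rewrite mformC => ->.
  by rewrite !mulr0 addr0.
apply/rowP; apply: ord4_ind; rewrite !mxE //.
  by have := congr1 (fun A : 'rV_2 => A 0 0) X0; rewrite !mxE.
by have := congr1 (fun A : 'rV_2 => A 0 1) X0; rewrite !mxE.
Qed.

Lemma adapted_frame_mform0 p n (k : R[i]) M : k != 0 -> unit_normal p n ->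
  mform M (sigma p) = 0 -> (forall v : T, mform M (tdiff sigma p v) = 0) ->
  mform M n = 0 -> M = 0.
Proof.
move=> k0 un Ms Md Mn; apply: (frame_nondegenerate (adapted_frame_unit k0 un)).
apply: ord4_ind; rewrite /adapted_frame //= ?Ms ?Md //.
by rewrite mformZr Mn mulr0.
Qed.

(** [sigma p] and the image of [d sigma] span a non-degenerate space of dimension three,
    whose orthogonal is a line. *)
Lemma unit_normal_unique p n n' : unit_normal p n -> unit_normal p n' ->
  n' = n \/ n' = - n.
Proof.
move=> un un'; have [ns nn nd] := un; have [ns' nn' nd'] := un'.
have E : n' = mform n' n *: n.
  apply/subr0_eq/(@adapted_frame_mform0 p n 1) => //; rewrite ?oner_neq0 //.
  - by rewrite mformDl mformNl mformZl ns ns' mulr0 subr0.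
  - by move=> v; rewrite mformDl mformNl mformZl nd nd' mulr0 subr0.
  - by rewrite mformDl mformNl mformZl nn mulr1 subrr.
move: nn'; rewrite [in LHS]E mformZl mformZr nn mulr1 => /eqP.
rewrite -expr2 sqrf_eq1 => /orP[]/eqP a1; rewrite E a1 ?scale1r ?scaleN1r; [by left|by right].
Qed.

Lemma immersion_cdiff p (X : 'rV[R[i]]_2) : ctdiff sigma p X = 0 -> X = 0.
Proof.
by move=> X0; apply: (sigma_adm.2 p) => Y; rewrite pullbackE X0 mform0l.
Qed.

End Hypersurface.

(** * Surfaces in a real form: the shape operator *)

Section RealStructure.
Context {R : realType}.
Implicit Types (b : 'I_4 -> 'M[R[i]]_2) (M N : 'M[R[i]]_2).

Lemma frame_conj_expand b (a : 'I_4 -> R[i]) : gram b \in unitmx -> real_gram b ->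
  frame_conj b (\sum_i a i *: b i) = \sum_i conjc (a i) *: b i.
Proof.
move=> ub rb; rewrite (antilinear_sum _ _ (frame_conj_antilinear b)).
by apply: eq_bigr => i _; rewrite frame_conj_fix.
Qed.

(** The conjugation is an antilinear isometry, because its fixed frame has real products. *)
Lemma mform_frame_conj b M N : gram b \in unitmx -> real_gram b ->
  mform (frame_conj b M) (frame_conj b N) = conjc (mform M N).
Proof.
move=> ub rb; rewrite (frame_expand M ub) (frame_expand N ub).
move: (frame_coord b M 0) (frame_coord b N 0) => a c.
rewrite !frame_conj_expand // !mform_suml rmorph_sum; apply: eq_bigr => i _ /=.
rewrite !mform_sumr rmorph_sum; apply: eq_bigr => j _ /=.
have := rb i j; rewrite mxE !mformZl !mformZr.
move: (mform _ _) (a i) (c j) => m x y rm.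
by rewrite !rmorphM /= rm.
Qed.

Lemma frame_conjN b M : frame_conj b (- M) = - frame_conj b M.
Proof.
by rewrite -scaleN1r (antilinearZ _ _ (frame_conj_antilinear b)) rmorphN1 scaleN1r.
Qed.

Section Orthonormal.
Variables (eta : 'I_4 -> R) (b : 'I_4 -> 'M[R[i]]_2).
Hypotheses (eta2 : forall i, eta i * eta i = 1) (ob : orthonormal eta b).
Let ub := orthonormal_gram eta2 ob.
Let rb := orthonormal_real_gram ob.

Lemma frame_conj_real M : (forall i, conjc (mform M (b i)) = mform M (b i)) ->
  frame_conj b M = M.
Proof.
move=> rM; apply/subr0_eq/(frame_nondegenerate ub) => i.
by rewrite mformDl mformNl -{1}(frame_conj_fix i ub rb) mform_frame_conj // rM subrr.
Qed.

Lemma real_frame_conj M i : frame_conj b M = M -> conjc (mform M (b i)) = mform M (b i).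
Proof. by move=> CM; rewrite -(mform_frame_conj M (b i) ub rb) CM frame_conj_fix. Qed.

Lemma frame_conj_span x : frame_conj b (span_map b x) = span_map b x.
Proof.
rewrite /span_map frame_conj_expand //; apply: eq_bigr => i _.
by rewrite conjc_real.
Qed.

Lemma frame_conj_spanP M : frame_conj b M = M -> exists x, M = span_map b x.
Proof.
move=> CM; exists (\row_i (eta i * complex.Re (mform M (b i)))).
apply/subr0_eq/(frame_nondegenerate ub) => i.
rewrite mformDl mformNl -{2}[b i]span_map_delta (mform_span_map _ _ ob).
rewrite /eform (bigD1 i) //= big1 => [|j ji]; last by rewrite !mxE (negPf ji) andbF !mulr0.
rewrite !mxE !eqxx mulr1 addr0 mulrA eta2 mul1r.
have := real_frame_conj i CM; case: (mform M (b i)) => x y /= [/eqP].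
by rewrite -subr_eq0 -opprD oppr_eq0 -mulr2n mulrn_eq0 /= => /eqP ->; rewrite subrr.
Qed.

(** The real span of the frame is a closed subspace, so a map into it
    has its derivative in it. *)
Lemma frame_conj_mxD (V : normedModType R) (U : set V) (F : V -> 'M[R[i]]_2) (x v : V) :
  open U -> U x -> smooth_mx_on U F -> (forall y, U y -> frame_conj b (F y) = F y) ->
  frame_conj b (mxD F x v) = mxD F x v.
Proof.
move=> oU Ux sF CF; apply: frame_conj_real => i.
have sb : smooth_mx_on U (fun=> b i) by apply: csmooth_smooth_mx => // k l; exact: csmooth_cst.
have dF : cderive (fun y => mform (F y) (b i)) x v = mform (mxD F x v) (b i).
  rewrite (cderive_mform oU v sF sb Ux).
  have -> : mxD (fun=> b i) x v = 0; last by rewrite mform0r addr0.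
  by apply/matrixP => k l; rewrite (mxDE_on v k l sb Ux) cderive_cst mxE.
rewrite -dF -(cderive_conj Ux v (csmooth_mform oU sF sb)).
by apply: (eq_cderive v oU Ux) => y Uy; apply: real_frame_conj; exact: CF.
Qed.

End Orthonormal.
End RealStructure.

Section ImageToShape.
Context {R : realType} {S : surface R}.
Variables (sigma : S -> 'M[R[i]]_2) (Psi : S -> 'M[R[i]]_2).
Hypotheses (sigma_adm : admissible sigma) (Psi_shape : shape_operator sigma Psi).
Variables (eta : 'I_4 -> R) (b : 'I_4 -> 'M[R[i]]_2).
Hypotheses (eta2 : forall i, eta i * eta i = 1) (ob : orthonormal eta b)
  (sigma_real : forall p, frame_conj b (sigma p) = sigma p).
Implicit Types (p q : S).
Local Notation C := (frame_conj b).
Let ub := orthonormal_gram eta2 ob.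
Let rb := orthonormal_real_gram ob.

Lemma smooth_map_scale (k : R[i]) (U : set S) (f : S -> 'M[R[i]]_2) : open U ->
  smooth_map_on U f -> smooth_map_on U (fun q => k *: f q).
Proof.
move=> oU sf c ac; have oX := chart_image_open (c := c) oU.
apply: csmooth_smooth_mx => // i j.
apply: csmooth_eq (csmoothM oX (csmooth_cst k oX) (smooth_mx_csmooth i j oX (sf c ac))) => //.
by move=> x _; rewrite /= mxE.
Qed.

Lemma tdiff_scale (k : R[i]) (U : set S) (f : S -> 'M[R[i]]_2) p v : open U -> U p ->
  smooth_map_on U f -> tdiff (fun q => k *: f q) p v = k *: tdiff f p v.
Proof.
move=> oU Up sf; rewrite !tdiffE; set c := chart_at p.
have ac : atlas c by exact: chart_at_atlas.
have cp : chart_dom c p by exact: chart_at_dom.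
have oX := chart_image_open (c := c) oU.
have Xp : (chart_map c @` (chart_dom c `&` U)) (chart_map c p) by exists p.
have skf := smooth_map_scale k oU sf ac.
apply/matrixP => i j; rewrite (mxDE_on v i j skf Xp) [RHS]mxE (mxDE_on v i j (sf c ac) Xp).
rewrite -[RHS]add0r -[in RHS](mul0r ((f \o chart_inv c) (chart_map c p) i j)).
rewrite -(cderive_cst k (chart_map c p) v).
rewrite -(cderiveM Xp v (csmooth_cst k oX) (smooth_mx_csmooth i j oX (sf c ac))).
by congr (cderive _ _ v); apply/funext => y /=; rewrite mxE.
Qed.

Lemma frame_conj_tdiff (U : set S) (f : S -> 'M[R[i]]_2) p v : open U -> U p ->
  smooth_map_on U f -> (forall q, U q -> C (f q) = f q) -> C (tdiff f p v) = tdiff f p v.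
Proof.
move=> oU Up sf Cf; rewrite tdiffE; set c := chart_at p.
have ac : atlas c by exact: chart_at_atlas.
have cp : chart_dom c p by exact: chart_at_dom.
apply: (frame_conj_mxD eta2 ob v (chart_image_open (c := c) oU) _ (sf c ac)); first by exists p.
by move=> y [q [cq Uq] <-] /=; rewrite chart_mapK //; exact: Cf.
Qed.

Lemma tdiff_real p v : C (tdiff sigma p v) = tdiff sigma p v.
Proof.
apply: (frame_conj_tdiff v openT (I : setT p) (sigma_smooth sigma_adm)) => q _.
exact: sigma_real.
Qed.

Lemma conj_unit_normal p n : unit_normal sigma p n -> unit_normal sigma p (C n).
Proof.
move=> [ns nn nd]; split=> [||v].
- by rewrite -(sigma_real p) mform_frame_conj // ns rmorph0.
- by rewrite mform_frame_conj // nn rmorph1.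
- by rewrite -tdiff_real mform_frame_conj // nd rmorph0.
Qed.

Lemma local_normal p : exists (U : set S) nu, [/\ open U, U p, smooth_map_on U nu,
  (forall q, U q -> unit_normal sigma q (nu q)) &
  forall X, ctdiff nu p X = - ctdiff sigma p (X *m Psi p)].
Proof.
have [U [nu [oU Up nf shape]]] := Psi_shape p.
exists U, nu; split=> //; first by case: nf.
  by move=> q; exact: normal_field_unit nf.
by rewrite ctdiff.unlock.
Qed.

(** For a unit normal field this function takes the values [1] and [-1] only, according to
    whether the conjugation fixes or negates the normal. *)
Lemma continuous_conj_norm p (U : set S) (nu : S -> 'M[R[i]]_2) : open U -> U p ->
  smooth_map_on U nu ->
  {for p, continuous (fun q => complex.Re (mform (C (nu q)) (nu q)))}.
Proof.
move=> oU Up snu.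
have cnu := smooth_map_continuous oU snu Up.
have sM (P : 'M[R[i]]_2) : smooth_mx_on setT (fun _ : 'M[R]_2 * 'M[R]_2 => P).
  by apply: csmooth_smooth_mx => [|k l]; [exact: openT|exact/csmooth_cst/openT].
have sC : smooth_mx_on setT (fun P : 'M[R]_2 * 'M[R]_2 => C (mx_of_reim P)).
  apply: csmooth_smooth_mx; first exact: openT.
  move=> k l; apply: (@csmooth_eq _ _ _ (fun P => \sum_i \sum_j
     (invmx (gram b) i j * conjc (mform (b i) (mx_of_reim P))) * b j k l)); first exact: openT.
    move=> P _; rewrite /frame_conj summxE; apply: eq_bigr => i _.
    by rewrite summxE; apply: eq_bigr => j _; rewrite mxE.
  apply: csmooth_sum => [|i]; first exact: openT.
  apply: csmooth_sum => [|j]; first exact: openT.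
  apply: csmoothM; [exact: openT| |exact/csmooth_cst/openT].
  apply: csmoothM; [exact: openT|exact/csmooth_cst/openT|].
  apply: csmooth_conj; first exact: openT.
  by apply: csmooth_mform; [exact: openT|exact: sM|exact: smooth_mx_of_reim].
have [sr _] := csmooth_mform openT sC smooth_mx_of_reim.
have cr := smooth_continuous sr (I : setT (mx_reim (nu p))).
have := continuous_comp cnu cr.
rewrite (_ : _ \o _ = (fun q => complex.Re (mform (C (nu q)) (nu q)))) //.
by apply/funext => q /=; rewrite mx_reimK.
Qed.

(** The conjugation maps a unit normal to a unit normal, hence to itself or its opposite;
    by connectedness the sign is the same at all points. *)
Lemma conj_normal_sign p0 : exists s : bool,
  forall p n, unit_normal sigma p n -> C n = (-1) ^+ s *: n.
Proof.
have sgnE p n : unit_normal sigma p n -> exists s : bool, C n = (-1) ^+ s *: n.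
  move=> un; case: (unit_normal_unique sigma_adm un (conj_unit_normal un)) => ->.
    by exists false; rewrite expr0 scale1r.
  by exists true; rewrite expr1 scaleN1r.
have uniq p n n' (s : bool) : unit_normal sigma p n -> unit_normal sigma p n' ->
    C n = (-1) ^+ s *: n -> C n' = (-1) ^+ s *: n'.
  move=> un un' Cn; case: (unit_normal_unique sigma_adm un un') => -> //.
  by rewrite frame_conjN Cn scalerN.
have val p n (s : bool) : unit_normal sigma p n -> C n = (-1) ^+ s *: n ->
    complex.Re (mform (C n) n) = (-1) ^+ s.
  by move=> [_ nn _] ->; rewrite mformZl nn mulr1; case: s.
have sgn_inj (s s' : bool) : `|(-1) ^+ s - (-1) ^+ s' : R| < 1 -> s = s'.
  by case: s; case: s' => //; rewrite expr0 expr1 ?opprK;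
    [rewrite -opprD normrN|]; rewrite -[1 + 1]/(2%:R) ger0_norm // => /ltW; rewrite lern1.
pose D p (s : bool) := forall n, unit_normal sigma p n -> C n = (-1) ^+ s *: n.
suff [s Ds] : exists s, forall p, D p s by exists s.
apply: (@surface_uniform _ _ _ D p0).
  move=> p; have [U [nu [oU Up snu unu _]]] := local_normal p.
  have [s Cs] := sgnE p _ (unu p Up); exists s.
  have cn := continuous_conj_norm oU Up snu.
  have near1 : \forall q \near p, `|complex.Re (mform (C (nu p)) (nu p))
     - complex.Re (mform (C (nu q)) (nu q))| < 1.
    by move/cvgrPdist_lt : cn => /(_ 1 ltr01).
  apply: filterS (filterI near1 (open_near oU Up)) => q [d1 Uq] n un.
  have [s' Cs'] := sgnE q _ (unu q Uq).
  rewrite (val p _ s (unu p Up) Cs) (val q _ s' (unu q Uq) Cs') in d1.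
  by rewrite (sgn_inj _ _ d1); exact: uniq (unu q Uq) un Cs'.
move=> p s s' Hs Hs'; have [U [nu [oU Up snu unu _]]] := local_normal p.
have un := unu p Up; apply: sgn_inj.
by rewrite -(val p _ s un (Hs _ un)) -(val p _ s' un (Hs' _ un)) subrr normr0 ltr01.
Qed.

(** The field [k nu] takes values in the real form, hence so does its derivative
    [- d sigma (k Psi v)]. Since [d sigma] is real and injective on complex tangent vectors,
    [k Psi v] is real. *)
Lemma real_shape (k : R[i]) : k != 0 ->
  (forall p n, unit_normal sigma p n -> C (k *: n) = k *: n) ->
  real_endo (fun p => k *: Psi p).
Proof.
move=> k0 Ck p v; have [U [nu [oU Up snu unu shape]]] := local_normal p.
have sknu := smooth_map_scale k oU snu.
have := frame_conj_tdiff v oU Up sknu (fun q Uq => Ck q _ (unu q Uq)).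
rewrite (tdiff_scale k v oU Up snu) -(ctdiff_cvec v oU Up snu) shape.
set X := map_mx (real_complex R) v *m Psi p.
have lin (a : R[i]) (Y Y' : 'rV[R[i]]_2) :
    ctdiff sigma p (a *: Y + Y') = a *: ctdiff sigma p Y + ctdiff sigma p Y'.
  rewrite !(ctdiffE _ openT (I : setT p) (sigma_smooth sigma_adm)) !sum2E !mxE.
  by rewrite scalerDr !scalerDl -!scalerA addrACA.
have conjX (Y : 'rV[R[i]]_2) : C (ctdiff sigma p Y) = ctdiff sigma p (map_mx (@conjc R) Y).
  rewrite !(ctdiffE _ openT (I : setT p) (sigma_smooth sigma_adm)) !sum2E !mxE.
  rewrite frame_conj_antilinear (antilinearZ _ _ (frame_conj_antilinear b)).
  by rewrite !tdiff_real.
have scl (a : R[i]) (Y : 'rV[R[i]]_2) : ctdiff sigma p (a *: Y) = a *: ctdiff sigma p Y.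
  have := lin (-1) 0 0; rewrite scaler0 addr0 scaleN1r addNr => l0.
  by have := lin a Y 0; rewrite l0 !addr0.
rewrite scalerN frame_conjN -scl conjX => /oppr_inj E.
have {}E : map_mx (@conjc R) (k *: X) = k *: X.
  apply/subr0_eq/(@immersion_cdiff _ _ _ sigma_adm p).
  by rewrite addrC -scaleN1r lin E scaleN1r addNr.
exists (map_mx (@complex.Re R) (k *: X)); rewrite /cvec -scalemxAr -/X.
apply/rowP => a; move/rowP : E => /(_ a); rewrite [LHS]mxE => E.
rewrite [RHS]mxE [in RHS]mxE; move: E; case: ((k *: X) 0 a) => x y /= [/eqP].
by rewrite -subr_eq0 -opprD oppr_eq0 -mulr2n mulrn_eq0 /= => /eqP ->.
Qed.

End ImageToShape.

(** * Orthogonal bases and signs of squares *)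

Section OrthogonalBasis.
Context {R : realType}.
Local Notation T := 'rV[R]_2.
Variable g : T -> T -> R.
Hypotheses (gC : forall u v, g u v = g v u)
  (gl : forall (a : R) u v w, g (a *: u + v) w = a * g u w + g v w)
  (g_nondeg : forall v, (forall w, g v w = 0) -> v = 0).

Let gZ (a : R) u w : g (a *: u) w = a * g u w.
Proof.
have := gl 1 0 0 w; rewrite scaler0 addr0 mul1r => /eqP.
rewrite -{1}[g 0 w]addr0 (inj_eq (addrI _)) eq_sym => /eqP g0.
by have := gl a u 0 w; rewrite g0 !addr0.
Qed.

Let gD u v w : g (u + v) w = g u w + g v w.
Proof. by have := gl 1 u v w; rewrite scale1r mul1r. Qed.

Let complete v u : g v v != 0 -> (forall t : R, u != t *: v) ->
  (forall x, exists s t : R, x = s *: v + t *: u) ->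
  exists w, [/\ g v w = 0, g w w != 0 & forall x, exists s t : R, x = s *: v + t *: w].
Proof.
move=> gv nuv span; pose r := g v u / g v v; exists (u - r *: v).
have vw0 : g v (u - r *: v) = 0.
  by rewrite gC -scaleNr gD gZ gC mulNr /r divfK // subrr.
have span' x : exists s t : R, x = s *: v + t *: (u - r *: v).
  have [s [t ->]] := span x; exists (s + t * r), t.
  by rewrite scalerBr scalerDl scalerA -addrA; congr (_ + _); rewrite addrCA subrr addr0.
split=> //; apply/eqP => ww0.
have w0 : u - r *: v = 0.
  apply: g_nondeg => x; have [s [t ->]] := span' x.
  by rewrite gC gD !gZ ww0 vw0 !mulr0 addr0.
by move/eqP : w0; rewrite subr_eq0 (negPf (nuv r)).
Qed.

Let rV2E (x : T) : x = x 0 0 *: delta_mx 0 0 + x 0 1 *: delta_mx 0 1.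
Proof. by rewrite {1}[x]row_sum_delta sum2E. Qed.

(** By polarisation one of [e0], [e1], [e0 + e1] is not isotropic; completing it by a basis
    vector and projecting gives the second vector. *)
Lemma orthogonal_basis2 : exists v w, [/\ g v w = 0, g v v != 0, g w w != 0 &
  forall x, exists s t : R, x = s *: v + t *: w].
Proof.
pose e0 : T := delta_mx 0 0; pose e1 : T := delta_mx 0 1.
suff [v [u [gv nuv span]]] : exists v u, [/\ g v v != 0, (forall t : R, u != t *: v) &
    forall x, exists s t : R, x = s *: v + t *: u].
  by have [w [vw ww sp]] := complete gv nuv span; exists v, w.
have [g00|g00] := eqVneq (g e0 e0) 0; last first.
  exists e0, e1; split=> // [t|x]; last by exists (x 0 0), (x 0 1); exact: rV2E.
  by apply/eqP => /rowP /(_ 1) /eqP; rewrite !mxE /= mulr0 oner_eq0.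
have [g11|g11] := eqVneq (g e1 e1) 0; last first.
  exists e1, e0; split=> // [t|x]; last first.
    by exists (x 0 1), (x 0 0); rewrite addrC; exact: rV2E.
  by apply/eqP => /rowP /(_ 0) /eqP; rewrite !mxE /= mulr0 oner_eq0.
exists (e0 + e1), e1; split=> [|t|x].
- have gDr u v w : g w (u + v) = g w u + g w v by rewrite gC gD !(gC w).
  rewrite gD !gDr g00 g11 add0r addr0 (gC e1) -mulr2n mulrn_eq0 /=.
  apply/eqP => g01; have e00 : e0 = 0.
    apply: g_nondeg => w; rewrite gC.
    have -> : g w e0 = w 0 0 * g e0 e0 + w 0 1 * g e1 e0 by rewrite {1}(rV2E w) gD !gZ.
    by rewrite g00 [g e1 e0]gC g01 !mulr0 addr0.
  by move/rowP : e00 => /(_ 0) /eqP; rewrite !mxE oner_eq0.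
- apply/eqP => /rowP H; have := (H 0, H 1); rewrite !mxE /= addr0 add0r !mulr1 => -[<-] /eqP.
  by rewrite oner_eq0.
- exists (x 0 0), (x 0 1 - x 0 0); rewrite scalerDr scalerBl -addrA.
  by rewrite [x 0 0 *: e1 + _]addrCA subrr addr0; exact: rV2E.
Qed.

End OrthogonalBasis.

Section Signs.
Context {R : realType}.
Implicit Types (eta d : 'I_4 -> R).

(** The signs of the standard form of signature [(p, 4 - p)]. *)
Definition signs (p : nat) (i : 'I_4) : R := if (i < p)%N then 1 else -1.

Lemma signs2 p i : signs p i * signs p i = 1.
Proof. by rewrite /signs; case: ifP => _; rewrite ?mulr1 ?mulrNN ?mulr1. Qed.

Lemma signsN2 p i : - signs p i * - signs p i = 1.
Proof. by rewrite mulrNN signs2. Qed.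

Definition orthogonal_system eta d (Y : 'I_4 -> 'rV[R]_4) :=
  forall i j, eform eta (Y i) (Y j) = d i *+ (i == j).

Lemma prod4E (F : 'I_4 -> R) : \prod_i F i = F 0 * F 1 * F 2%:R * F 3%:R.
Proof.
rewrite !big_ord_recl big_ord0 mulr1 !mulrA.
by congr (F _ * F _ * F _ * F _); apply: val_inj.
Qed.

Section System.
Variables (eta d : 'I_4 -> R) (Y : 'I_4 -> 'rV[R]_4).
Hypotheses (d0 : forall i, d i != 0) (YE : orthogonal_system eta d Y).

Let Ym : 'M[R]_4 := \matrix_(i, j) Y i 0 j.

Let YmE : Ym *m diag_mx (\row_i eta i) *m Ym^T = diag_mx (\row_i d i).
Proof.
apply/matrixP => i j; rewrite [RHS]mxE [X in _ = X *+ _]mxE -YE [LHS]mxE.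
apply: eq_bigr => k _; rewrite mul_mx_diag !mxE; ring.
Qed.

(** Compare determinants in [Ym * diag eta * Ym^T = diag d]: the parity of the number of
    negative squares is an invariant. *)
Lemma orthogonal_system_sign : 0 < (\prod_i d i) * \prod_i eta i.
Proof.
have := congr1 determinant YmE; rewrite !det_mulmx det_tr !det_diag.
rewrite (eq_bigr eta) => [|i _]; last by rewrite mxE.
rewrite [RHS](eq_bigr d) => [E|i _]; last by rewrite mxE.
have : \prod_i d i != 0 by apply/prodf_neq0 => i _; exact: d0.
move: E; move: (\det Ym) (\prod_i eta i) (\prod_i d i) => D e f <- E0.
have -> : D * e * D * e = (D * e) ^+ 2 by rewrite expr2; ring.
by rewrite exprn_even_gt0 //=; apply: contraNneq E0 => ->; rewrite mul0r.
Qed.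

Lemma orthogonal_system_span z : (forall i, eform eta z (Y i) = 0) ->
  (forall i, eta i != 0) -> z = 0.
Proof.
move=> Hz e0.
have uD : Ym *m diag_mx (\row_i eta i) *m Ym^T \in unitmx.
  rewrite YmE unitmxE det_diag unitfE; apply/prodf_neq0 => i _; rewrite mxE; exact: d0.
have uY : Ym^T \in unitmx by move: uD; rewrite unitmx_mul => /andP[].
have uE : diag_mx (\row_i eta i) \in unitmx.
  by rewrite unitmxE det_diag unitfE; apply/prodf_neq0 => i _; rewrite mxE; exact: e0.
apply: (can_inj (mulmxK uE)); apply: (can_inj (mulmxK uY)).
rewrite !mul0mx; apply/rowP => i; rewrite [RHS]mxE -(Hz i) [LHS]mxE.
by apply: eq_bigr => k _; rewrite mul_mx_diag !mxE; ring.
Qed.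

(** Parseval's identity: [eform eta z z] is the sum of the [(eform eta z (Y i))^2 / d i]. *)
Lemma orthogonal_system_negative z : (forall i, eta i != 0) -> (forall i, d i < 0) ->
  eform eta z z <= 0.
Proof.
move=> e0 dn; pose a i := eform eta z (Y i) / d i.
have aY j : eform eta (\sum_i a i *: Y i) (Y j) = a j * d j.
  have -> : eform eta (\sum_i a i *: Y i) (Y j) = \sum_i a i * eform eta (Y i) (Y j).
    rewrite [in LHS]sum4E !eformDl !eformZl sum4E //.
  rewrite (bigD1 j) //= big1 => [|i ij]; last by rewrite YE (negPf ij) mulr0.
  by rewrite YE eqxx addr0.
have zE : z = \sum_i a i *: Y i.
  apply/subr0_eq/orthogonal_system_span => // i.
  by rewrite -scaleN1r eformDl eformZl aY /a divfK // mulN1r subrr.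
rewrite {1}zE.
have -> : eform eta (\sum_i a i *: Y i) z = \sum_i a i * eform eta z (Y i).
  by rewrite [in LHS]sum4E !eformDl !eformZl sum4E ![eform eta (Y _) z]eformC.
apply: sumr_le0 => i _; rewrite /a mulrAC -expr2.
by rewrite mulr_ge0_le0 ?sqr_ge0 // invr_le0 ltW.
Qed.

End System.

Lemma eform4E eta x y : eform eta x y = eta 0 * (x 0 0 * y 0 0) + eta 1 * (x 0 1 * y 0 1)
  + eta 2%:R * (x 0 2%:R * y 0 2%:R) + eta 3%:R * (x 0 3%:R * y 0 3%:R).
Proof. by rewrite /eform sum4E. Qed.

Lemma eformN eta x y : eform (fun i => - eta i) x y = - eform eta x y.
Proof. by rewrite /eform -sumrN; apply: eq_bigr => i _; rewrite mulNr. Qed.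

(** By the Cauchy-Schwarz inequality, the product of the space components is smaller in
    absolute value than that of the time components. *)
Lemma minkowski_timelike y z : eform (signs 3) y y < 0 -> eform (signs 3) z z < 0 ->
  eform (signs 3) y z <> 0.
Proof.
rewrite !eform4E /signs /=.
move: (y 0 0) (y 0 1) (y 0 2%:R) (y 0 3%:R) => y0 y1 y2 y3.
move: (z 0 0) (z 0 1) (z 0 2%:R) (z 0 3%:R) => z0 z1 z2 z3.
rewrite !mul1r !mulN1r !subr_lt0 => hy hz /subr0_eq yz.
pose A := y0 * y0 + y1 * y1 + y2 * y2; pose B := z0 * z0 + z1 * z1 + z2 * z2.
have sq (t : R) : 0 <= t * t by rewrite -expr2 sqr_ge0.
have A0 : 0 <= A by rewrite !addr_ge0.
have B0 : 0 <= B by rewrite !addr_ge0.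
have CS : (y3 * z3) * (y3 * z3) <= A * B.
  rewrite -yz -subr_ge0.
  have -> : A * B - (y0 * z0 + y1 * z1 + y2 * z2) * (y0 * z0 + y1 * z1 + y2 * z2) =
    (y0 * z1 - y1 * z0) * (y0 * z1 - y1 * z0) + (y0 * z2 - y2 * z0) * (y0 * z2 - y2 * z0)
    + (y1 * z2 - y2 * z1) * (y1 * z2 - y2 * z1) by rewrite /A /B; ring.
  by rewrite !addr_ge0.
have : A * B < (y3 * z3) * (y3 * z3).
  by rewrite [ltRHS](_ : _ = (y3 * y3) * (z3 * z3)); [exact: ltr_pM | ring].
by rewrite ltNge CS.
Qed.

Section Cases.
Variables (a c k : R) (Y : 'I_4 -> 'rV[R]_4).
Hypotheses (a0 : a != 0) (c0 : c != 0) (k1 : k = 1 \/ k = -1).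
Let d : 'I_4 -> R := fun i => nth 0 [:: -1; a; c; k] i.

Let d0 i : d i != 0.
Proof.
move: i; apply: ord4_ind; rewrite /d //= ?oppr_eq0 ?oner_eq0 //.
by case: k1 => ->; rewrite ?oppr_eq0 oner_eq0.
Qed.

Let sgn eta : orthogonal_system eta d Y ->
  0 < - (a * c * k) * (eta 0 * eta 1 * eta 2%:R * eta 3%:R).
Proof.
move=> YE; have := orthogonal_system_sign d0 YE.
by rewrite !prod4E /d /= !mulN1r !mulNr.
Qed.

Let prod_pos (x y : R) : x != 0 -> y != 0 -> 0 < x * y -> (0 < x /\ 0 < y) \/ (x < 0 /\ y < 0).
Proof.
move=> x0 y0; case: (ltgtP 0 x) x0 => // hx _; first by rewrite pmulr_rgt0 //; left.
by rewrite nmulr_rgt0 //; right.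
Qed.

(** A second negative square besides that of [sigma] would give two orthogonal timelike
    vectors. *)
Lemma hyperbolic_signs : orthogonal_system (signs 3) d Y -> [/\ k = 1, 0 < a & 0 < c].
Proof.
move=> YE; have two i j : i != j -> d i < 0 -> d j < 0 -> False.
  move=> ij di dj; apply: (@minkowski_timelike (Y i) (Y j)); rewrite YE ?eqxx //.
  by rewrite (negPf ij).
have neg0 : d 0 < 0 by rewrite /d /= oppr_lt0 ltr01.
case: k1 => k1'; last first.
  by case: (two 0 3%:R) => //; rewrite /d /= k1' oppr_lt0 ltr01.
split=> //.
  rewrite lt_neqAle eq_sym a0 leNgt; apply/negP => an.
  exact: (two 0 1).
rewrite lt_neqAle eq_sym c0 leNgt; apply/negP => cn.
exact: (two 0 2%:R).
Qed.

(** For [k = -1] the sign of the determinant leaves two cases, and four negative squares are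
    excluded because the form takes positive values. *)
Lemma antidesitter_signs : orthogonal_system (signs 2) d Y ->
  (k = 1 /\ a * c < 0) \/ [/\ k = -1, 0 < a & 0 < c].
Proof.
move=> YE; have := sgn YE; rewrite /signs /= !mul1r mulrNN !mulr1.
case: k1 => k1'; rewrite k1' ?mulr1 ?mulrN1 ?opprK ?oppr_gt0; first by left.
move=> ac; right; case: (prod_pos a0 c0 ac) => -[ha hc]; first by [].
have dn i : d i < 0.
  by move: i; apply: ord4_ind; rewrite /d //= ?k1' oppr_lt0 ltr01.
have e0 i : signs 2 i != 0 by rewrite /signs; case: ifP; rewrite ?oppr_eq0 oner_eq0.
have := orthogonal_system_negative d0 YE (delta_mx 0 0) e0 dn.
by rewrite eform4E !mxE /signs /= !(mulr0, addr0, mulr1) ler10.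
Qed.

(** After changing the sign of the form, two positive squares would be two orthogonal
    timelike vectors of Minkowski space. *)
Lemma desitter_signs : orthogonal_system (fun i => - signs 3 i) d Y ->
  [/\ k = 1, a < 0 & c < 0] \/ (k = -1 /\ a * c < 0).
Proof.
move=> YE; have := sgn YE; rewrite /signs /= !(mulN1r, mulrN1, mulrNN, mulr1, mul1r, opprK) => ack.
have two i j : i != j -> 0 < d i -> 0 < d j -> False.
  move=> ij di dj; apply: (@minkowski_timelike (Y i) (Y j));
    rewrite -[eform _ _ _]opprK -eformN YE ?eqxx ?oppr_lt0 //.
  by rewrite (negPf ij) oppr0.
case: k1 => k1'; rewrite k1' in ack *; last by right; move: ack; rewrite mulrN1 oppr_gt0.
left; have d3 : 0 < d 3%:R by rewrite /d /= k1' ltr01.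
split=> //; rewrite lt_neqAle ?a0 ?c0 leNgt; apply/negP => hp.
  exact: (two 1 3%:R).
exact: (two 2%:R 3%:R).
Qed.

Lemma spherical_signs : orthogonal_system (fun i => - signs 4 i) d Y ->
  [/\ k = -1, a < 0 & c < 0].
Proof.
move=> YE.
have dn i : d i < 0.
  rewrite lt_neqAle d0 /=; have := YE i i; rewrite eqxx mulr1n => <-.
  rewrite eformN oppr_le0; apply: sumr_ge0 => j _.
  by rewrite /signs ltn_ord mul1r -expr2 sqr_ge0.
split; [|exact: (dn 1)|exact: (dn 2%:R)].
by case: k1 => // k1'; have := dn 3%:R; rewrite /d /= k1' ltr10.
Qed.

End Cases.
End Signs.

(** * Surfaces in a real form: the signature *)

Section Metric.
Context {R : realType} {S : surface R}.
Variable sigma : S -> 'M[R[i]]_2.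
Hypothesis sigma_adm : admissible sigma.
Implicit Types (p q : S).
Local Notation T := 'rV[R]_2.
Local Notation d p v := (tdiff sigma p v).

Lemma conjc_realP (z : R[i]) : reflect (conjc z = z) (z \is Num.real).
Proof. by rewrite CrealE; exact: eqP. Qed.

Lemma real_metricP : real_metric sigma <->
  forall p (v w : T), conjc (mform (d p v) (d p w)) = mform (d p v) (d p w).
Proof.
split=> H p v w; first by have := H p v w; rewrite pullback_cvec // => /conjc_realP.
by rewrite pullback_cvec //; apply/conjc_realP.
Qed.

Lemma conjc_realE (z : R[i]) : conjc z = z -> z = (complex.Re z)%:C.
Proof.
case: z => x y /= [/eqP].
by rewrite -subr_eq0 -opprD oppr_eq0 -mulr2n mulrn_eq0 /= => /eqP ->.
Qed.

Lemma tdiff_lin p (a : R) (v w : T) : d p (a *: v + w) = a%:C *: d p v + d p w.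
Proof. exact: (tdiff_linear a v w openT (I : setT p) (sigma_smooth sigma_adm)). Qed.

(** An admissible immersion with real metric has a non-degenerate real metric, since a real
    vector in the kernel is in the kernel over the complex numbers. *)
Lemma metric_basis p :
  (forall v w : T, conjc (mform (d p v) (d p w)) = mform (d p v) (d p w)) ->
  exists v w (a c : R), [/\ mform (d p v) (d p w) = 0,
    mform (d p v) (d p v) = a%:C /\ mform (d p w) (d p w) = c%:C, a != 0, c != 0 &
    forall u : T, exists s t : R, u = s *: v + t *: w].
Proof.
move=> rg; pose g (v w : T) := complex.Re (mform (d p v) (d p w)).
have gE v w : mform (d p v) (d p w) = (g v w)%:C by exact/conjc_realE/rg.
have gC v w : g v w = g w v by rewrite /g mformC.
have gl (a : R) u v w : g (a *: u + v) w = a * g u w + g v w.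
  by apply: complexI; rewrite -gE tdiff_lin mformDl mformZl !gE rmorphD rmorphM.
have gn v : (forall w, g v w = 0) -> v = 0.
  move=> gv; have H : map_mx (real_complex R) v = 0.
    apply: (sigma_adm.2 p) => Y; rewrite pullbackE.
    rewrite (ctdiff_cvec v openT (I : setT p) (sigma_smooth sigma_adm)).
    rewrite (ctdiffE Y openT (I : setT p) (sigma_smooth sigma_adm)) mform_sumr big1 // => a _.
    by rewrite mformZr gE gv mulr0.
  apply/rowP => a; move/rowP : H => /(_ a); rewrite [LHS]mxE [in RHS]mxE => H.
  by rewrite mxE; apply: complexI.
have [v [w [vw vv ww span]]] := orthogonal_basis2 gC gl gn.
exists v, w, (g v v), (g w w); split=> //; first by rewrite gE vw.
Qed.

Lemma metric_span p (v w : T) (a c s t : R) : mform (d p v) (d p w) = 0 ->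
  mform (d p v) (d p v) = a%:C -> mform (d p w) (d p w) = c%:C ->
  mform (d p (s *: v + t *: w)) (d p (s *: v + t *: w)) = (s ^+ 2 * a + t ^+ 2 * c)%:C.
Proof.
move=> vw vv ww.
have d0 : d p 0 = 0 := tdiff0 openT (I : setT p) (sigma_smooth sigma_adm).
have dt : d p (t *: w) = t%:C *: d p w by rewrite -[t *: w]addr0 tdiff_lin d0 addr0.
rewrite tdiff_lin dt !(mformDl, mformDr, mformZl, mformZr) vv ww vw [mform (d p w) _]mformC vw.
by rewrite !mulr0 addr0 add0r !expr2 rmorphD !rmorphM !mulrA.
Qed.

Lemma sum_sqr_gt0 (s t a c : R) : 0 < a -> 0 < c -> (s != 0) || (t != 0) ->
  0 < s ^+ 2 * a + t ^+ 2 * c.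
Proof.
move=> a0 c0 /orP[s0|t0].
  by apply: ltr_pwDl; [rewrite mulr_gt0 // exprn_even_gt0|rewrite mulr_ge0 ?sqr_ge0 ?ltW].
by apply: ltr_wpDl; [rewrite mulr_ge0 ?sqr_ge0 ?ltW|rewrite mulr_gt0 // exprn_even_gt0].
Qed.

(** [P a c] is what is known about the squares [a], [c] of any orthogonal basis of a tangent
    plane; by [metric_basis] such bases exist, and these squares decide the signature. *)
Section Signature.
Hypothesis rg : real_metric sigma.
Variable P : R -> R -> Prop.
Hypothesis HP : forall p (v w : T) (a c : R), mform (d p v) (d p w) = 0 ->
  mform (d p v) (d p v) = a%:C -> mform (d p w) (d p w) = c%:C -> a != 0 -> c != 0 -> P a c.

Let st0 (u v w : T) (s t : R) : u = s *: v + t *: w -> u != 0 -> (s != 0) || (t != 0).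
Proof.
move=> ->; apply: contraNT; rewrite negb_or !negbK => /andP[/eqP -> /eqP ->].
by rewrite !scale0r addr0.
Qed.

Lemma riemannianI : (forall a c, P a c -> 0 < a /\ 0 < c) -> riemannian sigma.
Proof.
move=> Pp; split=> // p u u0; rewrite pullback_cvec //.
have [v [w [a [c [vw [vv ww] a0 c0 span]]]]] := metric_basis (real_metricP.1 rg p).
have [s [t uE]] := span u; have [ap cp] := Pp _ _ (HP vw vv ww a0 c0).
by rewrite uE (metric_span s t vw vv ww) ltcR; apply: sum_sqr_gt0 => //; exact: st0 uE u0.
Qed.

Lemma negative_definiteI : (forall a c, P a c -> a < 0 /\ c < 0) -> negative_definite sigma.
Proof.
move=> Pp; split=> // p u u0; rewrite pullback_cvec //.
have [v [w [a [c [vw [vv ww] a0 c0 span]]]]] := metric_basis (real_metricP.1 rg p).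
have [s [t uE]] := span u; have [ap cp] := Pp _ _ (HP vw vv ww a0 c0).
rewrite uE (metric_span s t vw vv ww) -[0]/(0%:C) ltcR -oppr_gt0 opprD -!mulrN.
by apply: sum_sqr_gt0; rewrite ?oppr_gt0 //; exact: st0 uE u0.
Qed.

Lemma signature11I : (forall a c, P a c -> a * c < 0) -> signature11 sigma.
Proof.
move=> Pp; split=> // p.
have [v [w [a [c [vw [vv ww] a0 c0 span]]]]] := metric_basis (real_metricP.1 rg p).
have := Pp _ _ (HP vw vv ww a0 c0).
have vw' : mform (d p w) (d p v) = 0 by rewrite mformC.
case: (ltgtP 0 a) a0 => // ha _.
  rewrite pmulr_rlt0 // => hc; exists v, w; rewrite !pullback_cvec // vv ww vw.
  by rewrite -[0]/(0%:C) !ltcR.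
rewrite nmulr_rlt0 // => hc; exists w, v; rewrite !pullback_cvec // vv ww vw'.
by rewrite -[0]/(0%:C) !ltcR.
Qed.

End Signature.

Lemma riemannian_basis p : riemannian sigma -> exists v w (a c : R),
  [/\ mform (d p v) (d p w) = 0, mform (d p v) (d p v) = a%:C,
      mform (d p w) (d p w) = c%:C, 0 < a & 0 < c].
Proof.
move=> [rg pos].
have [v [w [a [c [vw [vv ww] a0 c0 _]]]]] := metric_basis (real_metricP.1 rg p).
have nz (u : T) (x : R) : mform (d p u) (d p u) = x%:C -> x != 0 -> 0 < x.
  move=> uu x0; have u0 : u != 0.
    apply: contraNneq x0 => u0; apply/eqP/complexI.
    by rewrite -uu u0 (tdiff0 openT (I : setT p) (sigma_smooth sigma_adm)) mform0l.
  by have := pos p u u0; rewrite pullback_cvec // uu ltcR.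
by exists v, w, a, c; split=> //; [exact: nz vv a0 | exact: nz ww c0].
Qed.

Lemma negative_basis p : negative_definite sigma -> exists v w (a c : R),
  [/\ mform (d p v) (d p w) = 0, mform (d p v) (d p v) = a%:C,
      mform (d p w) (d p w) = c%:C, a < 0 & c < 0].
Proof.
move=> [rg neg].
have [v [w [a [c [vw [vv ww] a0 c0 _]]]]] := metric_basis (real_metricP.1 rg p).
have nz (u : T) (x : R) : mform (d p u) (d p u) = x%:C -> x != 0 -> x < 0.
  move=> uu x0; have u0 : u != 0.
    apply: contraNneq x0 => u0; apply/eqP/complexI.
    by rewrite -uu u0 (tdiff0 openT (I : setT p) (sigma_smooth sigma_adm)) mform0l.
  by have := neg p u u0; rewrite pullback_cvec // uu -[0]/(0%:C) ltcR.
by exists v, w, a, c; split=> //; [exact: nz vv a0 | exact: nz ww c0].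
Qed.

Lemma signature11_basis p : signature11 sigma -> exists v w (a c : R),
  [/\ mform (d p v) (d p w) = 0, mform (d p v) (d p v) = a%:C,
      mform (d p w) (d p w) = c%:C, 0 < a & c < 0].
Proof.
move=> [rg H]; have [v [w]] := H p; rewrite !pullback_cvec // => -[vv ww vw].
have vE := conjc_realE (real_metricP.1 rg p v v).
have wE := conjc_realE (real_metricP.1 rg p w w).
exists v, w, (complex.Re (mform (d p v) (d p v))), (complex.Re (mform (d p w) (d p w))).
split=> //; first by move: vv; rewrite {1}vE -[0]/(0%:C) ltcR.
by move: ww; rewrite {1}wE -[0]/(0%:C) ltcR.
Qed.

End Metric.

Section ImageClassification.
Context {R : realType} {S : surface R}.
Variables (sigma : S -> 'M[R[i]]_2) (Psi : S -> 'M[R[i]]_2).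
Hypotheses (sigma_adm : admissible sigma) (Psi_shape : shape_operator sigma Psi).
Variables (eta : 'I_4 -> R) (b : 'I_4 -> 'M[R[i]]_2).
Hypotheses (eta2 : forall i, eta i * eta i = 1) (ob : orthonormal eta b)
  (sigma_real : forall p, frame_conj b (sigma p) = sigma p).
Local Notation d p v := (tdiff sigma p v).

(** The frame adapted to the surface, with the normal multiplied by [1] or ['i] so as to
    become real, is an orthogonal basis of the real form. *)
Lemma image_signs (p0 : S) : real_metric sigma /\
  exists (k : R) (kappa : R[i]), [/\
    (k = 1 /\ kappa = 1) \/ (k = -1 /\ kappa = 'i),
    real_endo (fun p => kappa *: Psi p) &
    forall p (v w : 'rV[R]_2) (a c : R), mform (d p v) (d p w) = 0 ->
      mform (d p v) (d p v) = a%:C -> mform (d p w) (d p w) = c%:C -> a != 0 -> c != 0 ->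
      exists Y, orthogonal_system eta (fun i : 'I_4 => nth 0 [:: -1; a; c; k] i) Y].
Proof.
have ub := orthonormal_gram eta2 ob; have rb := orthonormal_real_gram ob.
have dr p v : frame_conj b (d p v) = d p v.
  exact: (tdiff_real sigma_adm eta2 ob sigma_real).
split.
  apply/real_metricP => // p v w.
  by rewrite -(mform_frame_conj _ _ ub rb) !dr.
have [s Cs] := conj_normal_sign sigma_adm Psi_shape eta2 ob sigma_real p0.
pose k : R := (-1) ^+ s; pose kappa : R[i] := if s then 'i else 1.
have kk : (k = 1 /\ kappa = 1) \/ (k = -1 /\ kappa = 'i).
  by rewrite /k /kappa; case: s {Cs k kappa}; [right|left]; rewrite ?expr0 ?expr1.
have kappa2 : kappa * kappa = k%:C.
  case: kk => -[-> ->]; first by rewrite mulr1.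
  by rewrite rmorphN1; simpc.
have kappa0 : kappa != 0.
  by case: kk => -[_ ->]; rewrite ?oner_neq0 // eq_complex /= oner_eq0 andbF.
have Ck p n : unit_normal sigma p n -> frame_conj b (kappa *: n) = kappa *: n.
  move=> un; rewrite (antilinearZ _ _ (frame_conj_antilinear b)) (Cs p n un) scalerA.
  congr (_ *: _); rewrite /kappa; case: s {Cs k kappa kk kappa2 kappa0} => /=.
    by rewrite expr1; simpc.
  by rewrite expr0; simpc.
exists k, kappa; split=> //.
  exact: (real_shape sigma_adm Psi_shape eta2 ob sigma_real kappa0 Ck).
move=> p v w a c vw vv ww a0 c0.
have [U [nu [oU Up _ unu _]]] := local_normal sigma_adm Psi_shape p.
have un := unu p Up; have [ns nn nd] := un.
pose F (i : 'I_4) : 'M[R[i]]_2 := nth 0 [:: sigma p; d p v; d p w; kappa *: nu p] i.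
have CF i : frame_conj b (F i) = F i.
  by move: i; apply: ord4_ind; rewrite /F /= ?dr ?sigma_real // (Ck p).
pose Y i : 'rV[R]_4 := sval (cid (frame_conj_spanP eta2 ob (CF i))).
have YE i : F i = span_map b (Y i) by rewrite /Y; case: (cid _).
exists Y => i j; apply: complexI; rewrite -(mform_span_map _ _ ob) -!YE.
have sd u : mform (sigma p) (d p u) = 0 by exact: mform_sigma_diff.
have ss := mform_sigma sigma_adm p.
move: i j; apply: ord4_ind; apply: ord4_ind; rewrite /F /= ?mulr1n ?mulr0n ?rmorph0 ?rmorphN1 //;
  by rewrite ?(mformZl, mformZr) ?(mformC (sigma p) (nu p)) ?(mformC (d p _) (sigma p))
    ?(mformC (d p _) (nu p)) ?(mformC (d p w) (d p v)) ?sd ?ns ?nd ?nn ?vw ?mulr0 ?mulr1 ?kappa2.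
Qed.

End ImageClassification.

(** * Constancy of the real form along a surface *)

Section Koszul.
Context {R : realType} {V : normedModType R}.
Variables (U : set V) (F : V -> 'M[R[i]]_2).
Implicit Types (x y v w z : V).
Hypotheses (oU : open U) (sF : smooth_mx_on U F)
  (rF : forall x v w, U x ->
    conjc (mform (mxD F x v) (mxD F x w)) = mform (mxD F x v) (mxD F x w)).

(** As in the Koszul formula: the imaginary part of [mform (D_z D_v F) (D_w F)] is
    symmetric in its first two arguments and antisymmetric in the last two. *)
Lemma real_christoffel x z v w : U x ->
  conjc (mform (mxD (fun y => mxD F y v) x z) (mxD F x w)) =
  mform (mxD (fun y => mxD F y v) x z) (mxD F x w).
Proof.
move=> Ux.
pose M z v w := mform (mxD (fun y => mxD F y v) x z) (mxD F x w).
pose T z v w := M z v w - conjc (M z v w).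
have Tsym z1 v1 w1 : T z1 v1 w1 = T v1 z1 w1.
  by rewrite /T /M (mxD_sym oU v1 z1 sF Ux).
have Tanti z1 v1 w1 : T z1 v1 w1 = - T z1 w1 v1.
  apply/eqP; rewrite -addr_eq0; apply/eqP; rewrite /T addrACA -opprD.
  have sv := smooth_mxD oU v1 sF; have sw := smooth_mxD oU w1 sF.
  have := cderive_mform oU z1 sv sw Ux.
  rewrite [X in _ + X]mformC -/(M z1 v1 w1) -/(M z1 w1 v1) => E.
  rewrite -rmorphD -E /= -(cderive_conj Ux z1 (csmooth_mform oU sv sw)).
  apply/eqP; rewrite subr_eq0; apply/eqP; apply: (eq_cderive z1 oU Ux) => y Uy.
  by rewrite rF.
have T0 : T z v w = 0.
  have E : T z v w = - T z v w.
    by rewrite {1}Tanti Tsym Tanti opprK Tsym Tanti Tsym.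
  have two : (2%:R : R[i]) != 0 by rewrite pnatr_eq0.
  by apply: (mulIf two); rewrite mul0r mulr_natr mulr2n {2}E subrr.
by apply/esym/eqP; rewrite -subr_eq0; apply/eqP.
Qed.

End Koszul.

Section ShapeToImage.
Context {R : realType} {S : surface R}.
Variables (sigma : S -> 'M[R[i]]_2) (Psi : S -> 'M[R[i]]_2).
Hypotheses (sigma_adm : admissible sigma) (Psi_shape : shape_operator sigma Psi).
Variables (k : R) (kappa : R[i]).
Hypotheses (kappa0 : kappa != 0) (kappa2 : kappa * kappa = k%:C)
  (rg : real_metric sigma) (re : real_endo (fun p => kappa *: Psi p)).
Implicit Types (p q : S) (c : chart R S).
Local Notation d p v := (tdiff sigma p v).
Local Notation T := 'rV[R]_2.
Local Notation sc c := (sigma \o chart_inv c).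

Let chart_real c q (v w : T) : atlas c -> chart_dom c q ->
  conjc (mform (mxD (sc c) (chart_map c q) v) (mxD (sc c) (chart_map c q) w)) =
  mform (mxD (sc c) (chart_map c q) v) (mxD (sc c) (chart_map c q) w).
Proof.
move=> ac cq.
have ch u := tdiff_chart u openT (I : setT q) (sigma_smooth sigma_adm) ac cq.
rewrite -!ch; exact: (real_metricP sigma_adm).1.
Qed.

Let smooth_sc c : atlas c -> smooth_mx_on (chart_map c @` (chart_dom c `&` setT)) (sc c).
Proof. by move=> ac; exact: (sigma_smooth sigma_adm ac). Qed.

Let normal_chart c q n v : atlas c -> chart_dom c q -> unit_normal sigma q n ->
  mform n (mxD (sc c) (chart_map c q) v) = 0.
Proof.
move=> ac cq [_ _ nd].
by rewrite -(tdiff_chart v openT (I : setT q) (sigma_smooth sigma_adm) ac cq).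
Qed.

(** Up to sign, [n] is the value of a normal field. Differentiating its zero products with
    [d sigma] turns the second fundamental form into a product of [d sigma] with
    [d sigma (kappa Psi v)], which is real. *)
Lemma real_second_form c q n (v w : T) : atlas c -> chart_dom c q -> unit_normal sigma q n ->
  conjc (kappa * mform n (mxD (fun y => mxD (sc c) y w) (chart_map c q) v)) =
  kappa * mform n (mxD (fun y => mxD (sc c) y w) (chart_map c q) v).
Proof.
move=> ac cq un.
have [U [nu [oU Uq snu unu shape]]] := local_normal sigma_adm Psi_shape q.
pose X := chart_map c @` (chart_dom c `&` U).
have oX : open X by exact: chart_image_open.
have Xq : X (chart_map c q) by exists q.
have sX : smooth_mx_on X (sc c).
  by apply: smooth_mxS (smooth_sc ac) => y [q' [cq' _] <-]; exists q'.
have snX : smooth_mx_on X (nu \o chart_inv c) := snu c ac.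
have II : mform (nu q) (mxD (fun y => mxD (sc c) y w) (chart_map c q) v) =
    - mform (mxD (nu \o chart_inv c) (chart_map c q) v) (mxD (sc c) (chart_map c q) w).
  have := cderive_mform oX v snX (smooth_mxD oX w sX) Xq.
  have -> : cderive (fun y => mform ((nu \o chart_inv c) y) (mxD (sc c) y w))
      (chart_map c q) v = 0.
    rewrite (eq_cderive (g := fun=> 0) v oX Xq) ?cderive_cst // => y [q' [cq' Uq'] <-].
    by rewrite /= chart_mapK // normal_chart //; exact: unu.
  rewrite /= chart_mapK // => /esym/eqP; rewrite addrC addr_eq0 => /eqP.
  by [].
have main : conjc (kappa * mform (nu q) (mxD (fun y => mxD (sc c) y w) (chart_map c q) v)) =
    kappa * mform (nu q) (mxD (fun y => mxD (sc c) y w) (chart_map c q) v).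
  rewrite II -(tdiff_chart v oU Uq snu ac cq).
  rewrite -(ctdiff_cvec _ oU Uq snu) shape mformNl opprK -mformZl.
  rewrite -(tdiff_chart w openT (I : setT q) (sigma_smooth sigma_adm) ac cq).
  set t := transition c (chart_at q) q v.
  have [u uE] := re (t : tangent q).
  have -> : kappa *: ctdiff sigma q (map_mx (real_complex R) t *m Psi q) = d q u.
    rewrite -(ctdiff_cvec u openT (I : setT q) (sigma_smooth sigma_adm)).
    move: uE; rewrite /cvec -scalemxAr => <-.
    rewrite !(ctdiffE _ openT (I : setT q) (sigma_smooth sigma_adm)) scaler_sumr.
    by apply: eq_bigr => a _; rewrite [in RHS]mxE scalerA.
  exact: (real_metricP sigma_adm).1.
case: (unit_normal_unique sigma_adm (unu q Uq) un) => ->; first exact: main.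
by rewrite mformNl mulrN rmorphN /= main.
Qed.

(** [C] is the conjugation of the real form that contains [sigma p], the real tangent
    vectors and [kappa] times the normals at [p]. *)
Definition adapted_conj p (C : 'M[R[i]]_2 -> 'M[R[i]]_2) :=
  [/\ antilinear C, C (sigma p) = sigma p, forall v : T, C (d p v) = d p v &
    forall n, unit_normal sigma p n -> C (kappa *: n) = kappa *: n].

Lemma adapted_conj_unique p C C' : adapted_conj p C -> adapted_conj p C' -> C = C'.
Proof.
move=> [aC Cs Cd Cn] [aC' Cs' Cd' Cn'].
have [U [nu [oU Up _ unu _]]] := local_normal sigma_adm Psi_shape p.
have un := unu p Up.
apply: (antilinear_eq (adapted_frame_unit sigma_adm kappa0 un) aC aC').
apply: ord4_ind; rewrite /adapted_frame /= ?Cs ?Cs' ?Cd ?Cd' //.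
by rewrite Cn // Cn'.
Qed.

(** In a chart, move the frame made of [sigma], its two partial derivatives and [kappa nu].
    Its derivatives have real products with the frame: those of the partial derivatives among
    themselves by [real_christoffel], those with the normal by [real_second_form], and the
    remaining ones by differentiating constant products. *)
Lemma adapted_conj_local p0 : exists C, \forall q \near p0, adapted_conj q C.
Proof.
have [U [nu [oU Up0 snu unu _]]] := local_normal sigma_adm Psi_shape p0.
pose c := chart_at p0.
have ac : atlas c by exact: chart_at_atlas.
have cp0 : chart_dom c p0 by exact: chart_at_dom.
pose X0 := chart_map c @` (chart_dom c `&` U).
have oX0 : open X0 by exact: chart_image_open.
have Xp0 : X0 (chart_map c p0) by exists p0.
have sX0 : smooth_mx_on X0 (sc c).
  by apply: smooth_mxS (smooth_sc ac) => y [q' [cq' _] <-]; exists q'.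
have sn0 : smooth_mx_on X0 (fun y => kappa *: (nu \o chart_inv c) y).
  exact: (smooth_map_scale kappa oU snu ac).
pose B (i : 'I_4) : 'rV[R]_2 -> 'M[R[i]]_2 := fun y =>
  nth 0 [:: sc c y; mxD (sc c) y (delta_mx 0 0); mxD (sc c) y (delta_mx 0 1);
    kappa *: (nu \o chart_inv c) y] i.
have sB0 i : smooth_mx_on X0 (B i).
  by move: i; apply: ord4_ind => //; exact: smooth_mxD.
have sg i j : csmooth_on X0 (fun y => gram (B^~ y) i j).
  by apply: csmooth_eq (csmooth_mform oX0 (sB0 i) (sB0 j)) => // y _; rewrite mxE.
have up0 : gram (B^~ (chart_map c p0)) \in unitmx.
  have <- : adapted_frame sigma p0 (kappa *: nu p0) = B^~ (chart_map c p0).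
    apply/funext; apply: ord4_ind; rewrite /adapted_frame /B /= ?tdiffE //.
      by rewrite chart_mapK.
    by rewrite chart_mapK.
  exact: (adapted_frame_unit sigma_adm kappa0 (unu p0 Up0)).
have near_unit : \forall y \near chart_map c p0, X0 y /\ gram (B^~ y) \in unitmx.
  have d0 : \det (gram (B^~ (chart_map c p0))) != 0 := etrans (esym (unitfE _)) up0.
  have nd := csmooth_near_neq0 (csmooth_det oX0 sg) Xp0 d0.
  apply: filterS (filterI (open_near oX0 Xp0) nd) => y [Xy dy].
  by split => //; exact: etrans (unitfE _) dy.
have /nbhs_ballP [e /= e0 Xe] := near_unit.
pose X := ball (chart_map c p0) e.
have oX : open X by exact: ball_open.
have XX0 y : X y -> X0 y by move=> /Xe[].
have Xpt y : X y -> exists q, [/\ chart_dom c q, U q & chart_map c q = y].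
  by move=> /XX0 [q [cq Uq] <-]; exists q.
have sB i : smooth_mx_on X (B i) by exact: smooth_mxS XX0 (sB0 i).
have sX : smooth_mx_on X (sc c) := smooth_mxS XX0 sX0.
have sn : smooth_mx_on X (fun y => kappa *: (nu \o chart_inv c) y) := smooth_mxS XX0 sn0.
have rF y v w : X y -> conjc (mform (mxD (sc c) y v) (mxD (sc c) y w)) =
    mform (mxD (sc c) y v) (mxD (sc c) y w).
  by move=> /Xpt [q [cq Uq <-]]; exact: chart_real.
have mss y : X y -> mform (sc c y) (sc c y) = -1 by move=> _; exact: mform_sigma.
have msd y v : X y -> mform (sc c y) (mxD (sc c) y v) = 0.
  by move=> /Xpt [q [cq Uq <-]]; rewrite /= chart_mapK //; exact: mform_sigma_chart.
have mns y : X y -> mform (kappa *: (nu \o chart_inv c) y) (sc c y) = 0.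
  move=> /Xpt [q [cq Uq <-]]; rewrite /= chart_mapK // mformZl.
  by have [-> _ _] := unu q Uq; rewrite mulr0.
have mnd y v : X y -> mform (kappa *: (nu \o chart_inv c) y) (mxD (sc c) y v) = 0.
  move=> /Xpt [q [cq Uq <-]]; rewrite /= chart_mapK // mformZl normal_chart ?mulr0 //.
  exact: unu.
have mnn y : X y -> mform (kappa *: (nu \o chart_inv c) y) (kappa *: (nu \o chart_inv c) y) = k%:C.
  move=> /Xpt [q [cq Uq <-]]; rewrite /= chart_mapK // mformZl mformZr.
  by have [_ -> _] := unu q Uq; rewrite mulr1.
have mnII y v w : X y -> conjc (mform (kappa *: (nu \o chart_inv c) y)
      (mxD (fun z => mxD (sc c) z w) y v)) =
    mform (kappa *: (nu \o chart_inv c) y) (mxD (fun z => mxD (sc c) z w) y v).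
  move=> /Xpt [q [cq Uq <-]]; rewrite /= chart_mapK // mformZl.
  by apply: real_second_form => //; exact: unu.
have leib (G H : 'rV[R]_2 -> 'M[R[i]]_2) (r : R[i]) y v : X y -> smooth_mx_on X G ->
    smooth_mx_on X H -> (forall z, X z -> mform (G z) (H z) = r) ->
    mform (mxD G y v) (H y) = - mform (G y) (mxD H y v).
  move=> Xy sG sH GH; apply/eqP; rewrite -addr_eq0 -(cderive_mform oX v sG sH Xy).
  by rewrite (eq_cderive v oX Xy GH) cderive_cst.
have self (G : 'rV[R]_2 -> 'M[R[i]]_2) (r : R[i]) y v : X y -> smooth_mx_on X G ->
    (forall z, X z -> mform (G z) (G z) = r) -> mform (mxD G y v) (G y) = 0.
  move=> Xy sG GG; have := leib G G r y v Xy sG sG GG; rewrite [in RHS]mformC => /eqP.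
  by rewrite -addr_eq0 -mulr2n -mulr_natr mulf_eq0 pnatr_eq0 orbF => /eqP.
have sd v : smooth_mx_on X (fun y => mxD (sc c) y v) by exact: smooth_mxD.
have dsr y v w : X y -> conjc (mform (mxD (fun z => mxD (sc c) z w) y v) (sc c y)) =
    mform (mxD (fun z => mxD (sc c) z w) y v) (sc c y).
  move=> Xy; rewrite (leib _ _ 0 y v Xy (sd w) sX); last by move=> z Xz; rewrite mformC msd.
  by rewrite rmorphN /= rF.
have dss y v : X y -> mform (mxD (sc c) y v) (sc c y) = 0 by move=> Xy; rewrite mformC msd.
have dsn y v : X y -> mform (mxD (sc c) y v) (kappa *: (nu \o chart_inv c) y) = 0.
  by move=> Xy; rewrite mformC mnd.
have dns y v : X y ->
    mform (mxD (fun z => kappa *: (nu \o chart_inv c) z) y v) (sc c y) = 0.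
  by move=> Xy; rewrite (leib _ _ 0 y v Xy sn sX mns) mnd // oppr0.
have dnd y v w : X y ->
    conjc (mform (mxD (fun z => kappa *: (nu \o chart_inv c) z) y v) (mxD (sc c) y w)) =
    mform (mxD (fun z => kappa *: (nu \o chart_inv c) z) y v) (mxD (sc c) y w).
  move=> Xy; rewrite (leib _ _ 0 y v Xy sn (sd w)); last by move=> z Xz; exact: mnd.
  by rewrite rmorphN /= mnII.
have dnn y v : X y -> mform (mxD (fun z => kappa *: (nu \o chart_inv c) z) y v)
    (kappa *: (nu \o chart_inv c) y) = 0.
  by move=> Xy; apply: (self _ k%:C y v Xy sn) => z Xz; exact: mnn.
have ddn y v w : X y -> conjc (mform (mxD (fun z => mxD (sc c) z w) y v)
      (kappa *: (nu \o chart_inv c) y)) =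
    mform (mxD (fun z => mxD (sc c) z w) y v) (kappa *: (nu \o chart_inv c) y).
  by move=> Xy; rewrite mformC mnII.
have ddd y v w u : X y -> conjc (mform (mxD (fun z => mxD (sc c) z w) y v) (mxD (sc c) y u)) =
    mform (mxD (fun z => mxD (sc c) z w) y v) (mxD (sc c) y u).
  by move=> Xy; exact: (real_christoffel oX sX rF).
have c0 : conjc (0 : R[i]) = 0 by rewrite rmorph0.
have cr (r : R) : conjc r%:C = r%:C by exact: conjc_real.
have ub y : X y -> gram (B^~ y) \in unitmx by move=> /Xe[].
have rb y : X y -> real_gram (B^~ y).
  move=> Xy i j; rewrite !mxE; move: i j; apply: ord4_ind; apply: ord4_ind; rewrite /B /=;
    by rewrite ?mss ?msd ?dss ?dsn ?mns ?mnd ?mnn ?rF ?cr ?rmorphN1 ?c0 // mformC ?mns ?c0.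
have rdb y v i j : X y ->
    conjc (mform (mxD (B i) y v) (B j y)) = mform (mxD (B i) y v) (B j y).
  move=> Xy; move: i j; apply: ord4_ind; apply: ord4_ind; rewrite /B /=;
    by rewrite ?dss ?dsn ?rF ?dsr ?ddd ?ddn ?dns ?dnd ?dnn ?c0.
have Ccst := frame_conj_cst oX sB ub rb rdb (e := e) (x := chart_map c p0) (fun y h => h).
exists (frame_conj (B^~ (chart_map c p0))).
have cm : {for p0, continuous (chart_map c)} := chart_map_continuous cp0.
have nX : \forall q \near p0, X (chart_map c q).
  by apply: cm; apply: nbhsx_ballx.
apply: filterS (filterI nX (filterI (open_near (chart_dom_open c) cp0) (open_near oU Up0))).
move=> q [Xq [cq Uq]].
have fix_B i : frame_conj (B^~ (chart_map c p0)) (B i (chart_map c q)) = B i (chart_map c q).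
  by rewrite -(Ccst _ Xq); apply: (frame_conj_fix i (ub _ Xq) (rb _ Xq)).
have aC := frame_conj_antilinear (B^~ (chart_map c p0)).
move: (frame_conj (B^~ (chart_map c p0))) fix_B aC => C fix_B aC.
split=> //.
- by have := fix_B 0; rewrite /B /= chart_mapK.
- move=> v; rewrite (chart_tdiff v openT (I : setT q) (sigma_smooth sigma_adm) ac cq).
  set t := transition _ _ _ _.
  have -> : t = t 0 0 *: delta_mx 0 0 + t 0 1 *: delta_mx 0 1.
    by rewrite {1}[t]row_sum_delta sum2E.
  have lin a (u w : T) := mxD_linear oX a u w sX Xq.
  have l0 : mxD (sc c) (chart_map c q) 0 = 0.
    have := lin (-1) 0 0; by rewrite scaler0 addr0 rmorphN1 scaleN1r addNr.
  have lZ a (u : T) : mxD (sc c) (chart_map c q) (a *: u) = a%:C *: mxD (sc c) (chart_map c q) u.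
    by have := lin a u 0; rewrite l0 !addr0.
  rewrite lin lZ aC (antilinearZ _ _ aC) !cr.
  by have := (fix_B 1, fix_B 2%:R); rewrite /B /= => -[-> ->].
- move=> n un; have := fix_B 3%:R; rewrite /B /= chart_mapK // => Cn.
  case: (unit_normal_unique sigma_adm (unu q Uq) un) => -> //.
  by rewrite scalerN -scaleN1r (antilinearZ _ _ aC) rmorphN1 Cn.
Qed.

Lemma adapted_conj_global p0 : exists C, forall p, adapted_conj p C.
Proof.
apply: (@surface_uniform _ _ _ adapted_conj p0); first exact: adapted_conj_local.
by move=> p C C'; exact: adapted_conj_unique.
Qed.

End ShapeToImage.

(** * The four model spaces *)

Section Models.
Context {R : realType}.

Lemma pqform31E : @pqform R 3 1 = eform (signs 3) :> ('rV[R]_4 -> 'rV[R]_4 -> R).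
Proof.
apply/funext => x; apply/funext => y; rewrite eform4E /signs /= /pqform.
rewrite !big_ord_recl !big_ord0 !addr0 !mul1r !mulN1r !addrA.
by congr (x 0 _ * y 0 _ + x 0 _ * y 0 _ + x 0 _ * y 0 _ - x 0 _ * y 0 _); apply: val_inj.
Qed.

Lemma pqform22E : @pqform R 2 2 = eform (signs 2) :> ('rV[R]_4 -> 'rV[R]_4 -> R).
Proof.
apply/funext => x; apply/funext => y; rewrite eform4E /signs /= /pqform.
rewrite !big_ord_recl !big_ord0 !addr0 !mul1r !mulN1r opprD !addrA.
by congr (x 0 _ * y 0 _ + x 0 _ * y 0 _ - x 0 _ * y 0 _ - x 0 _ * y 0 _); apply: val_inj.
Qed.

Lemma pqform40E : @pqform R 4 0 = eform (signs 4) :> ('rV[R]_4 -> 'rV[R]_4 -> R).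
Proof.
apply/funext => x; apply/funext => y; rewrite eform4E /signs /= /pqform.
rewrite !big_ord_recl !big_ord0 subr0 !addr0 !mul1r !addrA.
by congr (x 0 _ * y 0 _ + x 0 _ * y 0 _ + x 0 _ * y 0 _ + x 0 _ * y 0 _); apply: val_inj.
Qed.

Definition quadric (eta : 'I_4 -> R) (W : set 'rV[R]_4) : set 'rV[R]_4 :=
  [set x | eform eta x x = -1 /\ W x].

Definition upper : set 'rV[R]_4 := [set x | 0 < x 0 3%:R].

Lemma open_upper : open upper.
Proof.
have cx : continuous (fun x : 'rV[R]_4 => x 0 3%:R) by exact: coord_continuous.
exact: (open_comp (fun x _ => cx x) (@open_gt R 0)).
Qed.

Section InImage.
Variables (T : Type) (sigma : T -> 'M[R[i]]_2).

Lemma in_H3E : in_isometric_image sigma H3 (@pqform R 3 1) =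
  in_isometric_image sigma (quadric (signs 3) upper) (eform (signs 3)).
Proof.
have -> : quadric (signs 3) upper = H3.
  rewrite /quadric /H3 -pqform31E; apply/funext => x; congr (_ /\ 0 < x 0 _).
  exact: val_inj.
by rewrite -pqform31E.
Qed.

Lemma in_AdS3E : in_isometric_image sigma AdS3 (@pqform R 2 2) =
  in_isometric_image sigma (quadric (signs 2) setT) (eform (signs 2)).
Proof.
have -> : quadric (signs 2) setT = AdS3; last by rewrite -pqform22E.
by rewrite /quadric /AdS3 -pqform22E; apply/funext => x; rewrite propeqE; split => [[]|].
Qed.

Lemma in_dS3E : in_isometric_image sigma dS3 (fun x y => - @pqform R 3 1 x y) =
  in_isometric_image sigma (quadric (fun i => - signs 3 i) setT) (eform (fun i => - signs 3 i)).
Proof.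
have E : eform (fun i => - signs 3 i) = (fun x y : 'rV[R]_4 => - @pqform R 3 1 x y).
  by apply/funext => x; apply/funext => y; rewrite eformN -pqform31E.
have -> : quadric (fun i => - signs 3 i) setT = dS3; last by rewrite E.
rewrite /quadric /dS3 E; apply/funext => x; rewrite propeqE.
by split => [[/oppr_inj]|/= ->].
Qed.

Lemma in_S3E : in_isometric_image sigma S3 (fun x y => - @pqform R 4 0 x y) =
  in_isometric_image sigma (quadric (fun i => - signs 4 i) setT) (eform (fun i => - signs 4 i)).
Proof.
have E : eform (fun i => - signs 4 i) = (fun x y : 'rV[R]_4 => - @pqform R 4 0 x y).
  by apply/funext => x; apply/funext => y; rewrite eformN -pqform40E.
have -> : quadric (fun i => - signs 4 i) setT = S3; last by rewrite E.
rewrite /quadric /S3 E; apply/funext => x; rewrite propeqE.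
by split => [[/oppr_inj]|/= ->].
Qed.

End InImage.

Lemma orthonormalize (eta D : 'I_4 -> R) (f : 'I_4 -> 'M[R[i]]_2) :
  (forall i, eta i = 1 \/ eta i = -1) ->
  (forall i, 0 < D i * eta i) -> (forall i j, mform (f i) (f j) = (D i *+ (i == j))%:C) ->
  orthonormal eta (fun i => ((Num.sqrt (D i * eta i))^-1)%:C *: f i).
Proof.
move=> e1 De fE i j; rewrite mformZl mformZr fE; have [<-|_] := eqVneq i j; last first.
  by rewrite !mulr0n rmorph0 !mulr0.
rewrite !mulr1n -!rmorphM mulrA -invfM -expr2 sqr_sqrtr ?ltW //; congr (_%:C).
have De0 := De i; have D0 : D i != 0 by apply: contraTneq De0 => ->; rewrite mul0r ltxx.
by case: (e1 i) => -> ; rewrite ?mulr1 ?mulrN1 ?invrN ?mulNr mulVf.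
Qed.

(** Orthogonal for [mform], with squares [standard_sign]. *)
Definition standard_frame (i : 'I_4) : 'M[R[i]]_2 :=
  nth 0 [:: 1%:M;
    \matrix_(k, l) (if k == l then if k == 0 then 1 else -1 else 0);
    \matrix_(k, l) (if k == l then 0 else 1);
    \matrix_(k, l) (if k == l then 0 else if k == 0 then 1 else -1)] i.

Definition standard_sign (i : 'I_4) : R := nth 0 [:: -1; 1; 1; -1] i.

Lemma standard_frame_gram i j :
  mform (standard_frame i) (standard_frame j) = (standard_sign i *+ (i == j))%:C.
Proof.
have two : (2%:R : R[i]) != 0 by rewrite pnatr_eq0.
apply: (mulIf two); rewrite mformE divfK //.
move: i j; apply: ord4_ind; apply: ord4_ind;
  rewrite /standard_frame /standard_sign !mxE /= ?mulr1n ?mulr0n ?rmorphN1 ?rmorph1 ?rmorph0;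
  ring.
Qed.

(** Multiplying a vector by ['i] changes the sign of its square, so every signature occurs
    in [Mat(2, C)]. *)
Lemma exists_orthonormal (eta : 'I_4 -> R) :
  (forall i, eta i = 1 \/ eta i = -1) -> exists b, orthonormal eta b.
Proof.
move=> e1.
exists (fun i => (if eta i == standard_sign i then 1 else 'i) *: standard_frame i) => i j.
rewrite mformZl mformZr standard_frame_gram; have [<-|_] := eqVneq i j; last first.
  by rewrite !mulr0n rmorph0 !mulr0.
have s1 : standard_sign i = 1 \/ standard_sign i = -1.
  by move: i {j}; apply: ord4_ind; [right|left|left|right].
have N11 : ((1 : R) == -1) = false.
  by apply/negbTE; rewrite -subr_eq0 opprK -[1 + 1]/(2%:R) pnatr_eq0.
rewrite !mulr1n; case: (e1 i) => ->; case: s1 => ->;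
  by rewrite ?eqxx ?N11 1?eq_sym ?N11 ?mul1r // ?rmorphN1 ?rmorph1; simpc.
Qed.

End Models.

Section Final.
Context {R : realType} {S : surface R}.
Variables (sigma : S -> 'M[R[i]]_2) (Psi : S -> 'M[R[i]]_2).
Hypotheses (sigma_adm : admissible sigma) (Psi_shape : shape_operator sigma Psi).
Local Notation d p v := (tdiff sigma p v).

Section FromImage.
Variables (eta : 'I_4 -> R) (W : set 'rV[R]_4).
Hypotheses (eta2 : forall i, eta i * eta i = 1) (oW : open W)
  (im : in_isometric_image sigma (quadric eta W) (eform eta)).

Lemma image_signature (p0 : S) : real_metric sigma /\
  exists (k : R) (kappa : R[i]), [/\
    (k = 1 /\ kappa = 1) \/ (k = -1 /\ kappa = 'i),
    real_endo (fun p => kappa *: Psi p) &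
    forall p (v w : 'rV[R]_2) (a c : R), mform (d p v) (d p w) = 0 ->
      mform (d p v) (d p v) = a%:C -> mform (d p w) (d p w) = c%:C -> a != 0 -> c != 0 ->
      exists Y, orthogonal_system eta (fun i : 'I_4 => nth 0 [:: -1; a; c; k] i) Y].
Proof.
have [b [ob sp]] := in_linear_image eta2 oW (sigma_smooth sigma_adm) p0 im.
apply: (image_signs sigma_adm Psi_shape eta2 ob) => // p.
by have [x _ ->] := sp p; exact: (frame_conj_span eta2 ob).
Qed.

End FromImage.

Lemma continuous_mform_sigma (M : 'M[R[i]]_2) (p : S) :
  {for p, continuous (fun q => complex.Re (mform (sigma q) M))}.
Proof.
have cs := smooth_map_continuous openT (sigma_smooth sigma_adm) (I : setT p).
have sM : smooth_mx_on setT (fun _ : 'M[R]_2 * 'M[R]_2 => M).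
  by apply: csmooth_smooth_mx => [|k l]; [exact: openT|exact/csmooth_cst/openT].
have [sr _] := csmooth_mform openT (@smooth_mx_of_reim R) sM.
have cr := smooth_continuous sr (I : setT (mx_reim (sigma p))).
have := continuous_comp cs cr.
rewrite (_ : _ \o _ = (fun q => complex.Re (mform (sigma q) M))) //.
by apply/funext => q /=; rewrite mx_reimK.
Qed.

Section FromShape.
Variables (eta : 'I_4 -> R).
Hypotheses (e1 : forall i, eta i = 1 \/ eta i = -1).
Let eta2 i : eta i * eta i = 1.
Proof. by case: (e1 i) => ->; rewrite ?mulrNN mulr1. Qed.

Lemma empty_in_image (W : set 'rV[R]_4) : open W -> (S -> False) ->
  in_isometric_image sigma (quadric eta W) (eform eta).
Proof.
move=> oW noS; have [b ob] := exists_orthonormal e1.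
exists (span_map b); split; first exact: span_map_isometric_embedding.
by move=> M [p]; case: (noS p).
Qed.

Variables (k : R) (kappa : R[i]).
Hypotheses (kk : (k = 1 /\ kappa = 1) \/ (k = -1 /\ kappa = 'i))
  (rg : real_metric sigma) (re : real_endo (fun p => kappa *: Psi p)).

(** The conjugations attached to the points of the surface coincide, so the real form
    spanned by the adapted frame at [p0] contains every [sigma p]. The map [r] lists the
    vectors of that frame in the order in which [eta] lists the signs. *)
Lemma shape_linear_image p0 (v w : 'rV[R]_2) (a c : R) (r : 'I_4 -> 'I_4) :
  mform (d p0 v) (d p0 w) = 0 -> mform (d p0 v) (d p0 v) = a%:C ->
  mform (d p0 w) (d p0 w) = c%:C -> injective r ->
  (forall i, 0 < nth 0 [:: -1; a; c; k] (r i) * eta i) ->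
  exists b, [/\ orthonormal eta b,
    forall p, exists2 x, eform eta x x = -1 & sigma p = span_map b x &
    forall i, r i = 0 -> b i = sigma p0].
Proof.
move=> vw vv ww ir Dpos.
have kappa2 : kappa * kappa = k%:C.
  case: kk => -[-> ->]; first by rewrite mulr1.
  by rewrite rmorphN1; simpc.
have kappa0 : kappa != 0.
  by case: kk => -[_ ->]; rewrite ?oner_neq0 // eq_complex /= oner_eq0 andbF.
have [C HC] := adapted_conj_global sigma_adm Psi_shape kappa0 kappa2 rg re p0.
have [U [nu [oU Up _ unu _]]] := local_normal sigma_adm Psi_shape p0.
have un := unu p0 Up; have [ns nn nd] := un.
pose F (i : 'I_4) : 'M[R[i]]_2 := nth 0 [:: sigma p0; d p0 v; d p0 w; kappa *: nu p0] i.
pose D (i : 'I_4) : R := nth 0 [:: -1; a; c; k] i.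
have sd u : mform (sigma p0) (d p0 u) = 0 by exact: mform_sigma_diff.
have ss := mform_sigma sigma_adm p0.
have FE i j : mform (F i) (F j) = (D i *+ (i == j))%:C.
  move: i j; apply: ord4_ind; apply: ord4_ind;
    rewrite /F /D /= ?mulr1n ?mulr0n ?rmorph0 ?rmorphN1 //;
    by rewrite ?(mformZl, mformZr) ?(mformC (sigma p0) (nu p0)) ?(mformC (d p0 _) (sigma p0))
    ?(mformC (d p0 _) (nu p0)) ?(mformC (d p0 w) (d p0 v))
    ?sd ?ns ?nd ?nn ?vw ?mulr0 ?mulr1 ?kappa2.
have [aC Cs Cd Cn] := HC p0.
have CF i : C (F i) = F i by move: i; apply: ord4_ind; rewrite /F /= ?Cs ?Cd // Cn.
have fE i j : mform (F (r i)) (F (r j)) = (D (r i) *+ (i == j))%:C.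
  by rewrite FE (inj_eq ir).
have ob := orthonormalize e1 Dpos fE.
set b := (fun i => _) in ob.
have Cb i : C (b i) = b i by rewrite (antilinearZ _ _ aC) CF conjc_real.
have CE : C = frame_conj b.
  apply: (antilinear_eq (orthonormal_gram eta2 ob) aC (frame_conj_antilinear b)) => i.
  rewrite Cb frame_conj_fix //; first exact: orthonormal_gram.
  exact: orthonormal_real_gram ob.
exists b; split=> // [p|i r0].
  have [_ Csp _ _] := HC p; rewrite CE in Csp.
  have [x xE] := frame_conj_spanP eta2 ob Csp; exists x => //.
  by apply: complexI; rewrite -(mform_span_map _ _ ob) -xE rmorphN1 mform_sigma.
rewrite /b; have := e1 i; have := Dpos i; rewrite r0 /F /= => He [] e1i; move: He; rewrite e1i.
  by rewrite mulr1 oppr_gt0 ltr10.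
by rewrite mulrNN mulr1 sqrtr1 invr1 rmorph1 scale1r.
Qed.

Lemma shape_in_image p0 (v w : 'rV[R]_2) (a c : R) (r : 'I_4 -> 'I_4) :
  mform (d p0 v) (d p0 w) = 0 -> mform (d p0 v) (d p0 v) = a%:C ->
  mform (d p0 w) (d p0 w) = c%:C -> injective r ->
  (forall i, 0 < nth 0 [:: -1; a; c; k] (r i) * eta i) ->
  in_isometric_image sigma (quadric eta setT) (eform eta).
Proof.
move=> vw vv ww ir Dpos.
have [b [ob sp _]] := shape_linear_image vw vv ww ir Dpos.
exists (span_map b); split; first by apply: span_map_isometric_embedding => //; exact: openT.
by move=> M [p _ <-]; have [x hx ->] := sp p; exists x.
Qed.

End FromShape.

(** On the hyperboloid the last coordinate has absolute value at least [1], so it has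
    constant sign along the connected surface, and it is [1] at [p0]. *)
Lemma one_sheet b p0 : orthonormal (signs 3) b ->
  (forall p, exists2 x, eform (signs 3) x x = -1 & sigma p = span_map b x) ->
  b 3%:R = sigma p0 ->
  forall p x, sigma p = span_map b x -> upper x.
Proof.
move=> ob sp b3.
have e2 : forall i, signs 3 i * signs 3 i = 1 :> R by exact: signs2.
pose t p := - complex.Re (mform (sigma p) (b 3%:R)).
have tE p x : sigma p = span_map b x -> x 0 3%:R = t p.
  by move=> /(orthonormal_real_coord e2 3%:R ob) ->; rewrite /signs /= mulN1r.
have t1 p : 1 <= t p * t p.
  have [x hx /tE <-] := sp p; move: hx; rewrite eform4E /signs /= !mul1r mulN1r.
  have sq i : 0 <= x 0 i * x 0 i by rewrite -expr2 sqr_ge0.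
  have := (sq 0, sq 1, sq 2%:R).
  move: (x 0 0 * _) (x 0 1 * _) (x 0 2%:R * _) (x 0 3%:R * _) => y0 y1 y2 y3 [[]].
  lra.
have ct p : {for p, continuous t}.
  by apply: continuousN; exact: continuous_mform_sigma.
have sgn p q : `|t p - t q| < 1 -> (0 < t p) = (0 < t q).
  have b1 (r : R) : 1 <= r * r -> 1 <= `|r|.
    move=> H; rewrite -(@ler_pXn2r _ 2) ?nnegrE // expr1n expr2 -normrM ger0_norm //.
    by rewrite -expr2 sqr_ge0.
  have hp := b1 _ (t1 p); have hq := b1 _ (t1 q) => H.
  case: (ltP 0 (t p)) hp => sp'; case: (ltP 0 (t q)) hq => sq' //.
    rewrite ler0_norm // gtr0_norm // => h1 h2; move: H; rewrite ltr_norml; lra.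
  rewrite gtr0_norm // ler0_norm // => h1 h2; move: H; rewrite ltr_norml; lra.
have [s Hs] : exists s, forall p, (0 < t p) = s.
  apply: (@surface_uniform _ _ _ (fun p s => (0 < t p) = s) p0); last by move=> p s s' <- <-.
  move=> p; exists (0 < t p).
  have near1 : \forall q \near p, `|t p - t q| < 1.
    by move/cvgrPdist_lt : (ct p) => /(_ 1 ltr01).
  by apply: filterS near1 => q /sgn ->.
have s1 : s = true.
  by rewrite -(Hs p0) /t b3 mform_sigma //= opprK ltr01.
by move=> p x /tE xE; rewrite /upper /= xE Hs s1.
Qed.

End Final.

(** Used to reorder the vectors of the adapted frame according to the signs of a model. *)
Definition perm4 (s : seq 'I_4) (i : 'I_4) : 'I_4 := nth 0 s i.

Lemma perm4_inj s : size s = 4%N -> uniq s -> injective (perm4 s).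
Proof.
move=> s4 us i j /eqP; rewrite /perm4 nth_uniq ?s4 //.
by move=> /eqP /val_inj.
Qed.

Theorem theorem6p6p2 (R : realType) (S : surface R)
    (sigma : S -> 'M[R[i]]_2) (Psi : S -> 'M[R[i]]_2)
    (sigma_adm : admissible sigma) (Psi_shape : shape_operator sigma Psi) :
  let iPsi := fun p : S => 'i *: Psi p in
  [/\ in_isometric_image sigma H3 (@pqform R 3 1) <->
        riemannian sigma /\ real_endo Psi,
      in_isometric_image sigma AdS3 (@pqform R 2 2) <->
        (riemannian sigma /\ real_endo iPsi) \/
        (signature11 sigma /\ real_endo Psi),
      in_isometric_image sigma dS3 (fun x y => - @pqform R 3 1 x y) <->
        (signature11 sigma /\ real_endo iPsi) \/
        (negative_definite sigma /\ real_endo Psi) &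
      in_isometric_image sigma S3 (fun x y => - @pqform R 4 0 x y) <->
        negative_definite sigma /\ real_endo iPsi].
Proof.
move=> iPsi; rewrite in_H3E in_AdS3E in_dS3E in_S3E.
have sg p i : (signs p i = 1 :> R) \/ (signs p i = -1 :> R).
  by rewrite /signs; case: ifP; [left|right].
have sgN p i : (- signs p i = 1 :> R) \/ (- signs p i = -1 :> R).
  by case: (sg p i) => ->; [right|left; rewrite opprK].
have [[p0 _]|noS] := pselect (exists p : S, True); last first.
  have noS' : S -> False by move=> p; apply: noS; exists p.
  have e1 : real_metric sigma by move=> p; case: (noS' p).
  have e2 : riemannian sigma by split => // p; case: (noS' p).
  have e3 : negative_definite sigma by split => // p; case: (noS' p).
  have e4 : signature11 sigma by split => // p; case: (noS' p).
  have e5 Q : @real_endo R S Q by move=> p; case: (noS' p).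
  split; split=> _; try by [split|left|left; split].
  - by apply: empty_in_image => //; exact: open_upper.
  - by apply: empty_in_image => //; exact: openT.
  - by apply: empty_in_image => //; exact: openT.
  - by apply: empty_in_image => //; exact: openT.
have PsiE : (fun p => 1 *: Psi p) = Psi by apply/funext => p; rewrite scale1r.
have k1 : ((1 : R) = 1 /\ (1 : R[i]) = 1) \/ ((1 : R) = -1 /\ (1 : R[i]) = 'i) by left.
have ki : ((-1 : R) = 1 /\ ('i : R[i]) = 1) \/ ((-1 : R) = -1 /\ ('i : R[i]) = 'i) by right.
have re1 : real_endo Psi -> real_endo (fun p => 1 *: Psi p) by rewrite PsiE.
have N11 : (1 : R) <> -1 by move/eqP; rewrite -subr_eq0 opprK -[1 + 1]/(2%:R) pnatr_eq0.
have rP := real_metricP sigma_adm.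
split; split.
- move=> im; have [rg [k [kappa [kk re HP]]]] :=
    image_signature sigma_adm Psi_shape (@signs2 R 3) open_upper im p0.
  have kc : k = 1 \/ k = -1 by case: kk => -[-> _]; [left|right].
  have [v [w [a [c [vw [vv ww] a0 c0 _]]]]] := metric_basis sigma_adm (rP.1 rg p0).
  have [Y YE] := HP p0 v w a c vw vv ww a0 c0.
  have [kE _ _] := hyperbolic_signs a0 c0 kc YE.
  case: kk => -[kE' kapE]; last by case: N11; exact: etrans (esym kE) kE'.
  rewrite kapE PsiE in re; split => //.
  apply: (riemannianI sigma_adm rg (P := fun a c => 0 < a /\ 0 < c)) => // p v' w' a' c'.
  move=> vw' vv' ww' a0' c0'; have [Y' YE'] := HP p v' w' a' c' vw' vv' ww' a0' c0'.
  by have [] := hyperbolic_signs a0' c0' kc YE'.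
- move=> [rm re]; have [v [w [a [c [vw vv ww a0 c0]]]]] := riemannian_basis sigma_adm p0 rm.
  (* In [perm4], [0] stands for [sigma], [1] and [2] for the tangent vectors and [3] for
     [kappa nu]; the order matches the signs of the model. *)
  have ip : injective (perm4 [:: 1; 2%:R; 3%:R; 0]).
    exact: perm4_inj.
  have Dp i : 0 < nth 0 [:: -1; a; c; 1] (perm4 [:: 1; 2%:R; 3%:R; 0] i) * signs 3 i.
    by move: i; apply: ord4_ind; rewrite /signs /=; lra.
  have [b [ob sp bp]] := shape_linear_image sigma_adm Psi_shape (sg 3%N) k1 rm.1 (re1 re)
    vw vv ww ip Dp.
  exists (span_map b); split.
    by apply: span_map_isometric_embedding => //; [exact: signs2 | exact: open_upper].
  move=> M [p _ <-]; have [x hx xE] := sp p; exists x => //; split => //.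
  have b3 : b 3%:R = sigma p0 by exact: bp.
  exact: (one_sheet sigma_adm ob sp b3 xE).
- move=> im; have [rg [k [kappa [kk re HP]]]] :=
    image_signature sigma_adm Psi_shape (@signs2 R 2) openT im p0.
  have kc : k = 1 \/ k = -1 by case: kk => -[-> _]; [left|right].
  case: kk => -[kE kapE]; rewrite kapE in re.
    right; rewrite PsiE in re; split => //.
    apply: (signature11I sigma_adm rg (P := fun a c => a * c < 0)) => // p v w a c.
    move=> vw vv ww a0 c0; have [Y YE] := HP p v w a c vw vv ww a0 c0.
    by case: (antidesitter_signs a0 c0 kc YE) => -[] //; rewrite kE => /N11.
  left; split => //.
  apply: (riemannianI sigma_adm rg (P := fun a c => 0 < a /\ 0 < c)) => // p v w a c.
  move=> vw vv ww a0 c0; have [Y YE] := HP p v w a c vw vv ww a0 c0.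
  by case: (antidesitter_signs a0 c0 kc YE) => -[] //; rewrite kE => /esym/N11.
- move=> [[rm re]|[rm re]].
    have [v [w [a [c [vw vv ww a0 c0]]]]] := riemannian_basis sigma_adm p0 rm.
    have ip : injective (perm4 [:: 1; 2%:R; 0; 3%:R]).
      exact: perm4_inj.
    apply: (shape_in_image sigma_adm Psi_shape (sg 2%N) ki rm.1 re vw vv ww ip) => i.
    by move: i; apply: ord4_ind; rewrite /signs /=; lra.
  have [v [w [a [c [vw vv ww a0 c0]]]]] := signature11_basis sigma_adm p0 rm.
  have ip : injective (perm4 [:: 1; 3%:R; 2%:R; 0]).
    exact: perm4_inj.
  apply: (shape_in_image sigma_adm Psi_shape (sg 2%N) k1 rm.1 (re1 re) vw vv ww ip) => i.
  by move: i; apply: ord4_ind; rewrite /signs /=; lra.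
- move=> im; have [rg [k [kappa [kk re HP]]]] :=
    image_signature sigma_adm Psi_shape (@signsN2 R 3) openT im p0.
  have kc : k = 1 \/ k = -1 by case: kk => -[-> _]; [left|right].
  case: kk => -[kE kapE]; rewrite kapE in re.
    right; rewrite PsiE in re; split => //.
    apply: (negative_definiteI sigma_adm rg (P := fun a c => a < 0 /\ c < 0)) => // p v w a c.
    move=> vw vv ww a0 c0; have [Y YE] := HP p v w a c vw vv ww a0 c0.
    by case: (desitter_signs a0 c0 kc YE) => -[] //; rewrite kE => /N11.
  left; split => //.
  apply: (signature11I sigma_adm rg (P := fun a c => a * c < 0)) => // p v w a c.
  move=> vw vv ww a0 c0; have [Y YE] := HP p v w a c vw vv ww a0 c0.
  by case: (desitter_signs a0 c0 kc YE) => -[] //; rewrite kE => /esym/N11.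
- move=> [[rm re]|[rm re]].
    have [v [w [a [c [vw vv ww a0 c0]]]]] := signature11_basis sigma_adm p0 rm.
    have ip : injective (perm4 [:: 2%:R; 0; 3%:R; 1]).
      exact: perm4_inj.
    apply: (shape_in_image sigma_adm Psi_shape (sgN 3%N) ki rm.1 re vw vv ww ip) => i.
    by move: i; apply: ord4_ind; rewrite /signs /=; lra.
  have [v [w [a [c [vw vv ww a0 c0]]]]] := negative_basis sigma_adm p0 rm.
  have ip : injective (perm4 [:: 1; 2%:R; 0; 3%:R]).
    exact: perm4_inj.
  apply: (shape_in_image sigma_adm Psi_shape (sgN 3%N) k1 rm.1 (re1 re) vw vv ww ip) => i.
  by move: i; apply: ord4_ind; rewrite /signs /=; lra.
- move=> im; have [rg [k [kappa [kk re HP]]]] :=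
    image_signature sigma_adm Psi_shape (@signsN2 R 4) openT im p0.
  have kc : k = 1 \/ k = -1 by case: kk => -[-> _]; [left|right].
  have [v [w [a [c [vw [vv ww] a0 c0 _]]]]] := metric_basis sigma_adm (rP.1 rg p0).
  have [Y YE] := HP p0 v w a c vw vv ww a0 c0.
  have [kE _ _] := spherical_signs a0 c0 kc YE.
  case: kk => -[kE' kapE]; first by case: N11; exact: etrans (esym kE') kE.
  rewrite kapE in re; split => //.
  apply: (negative_definiteI sigma_adm rg (P := fun a c => a < 0 /\ c < 0)) => // p v' w' a' c'.
  move=> vw' vv' ww' a0' c0'; have [Y' YE'] := HP p v' w' a' c' vw' vv' ww' a0' c0'.
  by have [] := spherical_signs a0' c0' kc YE'.
- move=> [rm re]; have [v [w [a [c [vw vv ww a0 c0]]]]] := negative_basis sigma_adm p0 rm.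
  have ip : injective (perm4 [:: 0; 1; 2%:R; 3%:R]).
    exact: perm4_inj.
  apply: (shape_in_image sigma_adm Psi_shape (sgN 4%N) ki rm.1 re vw vv ww ip) => i.
  by move: i; apply: ord4_ind; rewrite /signs /=; lra.
Qed.
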